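(* Consider the negative binomial regression with loss $\ell(u,y)=-yu+(y+k)\log(k+e^u)$ and assumptions (C.1)–(C.3), with the notation given in the context. Let $0<\delta<1$, $$M_{BX}=M_Y+\frac{B}{\log2},\qquad R_n:=\frac{6M_{BX}M_X}{C_{\min}}\left[\sqrt{\frac{2p}{n}\log\Big(\frac{2p}{\delta}\Big)}+\frac1n\sqrt{p\log\Big(\frac{2p}{\delta}\Big)}\right]\log^{1/\theta}\Big(\frac{2np}{\delta}\Big),$$ and $\boldsymbol{b}:=(k/n)M_X^2(1,\dots,1)^\top\in\mathbb{R}^n$. Let, with $t=C_{\min}/4$, $$c_n:=\exp\left\{-\frac14\left(\frac{nt^2}{2M_X^4\log^{4/\theta}(\frac{2np}{\delta})M_{BX}^2}\wedge\frac{nt}{M_X^2\log^{2/\theta}(\frac{2np}{\delta})M_{BX}}\right)\right\}+\exp\left\{-\left(\frac{t^{\theta/2}}{[4eC(\theta/2)\|\boldsymbol{b}\|_2L_n(\theta/2,\boldsymbol{b})]^{\theta/2}}\wedge\frac{t^2}{16e^2C^2(\theta/2)\|\boldsymbol{b}\|_2^2}\right)\right\}.$$ Under the event $\mathcal{F}_1\cap\mathcal{F}_2\cap\mathcal{F}_{\max}$, if the sample size $n$ satisfies $$R_nI_n\le\frac{\log(4/3)}{3},$$ then (with $\mathrm{P}$ the unconditional probability) $$\mathrm{P}\big(\|\hat\beta_n-\beta^*\|_2\le R_n\big)\ge1-2p^2c_n-\delta-\varepsilon_n .$$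
   Context: Setting: i.i.d. $\{(X_i,Y_i)\}_{i=1}^n\sim(X,Y)\in\mathbb{R}^p\times\mathbb{N}$, $X_i=(X_{i1},\dots,X_{ip})^\top$; $k>0$ is a known dispersion parameter ($Y_i$ negative binomial with mean $e^{X_i^\top\beta^*}$ given $X_i$); $\hat\beta_n:=\arg\min_{\beta\in\mathbb{R}^p}\frac1n\sum_{i=1}^n\ell(X_i^\top\beta,Y_i)$ and $\beta^*:=\arg\min_{\beta\in\mathbb{R}^p}\mathrm{E}\,\ell(X^\top\beta,Y)$. The empirical Hessian is $$\hat{\mathcal Q}_n(\beta)=\frac1n\sum_{i=1}^n\frac{(Y_i+k)ke^{X_i^\top\beta}X_iX_i^\top}{(k+e^{X_i^\top\beta})^2}.$$ Sub-Weibull norm: $\|Z\|_{\psi_\theta}:=\inf\{C>0:\mathrm{E}\exp(|Z|^\theta/C^\theta)\le2\}$. Assumptions. (C.1) For $M_Y,M_X>0$: $\max_{1\le i\le n}\|Y_i\|_{\psi_1}\le M_Y$ and $\max_{1\le i\le n,1\le j\le p}\|X_{ij}\|_{\psi_\theta}\le M_X$ for some $0<\theta<1$. (C.2) The vector $X_i$ is sparse or bounded, in the following sense: let $\mathcal{F}_Y:=\{\max_{1\le i\le n}\mathrm{E}Y_i=\max_{1\le i\le n}e^{X_i^\top\beta^*}\le B,\ \max_{1\le i\le n}\|X_i\|_2\le I_n\}$ with $I_n$ a slowly increasing function of $n$ (here $\mathrm{E}Y_i$ is the mean given $X_i$); then $\mathrm{P}(\mathcal{F}_Y^c)=\varepsilon_n\to0$.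 (C.3) $b^\top\mathrm{E}(\hat{\mathcal Q}_n(\beta^* ))b\ge C_{\min}$ for all $b\in S^{p-1}$ (unit Euclidean sphere), where $C_{\min}>0$. Events: $\mathcal{F}_{\max}=\{\max_{1\le i\le n,1\le j\le p}|X_{ij}|\le M_X\log^{1/\theta}(2np/\delta)\}\cap\mathcal{F}_Y$; $$\mathcal{F}_1=\left\{\max_{l,j}\left|\frac1n\sum_{i=1}^n\left[\frac{Y_ike^{X_i^\top\beta^*}X_{il}X_{ij}}{(k+e^{X_i^\top\beta^*})^2}-\mathrm{E}\left(\frac{Y_ike^{X_i^\top\beta^*}X_{il}X_{ij}}{(k+e^{X_i^\top\beta^*})^2}\right)\right]\right|\le\frac{C_{\min}}4\right\},$$ $$\mathcal{F}_2=\left\{\max_{l,j}\left|\frac1n\sum_{i=1}^n\left[\frac{ke^{X_i^\top\beta^*}X_{il}X_{ij}}{(k+e^{X_i^\top\beta^*})^2}-\mathrm{E}\left(\frac{ke^{X_i^\top\beta^*}X_{il}X_{ij}}{(k+e^{X_i^\top\beta^*})^2}\right)\right]\right|\le\frac{C_{\min}}4\right\}.$$ Constants, for $0<\tau\le1$ (used with $\tau=\theta/2$): $C(\tau)=2\big[(\log2)^{1/\tau}+e^3\big(\Gamma^{1/2}(\frac2\tau+1)+3^{\frac{2-\tau}{3\tau}}\sup_{p\ge2}p^{-1/\tau}\Gamma^{1/p}(\frac p\tau+1)\big)\big]$; $L_n(\tau,\boldsymbol{b})=\gamma^{2/\tau}A(\tau)\|\boldsymbol{b}\|_\infty/\|\boldsymbol{b}\|_2$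 with $$A(\tau)=\inf_{p\ge2}\frac{e^33^{\frac{2-\tau}{3\tau}}p^{-1/\tau}\Gamma^{1/p}(\frac p\tau+1)}{C(\tau)}$$ (in these formulas $p$ is a bound variable), and $\gamma\approx1.78$ the smallest element of $\{k>1:e^{2k^{-2}}-1+\frac{e^{2(1-k^2)/k^2}}{k^2-1}\le1\}$ (here $k$ is a bound variable). $\log^{a}(x)=(\log x)^a$, $x\wedge y=\min(x,y)$. *)

(* Defs.v *)
From HB Require Import structures.
From mathcomp Require Import all_boot all_order all_algebra.
From mathcomp Require Import all_classical all_reals all_analysis.

Set Implicit Arguments.
Unset Strict Implicit.
Unset Printing Implicit Defensive.
Import Order.TTheory GRing.Theory Num.Theory.
Import numFieldNormedType.Exports.

Local Open Scope classical_set_scope.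
Local Open Scope ring_scope.

(* Vectors of R^p are columns.  In the library the product sigma-algebra of R^p
   is carried by p.-tuple R, so measurability goes through [cvtuple]. *)
Definition cvtuple (R : realType) (p : nat) (x : 'cV[R]_p) : p.-tuple R :=
  [tuple x j 0 | j < p].

Definition dotv (R : realType) (p : nat) (x b : 'cV[R]_p) : R := (x^T *m b) 0 0.

Definition norm2 (R : realType) (p : nat) (x : 'cV[R]_p) : R :=
  Num.sqrt (\sum_j x j 0 ^+ 2).

Definition is_argmin (U : Type) (disp : Order.disp_t) (V : porderType disp)
    (f : U -> V) (x : U) : Prop :=
  forall y, (f x <= f y)%O.

Section Probability.
Context (R : realType) (d : measure_display) (T : measurableType d).
Variable P : probability T R.

Definition mutually_independent (d' : measure_display) (S : measurableType d')
    (Z : nat -> T -> S) : Prop :=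
  forall (J : seq nat) (A : nat -> set S), uniq J ->
    (forall i, measurable (A i)) ->
    P (\bigcap_(i in [set` J]) (Z i @^-1` A i)) =
    (\prod_(i <- J) P (Z i @^-1` A i))%E.

Definition same_law (d' : measure_display) (S : measurableType d')
    (Z Z' : T -> S) : Prop :=
  forall A : set S, measurable A -> P (Z @^-1` A) = P (Z' @^-1` A).

(* The infimum is taken in the extended reals, so that the norm is +oo when no
   admissible C exists. *)
Definition subweibull_norm (theta : R) (Z : T -> R) : \bar R :=
  ereal_inf [set C%:E | C in
    [set C : R | 0 < C /\
      ('E_P[(fun w => expR (`|Z w| `^ theta / C `^ theta))%R] <= 2%:E)%E]].

End Probability.

(* Negative binomial law with mean m and dispersion k (variance m + m^2/k); the
   product is Gamma(y + k) / Gamma(k). *)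
Definition nb_pmf (R : realType) (k m : R) (y : nat) : R :=
  (\prod_(j < y) (k + j%:R)) / y`!%:R
  * (k / (k + m)) `^ k * (m / (k + m)) ^+ y.

Definition nb_loss (R : realType) (k u : R) (y : nat) : R :=
  - (y%:R * u) + (y%:R + k) * ln (k + expR u).

Section Model.
Context (R : realType) (d : measure_display) (T : measurableType d).
Variables (P : probability T R) (p : nat).

Definition obs (X : T -> 'cV[R]_p) (Y : T -> nat) (w : T) : p.-tuple R * nat :=
  (cvtuple (X w), Y w).

Definition iid_sample (Xs : nat -> T -> 'cV[R]_p) (Ys : nat -> T -> nat)
    (X : T -> 'cV[R]_p) (Y : T -> nat) : Prop :=
  [/\ measurable_fun setT (obs X Y),
      forall i, measurable_fun setT (obs (Xs i) (Ys i)),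
      mutually_independent P (fun i => obs (Xs i) (Ys i)) &
      forall i, same_law P (obs (Xs i) (Ys i)) (obs X Y)].

(* The conditional law of Y given X is the negative binomial law of mean
   exp(X^T beta), i.e. the pmf is a version of P(Y = y | sigma(X)). *)
Definition nb_given (k : R) (beta : 'cV[R]_p)
    (X : T -> 'cV[R]_p) (Y : T -> nat) : Prop :=
  forall (A : set (p.-tuple R)) (y : nat), measurable A ->
    P [set w | A (cvtuple (X w)) /\ Y w = y] =
    (\int[P]_(w in [set w | A (cvtuple (X w))])
       (nb_pmf k (expR (dotv (X w) beta)) y)%:E)%E.

Definition population_risk (k : R) (X : T -> 'cV[R]_p) (Y : T -> nat)
    (beta : 'cV[R]_p) : \bar R :=
  'E_P[(fun w => nb_loss k (dotv (X w) beta) (Y w))%R]%E.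

Definition empirical_risk (k : R) (Xs : nat -> T -> 'cV[R]_p)
    (Ys : nat -> T -> nat) (n : nat) (w : T) (beta : 'cV[R]_p) : R :=
  n%:R^-1 * \sum_(i < n) nb_loss k (dotv (Xs i w) beta) (Ys i w).

(* An empirical minimizer need not exist (e.g. when all the Y_i vanish): the
   estimator is a measurable map that is a minimizer whenever there is one, and
   is unconstrained otherwise. *)
Definition is_estimator (k : R) (Xs : nat -> T -> 'cV[R]_p)
    (Ys : nat -> T -> nat) (n : nat) (betahat : T -> 'cV[R]_p) : Prop :=
  measurable_fun setT (fun w => cvtuple (betahat w)) /\
  forall w, (exists beta, is_argmin (empirical_risk k Xs Ys n w) beta) ->
    is_argmin (empirical_risk k Xs Ys n w) (betahat w).

Definition empirical_hessian (k : R) (Xs : nat -> T -> 'cV[R]_p)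
    (Ys : nat -> T -> nat) (n : nat) (beta : 'cV[R]_p) (w : T) : 'M[R]_p :=
  n%:R^-1 *: \sum_(i < n)
    (((Ys i w)%:R + k) * k * expR (dotv (Xs i w) beta)
       / (k + expR (dotv (Xs i w) beta)) ^+ 2)
    *: (Xs i w *m (Xs i w)^T).

Definition expectation_mx (M : T -> 'M[R]_p) : 'M[R]_p :=
  \matrix_(l, j) fine ('E_P[fun w => M w l j])%E.

Definition tail_condition (theta MX MY : R) (Xs : nat -> T -> 'cV[R]_p)
    (Ys : nat -> T -> nat) (n : nat) : Prop :=
  (forall i, (i < n)%N ->
     (subweibull_norm P 1 (fun w => (Ys i w)%:R)%R <= MY%:E)%E) /\
  (forall i (j : 'I_p), (i < n)%N ->
     (subweibull_norm P theta (fun w => Xs i w j 0)%R <= MX%:E)%E).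

Definition bounded_design_event (betastar : 'cV[R]_p) (B In : R)
    (Xs : nat -> T -> 'cV[R]_p) (n : nat) : set T :=
  [set w | (forall i, (i < n)%N -> expR (dotv (Xs i w) betastar) <= B) /\
           (forall i, (i < n)%N -> norm2 (Xs i w) <= In)].

Definition hessian_condition (k Cmin : R) (betastar : 'cV[R]_p)
    (Xs : nat -> T -> 'cV[R]_p) (Ys : nat -> T -> nat) (n : nat) : Prop :=
  forall b : 'cV[R]_p, norm2 b = 1 ->
    Cmin <= (b^T *m expectation_mx (empirical_hessian k Xs Ys n betastar)
               *m b) 0 0.

End Model.

Section Constants.
Context (R : realType).

Definition Gamma (z : R) : R :=
  \int[@lebesgue_measure R]_(x in `]0, +oo[) (x `^ (z - 1) * expR (- x)).

Definition gamma_moment (tau q : R) : R :=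
  q `^ (- (1 / tau)) * Gamma (q / tau + 1) `^ (1 / q).

Definition C_const (tau : R) : R :=
  2 * (ln 2 `^ (1 / tau)
       + expR 3 * (Gamma (2 / tau + 1) `^ (1 / 2)
                   + 3 `^ ((2 - tau) / (3 * tau))
                     * sup [set gamma_moment tau q | q in [set q | 2 <= q]])).

Definition A_const (tau : R) : R :=
  inf [set expR 3 * 3 `^ ((2 - tau) / (3 * tau)) * gamma_moment tau q
           / C_const tau | q in [set q | 2 <= q]].

(* The infimum is attained, at about 1.78: the left-hand side is continuous on
   x > 1 and tends to +oo at 1. *)
Definition gamma_const : R :=
  inf [set x : R | 1 < x /\
    expR (2 * x ^- 2) - 1
    + expR (2 * (1 - x ^+ 2) / x ^+ 2) / (x ^+ 2 - 1) <= 1].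

(* [`|b|] is the library's norm on matrices, the sup norm. *)
Definition L_const (n : nat) (tau : R) (b : 'cV[R]_n) : R :=
  gamma_const `^ (2 / tau) * A_const tau * `|b| / norm2 b.

Definition M_BX (MY B : R) : R := MY + B / ln 2.

Definition rate (n p : nat) (theta delta MX MY B Cmin : R) : R :=
  6 * M_BX MY B * MX / Cmin
  * (Num.sqrt (2 * p%:R / n%:R * ln (2 * p%:R / delta))
     + n%:R^-1 * Num.sqrt (p%:R * ln (2 * p%:R / delta)))
  * ln (2 * n%:R * p%:R / delta) `^ (1 / theta).

Definition bvec (n : nat) (k MX : R) : 'cV[R]_n :=
  const_mx (k / n%:R * MX ^+ 2).

Definition c_const (n p : nat) (k theta delta MX MY B Cmin : R) : R :=
  let t := Cmin / 4 in
  let b := bvec n k MX in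
  let logn := ln (2 * n%:R * p%:R / delta) in
  let C := C_const (theta / 2) in
  expR (- (1 / 4 *
    Num.min (n%:R * t ^+ 2
             / (2 * MX ^+ 4 * logn `^ (4 / theta) * M_BX MY B ^+ 2))
            (n%:R * t / (MX ^+ 2 * logn `^ (2 / theta) * M_BX MY B))))
  + expR (- Num.min
      (t `^ (theta / 2)
       / (4 * expR 1 * C * norm2 b * L_const (theta / 2) b) `^ (theta / 2))
      (t ^+ 2 / (16 * expR 1 ^+ 2 * C ^+ 2 * norm2 b ^+ 2))).

End Constants.

(* Main.v *)
(** The loss is convex in the linear predictor, so the estimator lies within [r = rate]
    of the true parameter as soon as the risk increases along every ray where it meets
    the sphere of radius [r]. On the design event, [r * In <= 1 / 9] makes the derivative
    of the loss nearly linear over that distance, and it is enough that the score at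
    the true parameter is at most [3 / 5 * Cmin * r] in norm while the Hessian there is
    at least [27 / 32 * Cmin]. Both are controlled entrywise by Chernoff bounds: the
    moment generating function of the negative binomial law is bounded conditionally on
    the covariate, which is first truncated to the ball of radius [In].

    If the lower bound to be proved is positive, then [2 * p ^ 2 * c_const < 1]. The first
    term of [c_const] then forces [n] to be large against the fourth power of the
    sub-Weibull scale, the second forces [ln (2 * n * p / delta) >= 2 / theta], the range
    in which the sub-Weibull tail yields sharp truncated second moments. Since
    [1 - eps n] is the [n]-th power of the probability that one covariate is in the
    design set, its positivity also bounds the bias due to truncation. *)

Require Import Defs.
From HB Require Import structures.
From mathcomp Require Import all_boot all_order all_algebra.
From mathcomp Require Import all_classical all_reals all_analysis.
From mathcomp Require Import measurable_realfun.
From mathcomp Require Import ring lra.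
Import Order.TTheory GRing.Theory Num.Theory.
Import numFieldNormedType.Exports.
Import HBNNSimple.
Local Open Scope classical_set_scope.
Local Open Scope ring_scope.

Set Implicit Arguments.
Unset Strict Implicit.
Unset Printing Implicit Defensive.

(** * Weighted integrals and independence *)

(** The negative binomial law has exponential moments only near 0, so every Chernoff step has to be
    small against the radius [In n]. In the other direction, the trace of the Hessian bounds [In n]
    from below; the two bounds together keep a factor [p] out of the truncation bias. The deviation
    events are charged to [delta] alone: there are [2 * p + 2 * p ^ 2] of them, each of probability
    at most [(delta / (2 * p)) ^ 2]. Leaving the design event costs [eps n]. Conditions stated for
    every sample size are also used away from the fixed [n]: the limit of [eps] makes the
    conditional mean at most [B] almost surely, and the tail and Hessian conditions at size 1 speak
    of a single observation. Conditional expectations are bounded through partial sums over the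
    values of the count, so no series is ever evaluated. *)

Lemma ge0_integral_weight_approx (R : realType) d (T : measurableType d)
  (mu : {measure set T -> \bar R}) d' (S : measurableType d')
  (W : T -> R) (Z : T -> S) (g : S -> \bar R)
  (mg : measurable_fun setT g) :
  measurable_fun setT W -> (forall t, 0 <= W t) ->
  measurable_fun setT Z -> (forall s, 0 <= g s)%E ->
  (\int[mu]_t ((W t)%:E * g (Z t)) =
   limn (fun n => \sum_(r \in range (nnsfun_approx measurableT mg n))
     r%:E * \int[mu]_t ((W t)%:E *
        (\1_(nnsfun_approx measurableT mg n @^-1` [set r]) (Z t))%:E)))%E.
Proof.
move=> mW W0 mZ g0; set h := nnsfun_approx measurableT mg.
have mhZ n : measurable_fun setT (fun t => (h n (Z t))%:E).
  by apply/measurable_EFinP; apply: measurableT_comp.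
transitivity (lim ((\int[mu]_t ((W t)%:E * (h n (Z t))%:E))%E @[n --> \oo])).
  rewrite -monotone_convergence//.
  - apply: eq_integral => t _; apply/esym/cvg_lim => //.
    apply: cvgeZl => //.
    by apply: (cvg_nnsfun_approx measurableT mg).
  - by move=> n; apply: emeasurable_funM => //; apply/measurable_EFinP.
  - by move=> n t _; rewrite mule_ge0// lee_fin.
  - move=> t _ a b ab; rewrite lee_wpmul2l// ?lee_fin//.
    exact/lefP/nd_nnsfun_approx.
congr (lim (_ @ \oo)); apply/funext => n.
have mI (r : R) : measurable_fun setT (fun t => (\1_(h n @^-1` [set r]) (Z t) : R)).
  by apply: (measurableT_comp (f := \1_(h n @^-1` [set r]) : S -> R)) => //; apply: measurable_indic.
transitivity (\int[mu]_t (\sum_(r \in range (h n)) (r%:E * ((W t)%:E *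
      (\1_(h n @^-1` [set r]) (Z t))%:E))))%E.
  apply: eq_integral => t _.
  rewrite fimfunE -fsumEFin// ge0_mule_fsumr; last first.
    by move=> r; rewrite nnfun_muleindic_ge0.
  by apply: eq_fsbigr => r _; rewrite EFinM muleCA.
rewrite ge0_integral_fsum//.
- apply: eq_fsbigr => r; rewrite inE => -[s _ <-].
  rewrite ge0_integralZl_EFin//.
  + by move=> t _; rewrite mule_ge0// lee_fin.
  + by apply: emeasurable_funM; apply/measurable_EFinP.
- move=> r; apply: emeasurable_funM => //.
  by apply: emeasurable_funM; apply/measurable_EFinP.
- move=> r t _; have [r0|r0] := leP 0 r.
    by rewrite !mule_ge0// lee_fin.
  by rewrite preimage_nnfun0// indic0 /= !mule0.
Qed.

(** By simple approximation the integral sees the weight only through indicators of [Z]. The same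
    principle gives independence (weight: the other factors), the conditional law (weight: an
    indicator of the count against its mass function) and equality in law (weight 1). *)
Lemma ge0_integral_weight_eq (R : realType) d (T : measurableType d)
  (mu mu' : {measure set T -> \bar R}) d' (S : measurableType d')
  (W W' : T -> R) (Z Z' : T -> S) (g : S -> \bar R) :
  measurable_fun setT W -> (forall t, 0 <= W t) ->
  measurable_fun setT W' -> (forall t, 0 <= W' t) ->
  measurable_fun setT Z -> measurable_fun setT Z' ->
  measurable_fun setT g -> (forall s, 0 <= g s)%E ->
  (forall A, measurable A ->
     \int[mu]_t ((W t)%:E * (\1_A (Z t))%:E) =
     \int[mu']_t ((W' t)%:E * (\1_A (Z' t))%:E))%E ->
  (\int[mu]_t ((W t)%:E * g (Z t)) = \int[mu']_t ((W' t)%:E * g (Z' t)))%E.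
Proof.
move=> mW W0 mW' W'0 mZ mZ' mg g0 AE.
rewrite (ge0_integral_weight_approx _ mg)// (ge0_integral_weight_approx _ mg)//.
congr (lim (_ @ \oo)); apply/funext => n; apply: eq_fsbigr => r _.
by rewrite AE.
Qed.

(* The factors are turned into indicators one at a time: the induction is on the
   number of factors that are not indicators. *)
Lemma integral_prod_independent (R : realType) d (T : measurableType d)
  (P : probability T R) d' (S : measurableType d') (Z : nat -> T -> S)
  (n : nat) (g : nat -> S -> R) (c : nat -> R) :
  (forall i, measurable_fun setT (Z i)) ->
  mutually_independent P Z ->
  (forall i, measurable_fun setT (g i)) -> (forall i s, 0 <= g i s) ->
  (forall i, \int[P]_t (g i (Z i t))%:E = (c i)%:E)%E ->
  (\int[P]_t (\prod_(i < n) g i (Z i t))%:E = (\prod_(i < n) c i)%:E)%E.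
Proof.
move=> mZ indep.
have gen k : (k <= n)%N -> forall (g : nat -> S -> R) (c : nat -> R),
    (forall i, measurable_fun setT (g i)) -> (forall i s, 0 <= g i s) ->
    (forall i, \int[P]_t (g i (Z i t))%:E = (c i)%:E)%E ->
    (forall i, (k <= i)%N -> exists2 A, measurable A & g i = \1_A) ->
  (\int[P]_t (\prod_(i < n) g i (Z i t))%:E = (\prod_(i < n) c i)%:E)%E.
  elim: k => [_|k IH kn] {}g {}c mg g0 gc gI.
    have /choice[A mA] : forall i, exists A, measurable A /\ g i = \1_A.
      by move=> i; have [A ? ?] := gI i (leq0n _); exists A.
    have mZA i : measurable (Z i @^-1` A i).
      by rewrite -[X in measurable X]setTI; apply: mZ => //; case: (mA i).
    have -> : (fun t => (\prod_(i < n) g i (Z i t))%:E) =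
        (EFin \o \1_(\bigcap_(i in [set` iota 0 n]) (Z i @^-1` A i))).
      apply/funext => t /=; congr EFin.
      rewrite indicE; case: (boolP (t \in _)) => [|] /=.
        rewrite inE => tA; rewrite big1// => i _; case: (mA i) => _ ->.
        by rewrite indicE mem_set//; apply: tA => /=; rewrite mem_iota add0n ltn_ord.
      move=> tA; apply/eqP; rewrite prodf_seq_eq0; apply/hasP.
      apply: contrapT => H; move/negP: tA; apply; rewrite inE => i /=.
      rewrite mem_iota add0n => /= ni; apply: contrapT => nA; apply: H.
      exists (Ordinal ni); rewrite ?mem_index_enum//=.
      by case: (mA i) => _ ->; rewrite indicE memNset.
    rewrite integral_indic//; last first.
      by apply: bigcap_measurableType => //.
    rewrite setIT.
    transitivity (\prod_(i <- iota 0 n) P (Z i @^-1` A i))%E.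
      by apply: indep => [|i]; [exact: iota_uniq|case: (mA i)].
    rewrite -prodEFin -(big_mkord xpredT (fun i => (c i)%:E)) /index_iota subn0.
    apply: eq_bigr => i _; rewrite -gc.
    have -> : (fun t => (g i (Z i t))%:E) = (EFin \o \1_(Z i @^-1` A i)).
      by apply/funext => t; case: (mA i) => _ ->; rewrite /= !indicE.
    by rewrite integral_indic// setIT.
  pose ko := Ordinal kn.
  pose W t := \prod_(i < n | i != ko) g i (Z i t).
  pose C := \prod_(i < n | i != ko) c i.
  have c0 i : 0 <= c i.
    by rewrite -lee_fin -gc; apply: integral_ge0 => t _; rewrite lee_fin.
  have WE t : \prod_(i < n) g i (Z i t) = W t * g k (Z k t).
    by rewrite (bigD1 ko)//= mulrC.
  have CE : \prod_(i < n) c i = C * c k by rewrite (bigD1 ko)//= mulrC.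
  under eq_integral do rewrite WE EFinM.
  rewrite CE EFinM.
  have mW : measurable_fun setT W.
    rewrite /W; under eq_fun do rewrite -big_filter.
    apply: measurable_prod => i _; exact: measurableT_comp.
  rewrite -gc -ge0_integralZl_EFin//; last 3 first.
  - by move=> t _; rewrite lee_fin.
  - by apply/measurable_EFinP; exact: measurableT_comp.
  - by apply: prodr_ge0.
  (* Both sides integrate [g k (Z k)], weighted by the other factors and by the constant [C]. On
     indicators they agree by the induction hypothesis, in which the indicator takes the place of
     [g k]. *)
  apply: (ge0_integral_weight_eq (W' := cst C) (g := fun s => (g k s)%:E)) => //.
  - by move=> t; apply: prodr_ge0.
  - by move=> t; apply: prodr_ge0.
  - by apply/measurable_EFinP.
  - by move=> s; rewrite lee_fin.
  move=> A mA.
  pose g' i := if i == k then \1_A else g i.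
  pose a := fine (P (Z k @^-1` A)).
  have mZA : measurable (Z k @^-1` A).
    by rewrite -[X in measurable X]setTI; apply: mZ.
  have aE : (\int[P]_t (\1_A (Z k t))%:E = a%:E)%E.
    rewrite [LHS](_ : _ = \int[P]_t (\1_(Z k @^-1` A) t)%:E)%E.
      by rewrite integral_indic// setIT /a fineK// fin_num_measure.
    by apply: eq_integral => t _; rewrite !indicE.
  pose c' i := if i == k then a else c i.
  have cE' : (\prod_(i < n) c' i) = C * a.
    rewrite (bigD1 ko)//= mulrC /c' eqxx; congr (_ * _).
    by apply: eq_bigr => i /negPf; rewrite -val_eqE /= => ->.
  have gE' : (fun t => (\prod_(i < n) g' i (Z i t))%:E) =
      (fun t => ((W t)%:E * (\1_A (Z k t))%:E)%E).
    apply/funext => t; rewrite (bigD1 ko)//= mulrC EFinM {2}/g' eqxx.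
    congr (_%:E * _)%E; apply: eq_bigr => i /negPf.
    by rewrite -val_eqE /= /g' => ->.
  rewrite -gE' (IH (ltnW kn) g' c') ?cE'.
  - rewrite /cst ge0_integralZl_EFin//; first by rewrite aE EFinM.
    + by apply/measurable_EFinP; apply: (measurableT_comp (f := \1_A : S -> R)) => //; apply: measurable_indic.
    + by apply: prodr_ge0.
  - by move=> i; rewrite /g'; case: ifP => // _; apply: measurable_indic.
  - by move=> i s; rewrite /g'; case: ifP => // _; rewrite indicE.
  - by move=> i; rewrite /g' /c'; case: eqP => [->|].
  - move=> i ki; rewrite /g'; case: eqP => [|/eqP ik]; first by exists A.
    by apply: gI; rewrite ltn_neqAle eq_sym ik.
move=> mg g0 gc.
(* From index [n] on the factors become the constant 1, which is an indicator, so that [gen] applies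
   with [k = n]. *)
pose g1 i := if (i < n)%N then g i else \1_setT.
pose c1 i := if (i < n)%N then c i else 1.
have -> : \prod_(i < n) c i = \prod_(i < n) c1 i.
  by apply: eq_bigr => i _; rewrite /c1 ltn_ord.
have -> : (fun t => (\prod_(i < n) g i (Z i t))%:E) =
    (fun t => (\prod_(i < n) g1 i (Z i t))%:E).
  by apply/funext => t; congr EFin; apply: eq_bigr => i _; rewrite /g1 ltn_ord.
apply: (gen n) => // i; rewrite /g1 /c1.
- by case: ifP => // _; apply: measurable_indic.
- by case: ifP => // _ s; rewrite indicE.
- case: ifP => // _.
  have -> : (fun t => (\1_setT (Z i t))%:E) = cst 1%:E :> (T -> \bar R).
    by apply/funext => t /=; rewrite indicT.
  by rewrite integral_cst// mul1e; exact: probability_setT.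
- by move=> ni; rewrite ltnNge ni/=; exists setT.
Qed.

(** Markov's inequality for the exponential of the sum, whose expectation factors by independence;
    [kappa] bounds the cumulant of one term. *)
Lemma chernoff_independent (R : realType) d (T : measurableType d)
  (P : probability T R) d' (S : measurableType d') (Z : nat -> T -> S)
  (n : nat) (f : S -> R) (kappa a : R) :
  (forall i, measurable_fun setT (Z i)) ->
  mutually_independent P Z -> measurable_fun setT f ->
  (forall i, \int[P]_t (expR (f (Z i t)))%:E <= (expR kappa)%:E)%E ->
  (P [set t | (n%:R * kappa + a <= \sum_(i < n) f (Z i t))%R]
    <= (expR (- a))%:E)%E.
Proof.
move=> mZ indep mf fk; set E := [set t | _].
have mexpf : measurable_fun setT (fun s => expR (f s)).
  by apply: measurableT_comp.
have mE : measurable E.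
  rewrite -[E]setTI; apply: measurable_fun_le => //.
  by apply: measurable_sum => i; exact: measurableT_comp.
pose c i := fine (\int[P]_t (expR (f (Z i t)))%:E)%E.
have cE i : (\int[P]_t (expR (f (Z i t)))%:E = (c i)%:E)%E.
  rewrite fineK// ge0_fin_numE; last first.
    by apply: integral_ge0 => t _; rewrite lee_fin expR_ge0.
  by rewrite (le_lt_trans (fk i))// ltry.
have := integral_prod_independent n mZ indep (fun=> mexpf)
  (fun _ s => expR_ge0 (f s)) cE.
have ck : \prod_(i < n) c i <= expR (n%:R * kappa).
  rewrite expRM_natl -[n in X in _ <= X]card_ord -prodr_const.
  apply: ler_prod => i _; rewrite -!lee_fin -cE fk andbT.
  by apply: integral_ge0 => t _; rewrite lee_fin expR_ge0.
move=> intE.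
have : (\int[P]_t (expR (n%:R * kappa + a) * \1_E t)%:E <=
        (expR (n%:R * kappa))%:E)%E.
  apply: (@le_trans _ _ (\prod_(i < n) c i)%:E); last by rewrite lee_fin.
  rewrite -intE; apply: ge0_le_integral => //=.
  - apply/measurable_EFinP; apply: measurable_funM => //.
  - apply/measurable_EFinP; apply: measurable_prod => i _.
    exact: (measurableT_comp mexpf).
  - move=> t _; rewrite lee_fin indicE; case: (boolP (t \in E)) => tE; last first.
      by rewrite mulr0 prodr_ge0// => i _; exact: expR_ge0.
    by rewrite mulr1 -expR_sum ler_expR; move: tE; rewrite inE.
under eq_integral do rewrite EFinM.
rewrite ge0_integralZl_EFin//; last first.
  by apply/measurable_EFinP; exact: measurable_indic.
rewrite integral_indic// setIT expRD EFinM muleAC => H.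
rewrite expRN -(@lee_pmul2l _ (expR (n%:R * kappa) * expR a)%:E)//; last first.
  by rewrite lte_fin mulr_gt0 ?expR_gt0.
by rewrite -EFinM mulrK ?unitfE ?gt_eqF ?expR_gt0// EFinM muleAC.
Qed.

(** * Integration against the conditional law of the count *)

Section nb_conditional.
Context (R : realType) (d : measure_display) (T : measurableType d).
Variables (P : probability T R) (p : nat) (k : R) (beta : 'cV[R]_p).
Hypothesis k_gt0 : 0 < k.

(** The counterpart of [dotv] on tuples, which carry the sigma-algebra. *)
Definition tdot (x : p.-tuple R) : R := \sum_j tnth x j * beta j 0.

Lemma tdotE (x : 'cV[R]_p) : tdot (cvtuple x) = dotv x beta.
Proof.
rewrite /tdot /dotv mxE; apply: eq_bigr => j _.
by rewrite tnth_mktuple !mxE.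
Qed.

Lemma measurable_tdot : measurable_fun setT tdot.
Proof.
by apply: measurable_sum => j; apply: measurable_funM => //; exact: measurable_tnth.
Qed.

Lemma nb_pmf_ge0 m y : 0 <= m -> 0 <= nb_pmf k m y.
Proof.
move=> m0; rewrite /nb_pmf !mulr_ge0 ?powR_ge0 ?invr_ge0 ?exprn_ge0//.
- by apply: prodr_ge0 => j _; rewrite addr_ge0// ltW.
- by rewrite divr_ge0// addr_ge0// ltW.
Qed.

Lemma measurable_funV d' (S : measurableType d') (f : S -> R) :
  measurable_fun setT f -> (forall s, 0 < f s) ->
  measurable_fun setT (fun s => (f s)^-1).
Proof.
move=> mf f0.
rewrite (_ : (fun s => (f s)^-1) = (fun s => f s `^ (-1))).
  by apply: (measurableT_comp (measurable_powR (-1))).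
by apply/funext => s; rewrite powR_inv1// ltW.
Qed.

Lemma measurable_nb_pmf y :
  measurable_fun setT (fun x => nb_pmf k (expR (tdot x)) y).
Proof.
have me : measurable_fun setT (fun x => expR (tdot x)).
  by apply: measurableT_comp => //; exact: measurable_tdot.
have mi : measurable_fun setT (fun x => (k + expR (tdot x))^-1).
  apply: measurable_funV; first exact: measurable_funD.
  by move=> s; rewrite addr_gt0// expR_gt0.
apply: measurable_funM; last first.
  by apply: measurable_funX; exact: measurable_funM.
apply: measurable_funM => //.
by apply: (measurableT_comp (measurable_powR k)); exact: measurable_funM.
Qed.

Variables (X : T -> 'cV[R]_p) (Y : T -> nat).
Hypothesis mXY : measurable_fun setT (obs X Y).

Lemma measurable_cvtuple : measurable_fun setT (fun w => cvtuple (X w)).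
Proof. exact: (measurableT_comp measurable_fst mXY). Qed.

Lemma measurable_count : measurable_fun setT Y.
Proof. exact: (measurableT_comp measurable_snd mXY). Qed.

Hypothesis hNB : nb_given P k beta X Y.

Lemma nb_given_integral (g : p.-tuple R -> R) y :
  measurable_fun setT g -> (forall x, 0 <= g x) ->
  (\int[P]_w ((\1_[set y] (Y w) : R)%:E * (g (cvtuple (X w)))%:E) =
   \int[P]_w ((nb_pmf k (expR (tdot (cvtuple (X w)))) y)%:E *
               (g (cvtuple (X w)))%:E))%E.
Proof.
move=> mg g0.
have mX := measurable_cvtuple.
have mY1 : measurable_fun setT (fun w => \1_[set y] (Y w) : R).
  by apply: (measurableT_comp (f := \1_[set y] : nat -> R)) => //; exact: measurable_count.
have mpmf : measurable_fun setT (fun w => nb_pmf k (expR (tdot (cvtuple (X w)))) y).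
  by apply: (measurableT_comp (measurable_nb_pmf y)).
have pmf0 x : 0 <= nb_pmf k (expR (tdot x)) y by rewrite nb_pmf_ge0 ?expR_ge0.
apply: (ge0_integral_weight_eq (g := fun x => (g x)%:E)) => //.
- exact/measurable_EFinP.
move=> A mA.
have mXA : measurable [set w | A (cvtuple (X w))].
  by rewrite -[X in measurable X]setTI; exact: mX.
set E := [set w | A (cvtuple (X w)) /\ Y w = y].
have mE : measurable E.
  rewrite (_ : E = (fun w => cvtuple (X w)) @^-1` A `&` Y @^-1` [set y])//.
  apply: measurableI => //.
  by rewrite -[X in measurable X]setTI; exact: measurable_count.
transitivity (P E).
  rewrite -(setIT E) -integral_indic//; apply: eq_integral => w _.
  rewrite -EFinM !indicE; congr (_%:E).
  have -> : (w \in E) = (cvtuple (X w) \in A) && (Y w \in [set y]).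
    apply/idP/andP; rewrite !inE; first by case.
    by case.
  by case: (_ \in A); case: (_ \in [set y]); rewrite /= ?mulr1 ?mulr0.
rewrite hNB// [LHS]integral_mkcond; apply: eq_integral => w _.
rewrite patchE -tdotE indicE.
case: ifPn => wA.
  by rewrite mem_set ?mule1//; move: wA; rewrite inE.
by rewrite memNset ?mule0//; move: wA => /negP; rewrite inE.
Qed.

(** [F (X, Y)] is split according to the value of [Y], and each piece is integrated against the mass
    function. Asking for a bound on all partial sums avoids evaluating or even discussing the
    series. *)
Lemma nb_given_integral_le (F : p.-tuple R -> nat -> R) (G : p.-tuple R -> R) :
  (forall y, measurable_fun setT (F ^~ y)) -> (forall x y, 0 <= F x y) ->
  measurable_fun setT G ->
  (forall x N, \sum_(y < N) nb_pmf k (expR (tdot x)) y * F x y <= G x) ->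
  (\int[P]_w (F (cvtuple (X w)) (Y w))%:E <=
   \int[P]_w (G (cvtuple (X w)))%:E)%E.
Proof.
move=> mF F0 mG FG.
have mX := measurable_cvtuple.
have pmf0 x y : 0 <= nb_pmf k (expR (tdot x)) y by rewrite nb_pmf_ge0 ?expR_ge0.
have mY1 y : measurable_fun setT (fun w => \1_[set y] (Y w) : R).
  by apply: (measurableT_comp (f := \1_[set y] : nat -> R)) => //; exact: measurable_count.
have mpmf y : measurable_fun setT (fun w => nb_pmf k (expR (tdot (cvtuple (X w)))) y).
  by apply: (measurableT_comp (measurable_nb_pmf y)).
have mFX y : measurable_fun setT (fun w => F (cvtuple (X w)) y).
  by apply: (measurableT_comp (mF y)).
have FE w : ((F (cvtuple (X w)) (Y w))%:E =
    \sum_(y <oo) ((\1_[set y] (Y w) : R)%:E * (F (cvtuple (X w)) y)%:E))%E.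
  rewrite (nneseriesD1 (n := Y w))//; last first.
    by move=> n _; rewrite mule_ge0// lee_fin.
  rewrite indicE mem_set// mul1e eseries0 ?adde0// => i _ /= iY.
  by rewrite indicE memNset ?mul0e//= => Yi; rewrite Yi eqxx in iY.
under eq_integral do rewrite FE.
rewrite integral_nneseries//; last 2 first.
- by move=> y; apply: emeasurable_funM; apply/measurable_EFinP.
- by move=> y w _; rewrite mule_ge0// lee_fin.
under eq_eseriesr => y _ do rewrite (nb_given_integral y (mF y) (fun x => F0 x y)).
rewrite -integral_nneseries//; last 2 first.
- by move=> y; apply: emeasurable_funM; apply/measurable_EFinP.
- by move=> y w _; rewrite mule_ge0// lee_fin.
apply: ge0_le_integral => //.
- by move=> w _; apply: nneseries_ge0 => y _ _; rewrite mule_ge0// lee_fin.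
- apply: ge0_emeasurable_sum => [y w _ _|y _]; first by rewrite mule_ge0// lee_fin.
  by apply: emeasurable_funM; apply/measurable_EFinP.
- by apply/measurable_EFinP; exact: measurableT_comp.
move=> w _; apply: lime_le.
  by apply: is_cvg_nneseries => y _ _; rewrite mule_ge0// lee_fin.
apply: nearW => N; rewrite big_mkord.
under eq_bigr do rewrite -EFinM.
by rewrite sumEFin lee_fin.
Qed.
End nb_conditional.

(** * Moments of the negative binomial law *)

Section negative_binomial_series.
Context (R : realType).
Implicit Types k x m h : R.

(** Taylor coefficients at 0 of [(1 - x) ^ (- k)]. *)
Definition nb_coef k (y : nat) : R := (\prod_(j < y) (k + j%:R)) / y`!%:R.

Definition nb_poly k (N : nat) : {poly R} := \sum_(y < N) nb_coef k y *: 'X^y.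

Lemma nb_coef_ge0 k y : 0 < k -> 0 <= nb_coef k y.
Proof.
move=> k0; rewrite divr_ge0//.
by apply: prodr_ge0 => j _; rewrite addr_ge0// ltW.
Qed.

Lemma nb_coefS k y : y.+1%:R * nb_coef k y.+1 = (k + y%:R) * nb_coef k y.
Proof.
rewrite /nb_coef big_ord_recr/= factS natrM.
have y0 : (y.+1%:R : R) != 0 by rewrite pnatr_eq0.
have f0 : (y`!%:R : R) != 0 by rewrite pnatr_eq0 -lt0n fact_gt0.
by field; rewrite f0 nat1r.
Qed.

(** Coefficientwise, the derivative of [(1 - x) ^ (- k)] is [k] times [(1 - x) ^ (- k - 1)]. In the
    mean, this absorbs the factor [y] into the parameter. *)
Lemma nb_coefS_shift k y : y.+1%:R * nb_coef k y.+1 = k * nb_coef (k + 1) y.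
Proof.
elim: y => [|y IH].
  by rewrite nb_coefS addr0 /nb_coef !big_ord0.
have y0 : (y.+1%:R : R) != 0 by rewrite pnatr_eq0.
apply: (mulfI y0); rewrite nb_coefS [RHS]mulrCA nb_coefS mulrCA IH -natr1.
ring.
Qed.

Lemma horner_nb_poly k N x : (nb_poly k N).[x] = \sum_(y < N) nb_coef k y * x ^+ y.
Proof.
rewrite /nb_poly horner_sum; apply: eq_bigr => y _.
by rewrite hornerZ hornerXn.
Qed.

(** For the full series this is the differential equation of [(1 - x) ^ (- k)], with equality.
    Truncation leaves one boundary term, which is nonnegative. *)
Lemma nb_poly_deriv k N x : 0 < k -> 0 <= x ->
  (1 - x) * (nb_poly k N)^`().[x] <= k * (nb_poly k N).[x].
Proof.
move=> k0 x0; have -> : (nb_poly k N)^`().[x] =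
    \sum_(y < N) y%:R * nb_coef k y * x ^+ y.-1.
  rewrite /nb_poly raddf_sum horner_sum; apply: eq_bigr => y _ /=.
  by rewrite derivZ derivXn hornerZ hornerMn hornerXn -mulr_natr; ring.
rewrite horner_nb_poly -subr_ge0.
have -> : k * (\sum_(y < N) nb_coef k y * x ^+ y) -
    (1 - x) * (\sum_(y < N) y%:R * nb_coef k y * x ^+ y.-1) =
    N%:R * nb_coef k N * x ^+ N.-1.
  elim: N => [|N IH]; first by rewrite !big_ord0 !mulr0 !mul0r subrr.
  rewrite !big_ord_recr/= !mulrDr opprD addrACA IH nb_coefS.
  case: N {IH} => [|N] /=; first by rewrite expr0; ring.
  by rewrite exprS; ring.
by rewrite mulr_ge0 ?exprn_ge0// mulr_ge0// nb_coef_ge0.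
Qed.

(* [(nb_poly k N).[x] * (1 - x) `^ k] is nonincreasing in [x], which bounds the
   partial sums of the binomial series without summing it. *)
Lemma nb_poly_le1 k N x : 0 < k -> 0 <= x < 1 ->
  (nb_poly k N).[x] * (1 - x) `^ k <= 1.
Proof.
move=> k0 /andP[x0 x1].
have p0 : (nb_poly k N).[0] <= 1.
  rewrite horner_nb_poly; case: N => [|N]; first by rewrite big_ord0.
  rewrite big_ord_recl big1 ?addr0; last by move=> i _; rewrite expr0n mulr0.
  by rewrite /nb_coef big_ord0 fact0 divr1 expr0 mulr1.
pose f (z : R) := (nb_poly k N).[z] * (1 - z) `^ k.
pose df (z : R) := (nb_poly k N).[z] * (- (k * (1 - z) `^ (k - 1)))
   + (1 - z) `^ k * (nb_poly k N)^`().[z].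
have fE (z : R) : z < 1 -> is_derive z (1 : R) f (df z).
  move=> z1.
  have -> : f = (horner (nb_poly k N)) * ((@powR R ^~ k) \o (fun z => 1 - z)).
    by [].
  have dpow : is_derive (1 - z) 1 (@powR R ^~ k) (k * (1 - z) `^ (k - 1)).
    by apply: is_derive1_powR; rewrite subr_gt0.
  have dsub : is_derive z 1 (fun z : R => 1 - z) (-1).
    rewrite -[-1]sub0r.
    exact: (is_deriveB (is_derive_cst (1 : R) z 1) (is_derive_id z (1 : R))).
  apply: is_derive_eq.
  by rewrite /df mulrN1.
have cf : {within `[0, x], continuous f}.
  apply: derivable_within_continuous => z; rewrite in_itv/= => /andP[_ zx].
  by case: (fE z (le_lt_trans zx x1)).
have dfx (z : R) : z \in `]0, x[ -> is_derive z 1 f (df z).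
  by rewrite in_itv/= => /andP[_ zx]; apply: fE; exact: lt_trans x1.
have [z] := MVT_segment x0 dfx cf.
rewrite in_itv/= => /andP[z0 zx] fxE.
have z1 : z < 1 by exact: le_lt_trans x1.
have df0 : df z <= 0.
  have -> : df z = (1 - z) `^ (k - 1) *
      ((1 - z) * (nb_poly k N)^`().[z] - k * (nb_poly k N).[z]).
    rewrite /df -(mulr_powRB1 (x := 1 - z) (p := k)) ?subr_ge0 ?(ltW z1)//; last first.
    by ring.
  by rewrite mulr_ge0_le0 ?powR_ge0// subr_le0 nb_poly_deriv.
have f0 : f 0 <= 1 by rewrite /f subr0 powR1 mulr1.
rewrite -/(f x); apply: le_trans f0; rewrite -subr_le0 fxE subr0.
by rewrite mulr_le0_ge0.
Qed.
End negative_binomial_series.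

Section negative_binomial_moments.
Context (R : realType).
Implicit Types k x m h : R.

(** Since [expR h <= 1 / (1 - h)], it is enough that [1 - h] times the right-hand side be at least
    1, that is, [h <= 3 / 53] or [h = 0]. *)
Lemma expR_le_quad h : `|h| <= 1 / 20 -> expR h <= 1 + h + 53 / 50 * h ^+ 2.
Proof.
rewrite ler_norml => /andP[h1 h2].
have e0 := expR_gt0 h.
have := expR_ge1Dx (- h); rewrite expRN.
move=> H; have : (1 - h) * expR h <= 1.
  by rewrite -ler_pdivlMr// mul1r.
move=> H1.
have h2' : 0 <= h ^+ 2 by exact: sqr_ge0.
rewrite -(@ler_pM2l _ (1 - h)); last by lra.
apply: (le_trans H1).
have -> : (1 - h) * (1 + h + 53 / 50 * h ^+ 2) = 1 + h ^+ 2 * (3 / 50 - 53 / 50 * h) by field.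
by rewrite lerDl mulr_ge0//; lra.
Qed.

(** With [b = m / k] the moment generating function is [(1 - b * (expR h - 1)) ^ (- k)]. The first
    claim says that [h] lies in its domain, the second is the [k]-th root of the bound on it. The
    variance is [k * b * (1 + b)], and the excess of 6/5 over the Taylor coefficient 1/2 absorbs the
    remainder. *)
Lemma nb_exponent_bound b h : 0 <= b -> `|h| * (1 + b) <= 1 / 20 ->
  b * (expR h - 1) < 1 /\
  1 <= expR (b * h + 6 / 5 * (b * (1 + b) * h ^+ 2)) * (1 - b * (expR h - 1)).
Proof.
move=> b0 hb.
have h20 : `|h| <= 1 / 20.
  by apply: le_trans hb; rewrite ler_peMr//; lra.
have bh20 : `|b * h| <= 1 / 20.
  rewrite normrM ger0_norm// mulrC; apply: le_trans hb.
  by rewrite ler_wpM2l//; lra.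
have := expR_le_quad h20.
move: bh20 h20; rewrite !ler_norml => /andP[r1 r2] /andP[h1 h2] eh.
set r := b * h in r1 r2 *; pose t := b * h ^+ 2.
have t0 : 0 <= t by rewrite mulr_ge0// sqr_ge0.
have t1 : t <= 1 / 400.
  have -> : t = r * h by rewrite /t /r; ring.
  nra.
have a1 : b * (expR h - 1) <= r + 53 / 50 * t.
  have -> : r + 53 / 50 * t = b * (h + 53 / 50 * h ^+ 2) by rewrite /r /t; ring.
  by rewrite ler_wpM2l//; lra.
split; first by apply: (le_lt_trans a1); lra.
have rt : r ^+ 2 = b * t by rewrite /r /t; ring.
have -> : b * h + 6 / 5 * (b * (1 + b) * h ^+ 2) = r + 6 / 5 * ((1 + b) * t).
  by rewrite /r /t; ring.
have bt0 : 0 <= b * t by exact: mulr_ge0.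
apply: (@le_trans _ _ ((1 + (r + 6 / 5 * ((1 + b) * t))) * (1 - (r + 53 / 50 * t)))).
  have -> : (1 + (r + 6 / 5 * ((1 + b) * t))) * (1 - (r + 53 / 50 * t)) =
      1 + (t * (6 / 5 * (1 + b) * (1 - r - 53 / 50 * t) - 53 / 50 * (1 + r)) - r ^+ 2).
    by field.
  rewrite lerDl rt [b * t]mulrC -mulrBr mulr_ge0//.
  have : 1136 / 1000 * (1 + b) <= 6 / 5 * (1 + b) * (1 - r - 53 / 50 * t).
    have -> : 6 / 5 * (1 + b) * (1 - r - 53 / 50 * t) =
       (1 + b) * (6 / 5 * (1 - r - 53 / 50 * t)) by ring.
    by rewrite mulrC ler_wpM2l//; lra.
  by lra.
apply: ler_pM; [lra|lra|exact: expR_ge1Dx|lra].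
Qed.

Lemma nb_pmfE k m y : 0 < k -> 0 <= m ->
  nb_pmf k m y = (k / (k + m)) `^ k * (nb_coef k y * (m / (k + m)) ^+ y).
Proof. by move=> k0 m0; rewrite /nb_pmf /nb_coef; ring. Qed.

(** Tilting by [h] replaces the parameter [rho = m / (k + m)] by [rho * expR h]: the sum becomes
    [(1 - rho) ^ k] times a partial binomial series at the new parameter, to which [nb_poly_le1]
    applies. *)
Lemma nb_pmf_mgf k m h N : 0 < k -> 0 < m ->
  `|h| * (1 + m / k) <= 1 / 20 ->
  \sum_(y < N) nb_pmf k m y * expR (y%:R * h) <=
  expR (m * h + 6 / 5 * (m * (1 + m / k) * h ^+ 2)).
Proof.
move=> k0 m0 hk; set b := m / k in hk *.
have b0 : 0 < b by rewrite divr_gt0.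
have [a1 aE] := nb_exponent_bound (ltW b0) hk.
pose rho := m / (k + m); pose x := rho * expR h.
have km0 : 0 < k + m by rewrite addr_gt0.
have xE : 1 - x = (k / (k + m)) * (1 - b * (expR h - 1)).
  by rewrite /x /rho /b; field; rewrite !gt_eqF.
have x1 : 0 < 1 - x.
  by rewrite xE mulr_gt0// ?divr_gt0// subr_gt0.
have -> : \sum_(y < N) nb_pmf k m y * expR (y%:R * h) =
    (k / (k + m)) `^ k * (nb_poly k N).[x].
  rewrite horner_nb_poly mulr_sumr; apply: eq_bigr => y _.
  rewrite nb_pmfE ?ltW// -mulrA -mulrA; congr (_ * (_ * _)).
  by rewrite /x (exprMn y rho) expRM_natl.
set L := m * h + _.
have LE : L = (b * h + 6 / 5 * (b * (1 + b) * h ^+ 2)) * k.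
  by rewrite /L /b; field; rewrite gt_eqF.
have := @nb_poly_le1 R k N x k0; rewrite -subr_gt0 x1 andbT.
move=> /(_ (mulr_ge0 (divr_ge0 (ltW m0) (ltW km0)) (expR_ge0 _))) H.
apply: (@le_trans _ _ (expR L * (1 - x) `^ k * (nb_poly k N).[x])).
  rewrite ler_wpM2r//.
    by rewrite horner_nb_poly sumr_ge0// => y _; rewrite mulr_ge0 ?nb_coef_ge0 ?exprn_ge0// mulr_ge0 ?expR_ge0// divr_ge0 ?ltW.
  rewrite LE expRM -powRM ?expR_ge0 ?(ltW x1)//.
  have q0 : 0 <= k / (k + m) by rewrite ltW// divr_gt0.
  have q1 : k / (k + m) <= expR (b * h + 6 / 5 * (b * (1 + b) * h ^+ 2)) * (1 - x).
    by rewrite xE mulrCA -[X in X <= _]mulr1 ler_wpM2l.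
  by apply: ge0_ler_powR; rewrite ?nnegrE ?(ltW k0)// (le_trans q0).
by rewrite -mulrA [X in _ * X]mulrC ler_piMr// expR_ge0.
Qed.

Lemma nb_pmf_sum_le1 k m N : 0 < k -> 0 < m -> \sum_(y < N) nb_pmf k m y <= 1.
Proof.
move=> k0 m0; have := @nb_pmf_mgf k m 0 N k0 m0.
rewrite normr0 mul0r !mulr0 expr0n mulr0 mulr0 addr0 expR0.
under eq_bigr do rewrite mulr0 expR0 mulr1.
by apply; lra.
Qed.

(** Absorbing the factor [y] shifts the index by one and turns [k] into [k + 1], which leaves
    another partial binomial series. *)
Lemma nb_pmf_mean_le k m N : 0 < k -> 0 < m ->
  \sum_(y < N) nb_pmf k m y * y%:R <= m.
Proof.
move=> k0 m0; have km0 : 0 < k + m by rewrite addr_gt0.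
case: N => [|N]; first by rewrite big_ord0 ltW.
rewrite big_ord_recl mulr0 add0r.
pose x := m / (k + m).
have xE : 1 - x = k / (k + m) by rewrite /x; field; rewrite gt_eqF.
have x0 : 0 <= x by rewrite divr_ge0// ltW.
have x1 : 0 < 1 - x by rewrite xE divr_gt0.
have -> : \sum_(i < N) nb_pmf k m (lift ord0 i) * (lift ord0 i)%:R =
    (k / (k + m)) `^ k * (k * x) * (nb_poly (k + 1) N).[x].
  rewrite horner_nb_poly mulr_sumr; apply: eq_bigr => y _.
  rewrite nb_pmfE ?ltW// lift0 -/x exprS.
  transitivity ((k / (k + m)) `^ k * (y.+1%:R * nb_coef k y.+1) * (x * x ^+ y)).
    by ring.
  by rewrite nb_coefS_shift; ring.
rewrite -xE.
have := @nb_poly_le1 R (k + 1) N x (addr_gt0 k0 ltr01).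
rewrite x0 -subr_gt0 x1 => /(_ isT).
rewrite powRD; last by rewrite gt_eqF ?implybT// addr_gt0.
rewrite powRr1 ?(ltW x1)// => H.
apply: (@le_trans _ _ (k * x * (1 - x)^-1)); last first.
  by rewrite xE /x le_eqVlt; apply/orP; left; apply/eqP; field; rewrite !gt_eqF.
rewrite ler_pdivlMr//.
have -> : (1 - x) `^ k * (k * x) * (nb_poly (k + 1) N).[x] * (1 - x) =
  k * x * ((nb_poly (k + 1) N).[x] * ((1 - x) `^ k * (1 - x))) by ring.
by rewrite ler_piMr// mulr_ge0// ltW.
Qed.
End negative_binomial_moments.

(** * Sub-Weibull tails and conditional moments *)

Section subweibull.
Context (R : realType) (d : measure_display) (T : measurableType d).
Variable P : probability T R.

Lemma measurable_subweibull_exp (theta C : R) (Z : T -> R) :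
  measurable_fun setT Z ->
  measurable_fun setT (fun w => expR (`|Z w| `^ theta / C `^ theta)).
Proof.
move=> mZ; apply: measurableT_comp => //; apply: measurable_funM => //.
apply: (measurableT_comp (measurable_powR theta)).
exact: measurableT_comp.
Qed.

(** The infimum is attained: every constant above [C] exceeds an admissible one, and the bound 2
    passes to [C] by monotone convergence. *)
Lemma subweibull_norm_le (theta C : R) (Z : T -> R) :
  0 < theta -> 0 < C -> measurable_fun setT Z ->
  (subweibull_norm P theta Z <= C%:E)%E ->
  (\int[P]_w (expR (`|Z w| `^ theta / C `^ theta))%:E <= 2%:E)%E.
Proof.
move=> th0 C0 mZ hZ.
(* Scaling the exponent by [r n] amounts to replacing [C] by the larger constant
   [C * (r n) ^ (- 1 / theta)]. The shift by 2 makes [r 0] positive. *)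
pose r (n : nat) : R := 1 - n.+2%:R^-1.
have r0 n : 0 < r n by rewrite subr_gt0 invf_lt1// ltr1n.
have r1 n : r n < 1 by rewrite ltrBlDr ltrDl invr_gt0.
pose g n w := expR (r n * (`|Z w| `^ theta / C `^ theta)).
have q0 w : 0 <= `|Z w| `^ theta / C `^ theta.
  by rewrite divr_ge0// powR_ge0.
have mg n : measurable_fun setT (g n).
  apply: measurableT_comp => //; apply: measurable_funM => //.
  apply: measurable_funM => //.
  apply: (measurableT_comp (measurable_powR theta)).
  exact: measurableT_comp.
have gle n : (\int[P]_w (g n w)%:E <= 2%:E)%E.
  pose Cn := C * (r n)^-1 `^ theta^-1.
  have CCn : C < Cn.
    have e1 : 1 = (1 : R) `^ theta^-1 by rewrite powR1.
    rewrite /Cn ltr_pMr// [X in X < _]e1 gt0_ltr_powR ?invr_gt0 ?nnegrE//.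
      by rewrite ltW// invr_gt0.
    by rewrite invf_gt1.
  have /ereal_inf_lt[_ [C' [C'0 HC'] <-]] :
    (subweibull_norm P theta Z < Cn%:E)%E by rewrite (le_lt_trans hZ)// lte_fin.
  rewrite lte_fin => C'Cn; apply: le_trans HC'; rewrite unlock.
  apply: ge0_le_integral => //=.
  - by move=> w _; rewrite lee_fin expR_ge0.
  - exact/measurable_EFinP.
  - exact/measurable_EFinP/measurable_subweibull_exp.
  - move=> w _; rewrite lee_fin ler_expR mulrCA ler_wpM2l ?powR_ge0//.
    have -> : r n / C `^ theta = (Cn `^ theta)^-1.
      rewrite /Cn powRM ?powR_ge0 ?(ltW C0)// -powRrM mulVf ?gt_eqF//.
      by rewrite powRr1 ?invr_ge0 ?(ltW (r0 n))// invfM invrK mulrC.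
    rewrite lef_pV2 ?posrE ?powR_gt0//; last by rewrite (lt_trans C0).
    by rewrite ge0_ler_powR ?nnegrE ?ltW// (lt_trans C0).
have -> : (fun w => (expR (`|Z w| `^ theta / C `^ theta))%:E) =
    (fun w => limn (fun n => (g n w)%:E)).
  apply/funext => w; apply/esym/cvg_lim => //.
  apply/fine_cvgP; split; first exact: nearW.
  rewrite -[X in expR X]mul1r.
  apply: (@continuous_cvg _ _ _ _ _ _ expR); first exact: continuous_expR.
  apply: cvgMl.
  rewrite -[X in _ --> X]subr0; apply: cvgB; first exact: cvg_cst.
  have := @cvg_harmonic R; rewrite -(cvg_shiftS (@harmonic R)).
  exact.
rewrite monotone_convergence//.
- apply: lime_le; last by apply: nearW => n; exact: gle.
  apply: ereal_nondecreasing_is_cvgn => m n mn; apply: ge0_le_integral => //=.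
  + by move=> w _; rewrite lee_fin expR_ge0.
  + exact/measurable_EFinP.
  + exact/measurable_EFinP.
  + move=> w _; rewrite lee_fin ler_expR ler_wpM2r//.
    by rewrite lerB// lef_pV2 ?posrE// ler_nat.
- by move=> n; exact/measurable_EFinP.
- by move=> n w _; rewrite lee_fin expR_ge0.
- move=> w _ m n mn; rewrite lee_fin ler_expR ler_wpM2r//.
  by rewrite lerB// lef_pV2 ?posrE// ler_nat.
Qed.

End subweibull.

(** * Real-valued expectations of integrable functions *)

Section expectation_toolbox.
Context (R : realType) (d : measure_display) (T : measurableType d).
Variable P : probability T R.
Implicit Types f g : T -> R.

Definition L1 f := P.-integrable setT (EFin \o f).

Lemma EFin_Rintegral f : L1 f ->
  (\int[P]_w (f w)%:E)%E = (\int[P]_w f w)%:E.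
Proof. by move=> lf; rewrite /Rintegral fineK//; exact: integrable_fin_num. Qed.

Lemma L1_le f g : measurable_fun setT f -> L1 g ->
  (forall w, `|f w| <= g w) -> L1 f.
Proof.
move=> mf lg fg; apply: (le_integrable measurableT _ _ lg).
  exact/measurable_EFinP.
by move=> w _ /=; rewrite lee_fin (le_trans (fg w))// ler_norm.
Qed.

Lemma L1_bounded f (c : R) : measurable_fun setT f ->
  (forall w, `|f w| <= c) -> L1 f.
Proof.
move=> mf fc; apply: (@L1_le f (cst c)) => //.
by apply: finite_measure_integrable_cst.
Qed.

Lemma L1_ge0 f (c : R) : measurable_fun setT f -> (forall w, 0 <= f w) ->
  (\int[P]_w (f w)%:E <= c%:E)%E -> L1 f /\ \int[P]_w f w <= c.
Proof.
move=> mf f0 fc; have lf : L1 f.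
  apply/integrableP; split; first exact/measurable_EFinP.
  under eq_integral => w _ do rewrite /= ger0_norm//.
  by rewrite (le_lt_trans fc)// ltry.
by split => //; rewrite -lee_fin -EFin_Rintegral.
Qed.

Lemma L1Z (c : R) f : L1 f -> L1 (fun w => c * f w).
Proof. by move=> lf; exact: (integrableZl measurableT c lf). Qed.

Lemma L1D f g : L1 f -> L1 g -> L1 (fun w => f w + g w).
Proof. by move=> lf lg; exact: (integrableD measurableT lf lg). Qed.

Lemma L1_sum (I : finType) (f : I -> T -> R) :
  (forall i, L1 (f i)) -> L1 (fun w => \sum_i f i w).
Proof.
move=> lf; rewrite /L1.
rewrite (_ : _ \o _ = (fun w => \sum_i (f i w)%:E)%E); last first.
  by apply/funext => w /=; rewrite sumEFin.
by apply: (integrable_sum measurableT) => i _; exact: lf.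
Qed.

Lemma Rintegral_sum (I : finType) (f : I -> T -> R) :
  (forall i, L1 (f i)) ->
  \int[P]_w (\sum_i f i w) = \sum_i \int[P]_w f i w.
Proof.
move=> lf; apply: EFin_inj; rewrite -EFin_Rintegral; last exact: L1_sum.
under eq_integral do rewrite -sumEFin.
rewrite integral_sum//=.
rewrite -sumEFin; apply: eq_bigr => i _.
by rewrite EFin_Rintegral//; exact: lf.
Qed.

Lemma RintegralDT f g : L1 f -> L1 g ->
  \int[P]_w (f w + g w) = \int[P]_w f w + \int[P]_w g w.
Proof. by move=> lf lg; rewrite RintegralD. Qed.

Lemma RintegralZT (c : R) f : L1 f -> \int[P]_w (c * f w) = c * \int[P]_w f w.
Proof. by move=> lf; rewrite RintegralZl. Qed.

Lemma Rintegral_cstT (c : R) : \int[P]_w c = c.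
Proof.
rewrite Rintegral_cst//= [X in _ * fine X](_ : _ = 1%E) ?mulr1//.
exact: probability_setT.
Qed.

Lemma le_RintegralT f g : L1 f -> L1 g -> (forall w, f w <= g w) ->
  \int[P]_w f w <= \int[P]_w g w.
Proof. by move=> lf lg fg; apply: le_Rintegral => // w _. Qed.

Lemma ae_le_Rintegral f g : L1 f -> L1 g -> (forall w, 0 <= f w) ->
  (forall w, 0 <= g w) -> {ae P, forall w, f w <= g w} ->
  \int[P]_w f w <= \int[P]_w g w.
Proof.
move=> lf lg f0 g0 fg; rewrite -lee_fin -!EFin_Rintegral//.
apply: ae_ge0_le_integral => //=.
- by move=> w _; rewrite lee_fin.
- exact: (measurable_int P).
- by move=> w _; rewrite lee_fin.
- exact: (measurable_int P).
- by apply: filterS fg => w + _; rewrite lee_fin.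
Qed.

End expectation_toolbox.

(** * Conditional exponential moments of the score and of the Hessian weight *)

Section nb_regression.
Context (R : realType) (p : nat) (k : R) (beta : 'cV[R]_p).
Hypothesis k_gt0 : 0 < k.
Implicit Types (x : p.-tuple R) (y : nat).

(* Given [X = x], the conditional means of [nbweight x Y] and of [nbscore x Y ^+ 2]
   are both [nbvar x]. *)
Definition nbmean x := expR (tdot beta x).
Definition nbvar x := k * nbmean x / (k + nbmean x).
Definition nbweight x y := (y%:R + k) * k * nbmean x / (k + nbmean x) ^+ 2.
Definition nbscore x y := k * (y%:R - nbmean x) / (k + nbmean x).
Definition sqnorm x := \sum_j tnth x j ^+ 2.

Lemma nbmean_gt0 x : 0 < nbmean x. Proof. exact: expR_gt0. Qed.

Lemma kmean_gt0 x : 0 < k + nbmean x. Proof. by rewrite addr_gt0// nbmean_gt0. Qed.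

Lemma nbvar_gt0 x : 0 < nbvar x.
Proof. by rewrite divr_gt0 ?kmean_gt0// mulr_gt0// nbmean_gt0. Qed.

Lemma nbvar_le_k x : nbvar x <= k.
Proof.
rewrite /nbvar ler_pdivrMr ?kmean_gt0// ler_wpM2l ?(ltW k_gt0)//.
by rewrite lerDr ltW.
Qed.

Lemma nbvar_le_mean x : nbvar x <= nbmean x.
Proof.
rewrite /nbvar mulrAC ler_piMl ?(ltW (nbmean_gt0 x))//.
by rewrite ler_pdivrMr ?kmean_gt0// mul1r lerDl ltW// nbmean_gt0.
Qed.

Lemma nbweight_ge0 x y : 0 <= nbweight x y.
Proof.
rewrite divr_ge0 ?exprn_ge0 ?(ltW (kmean_gt0 x))//.
by rewrite mulr_ge0 ?(ltW (nbmean_gt0 x))// mulr_ge0 ?addr_ge0 ?(ltW k_gt0).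
Qed.

Lemma measurable_nbmean : measurable_fun setT nbmean.
Proof. by apply: measurableT_comp => //; exact: measurable_tdot. Qed.

Lemma measurable_kmeanV : measurable_fun setT (fun x => (k + nbmean x)^-1).
Proof.
apply: measurable_funV; last exact: kmean_gt0.
by apply: measurable_funD => //; exact: measurable_nbmean.
Qed.

Lemma measurable_nbvar : measurable_fun setT nbvar.
Proof.
apply: measurable_funM; last exact: measurable_kmeanV.
by apply: measurable_funM => //; exact: measurable_nbmean.
Qed.

Lemma measurable_sqnorm : measurable_fun setT sqnorm.
Proof.
by apply: measurable_sum => j; apply: measurable_funX; exact: measurable_tnth.
Qed.

Let mcount d' (S : measurableType d') (f : S -> nat) : measurable_fun setT f ->
  measurable_fun setT (fun s => (f s)%:R : R).
Proof. by move=> mf; apply: (measurableT_comp (f := fun n : nat => n%:R : R)). Qed.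

Lemma measurable_nbweight :
  measurable_fun setT (fun s : p.-tuple R * nat => nbweight s.1 s.2).
Proof.
apply: measurable_funM.
  apply: measurable_funM.
    apply: measurable_funM => //; apply: measurable_funD => //.
    by apply: mcount; exact: measurable_snd.
  exact: (measurableT_comp measurable_nbmean measurable_fst).
rewrite (_ : (fun _ => _) = (fun s : p.-tuple R * nat => ((k + nbmean s.1)^-1) ^+ 2)).
  apply: measurable_funX.
  exact: (measurableT_comp measurable_kmeanV measurable_fst).
by apply/funext => s; rewrite exprVn.
Qed.

Lemma measurable_nbscore :
  measurable_fun setT (fun s : p.-tuple R * nat => nbscore s.1 s.2).
Proof.
apply: measurable_funM; last first.
  exact: (measurableT_comp measurable_kmeanV measurable_fst).
apply: measurable_funM => //; apply: measurable_funB.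
  by apply: mcount; exact: measurable_snd.
exact: (measurableT_comp measurable_nbmean measurable_fst).
Qed.

Context (d : measure_display) (T : measurableType d).
Variables (P : probability T R) (X : T -> 'cV[R]_p) (Y : T -> nat).
Hypothesis mXY : measurable_fun setT (obs X Y).
Hypothesis hNB : nb_given P k beta X Y.

Let m_slice (f : p.-tuple R * nat -> R) y :
  measurable_fun setT f -> measurable_fun setT (fun x => f (x, y)).
Proof. by move=> mf; apply: (measurableT_comp mf); exact: measurable_fun_pair. Qed.

(** With [m] the conditional mean and [h = u * k / (k + m)], the exponent is [h * (Y - m)]. Then
    [h * (1 + m / k) = u], so the first bound on [u] is the domain of [nb_pmf_mgf], and the variance
    term is [nbvar * u ^ 2]. The bound 1/48 allows the exponential to be linearised, with 6/5
    relaxed to 5/4; after that the law of the covariate enters through a mean instead of a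
    supremum. *)
Lemma nbscore_mgf (u : p.-tuple R -> R) :
  measurable_fun setT u -> (forall x, `|u x| <= 1 / 20) ->
  (forall x, nbvar x * u x ^+ 2 <= 1 / 48) ->
  (\int[P]_w (expR (u (cvtuple (X w)) * nbscore (cvtuple (X w)) (Y w)))%:E <=
   \int[P]_w (1 + 5 / 4 * (nbvar (cvtuple (X w)) * u (cvtuple (X w)) ^+ 2))%:E)%E.
Proof.
move=> mu u20 u48.
apply: (nb_given_integral_le k_gt0 mXY hNB
  (F := fun x y => expR (u x * nbscore x y))
  (G := fun x => 1 + 5 / 4 * (nbvar x * u x ^+ 2))).
- move=> y; apply: measurableT_comp => //; apply: measurable_funM => //.
  exact: (m_slice y measurable_nbscore).
- by move=> x y; exact: expR_ge0.
- apply: measurable_funD => //; apply: measurable_funM => //.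
  by apply: measurable_funM; [exact: measurable_nbvar|exact: measurable_funX].
move=> x N; rewrite -/(nbmean x).
have m0 := nbmean_gt0 x; have km0 := kmean_gt0 x.
set m := nbmean x in m0 km0 *; pose h := u x * k / (k + m).
have v0 := nbvar_gt0 x; have v48 := u48 x.
have hk : `|h| * (1 + m / k) <= 1 / 20.
  apply: le_trans (u20 x).
  have -> : h = u x * (k / (k + m)) by rewrite /h mulrA.
  rewrite normrM (@ger0_norm _ (k / (k + m))) ?divr_ge0 ?(ltW k_gt0) ?(ltW km0)//.
  by rewrite le_eqVlt; apply/orP; left; apply/eqP; field; rewrite !gt_eqF.
have := @nb_pmf_mgf R k m h N k_gt0 m0 hk.
have -> : m * (1 + m / k) * h ^+ 2 = nbvar x * u x ^+ 2.
  by rewrite /h /nbvar -/m; field; rewrite !gt_eqF.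
move=> H; have -> : \sum_(y < N) nb_pmf k m y * expR (u x * nbscore x y) =
    expR (- (m * h)) * \sum_(y < N) nb_pmf k m y * expR (y%:R * h).
  rewrite mulr_sumr; apply: eq_bigr => y _; rewrite [RHS]mulrCA -expRD.
  congr (_ * expR _); rewrite /nbscore -/m /h; field; by rewrite gt_eqF.
apply: (@le_trans _ _ (expR (6 / 5 * (nbvar x * u x ^+ 2)))).
  by rewrite -[X in _ <= expR X](addKr (m * h)) expRD ler_wpM2l// expR_ge0.
set t := nbvar x * u x ^+ 2 in v48 *.
have t0 : 0 <= t by rewrite mulr_ge0 ?sqr_ge0// ltW.
apply: (le_trans (expR_le_quad _)); first by rewrite ger0_norm; lra.
by nra.
Qed.

(** The weight is affine in the count, with slope [k * m / (k + m) ^ 2] for conditional mean [m]. It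
    is not centred, so the linear term [nbvar * z] stays and its square contributes the [nbvar ^ 2]
    of the second-order term. *)
Lemma nbweight_mgf (z : p.-tuple R -> R) :
  measurable_fun setT z ->
  (forall x, `|z x| * (1 + nbvar x) <= 1 / 25) ->
  (\int[P]_w (expR (z (cvtuple (X w)) * nbweight (cvtuple (X w)) (Y w)))%:E <=
   \int[P]_w (1 + nbvar (cvtuple (X w)) * z (cvtuple (X w)) +
      6 / 5 * ((nbvar (cvtuple (X w)) + nbvar (cvtuple (X w)) ^+ 2)
               * z (cvtuple (X w)) ^+ 2))%:E)%E.
Proof.
move=> mz z25.
apply: (nb_given_integral_le k_gt0 mXY hNB
  (F := fun x y => expR (z x * nbweight x y))
  (G := fun x => 1 + nbvar x * z x + 6 / 5 * ((nbvar x + nbvar x ^+ 2) * z x ^+ 2))).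
- move=> y; apply: measurableT_comp => //; apply: measurable_funM => //.
  exact: (m_slice y measurable_nbweight).
- by move=> x y; exact: expR_ge0.
- have mv := measurable_nbvar.
  apply: measurable_funD; first by apply: measurable_funD => //; exact: measurable_funM.
  apply: measurable_funM => //; apply: measurable_funM; last exact: measurable_funX.
  by apply: measurable_funD => //; exact: measurable_funX.
move=> x N; rewrite -/(nbmean x).
have m0 := nbmean_gt0 x; have km0 := kmean_gt0 x.
set m := nbmean x in m0 km0 *; pose h := z x * k * m / (k + m) ^+ 2.
have v0 := nbvar_gt0 x; have zx25 := z25 x.
have z25' : `|z x| <= 1 / 25.
  by apply: le_trans zx25; rewrite ler_peMr// lerDl ltW.
have rho1 : m / (k + m) <= 1 by rewrite ler_pdivrMr// mul1r lerDr ltW.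
have rho0 : 0 <= m / (k + m) by rewrite divr_ge0// ltW.
have hk : `|h| * (1 + m / k) <= 1 / 20.
  have -> : h = z x * (k * m / (k + m) ^+ 2) by rewrite /h !mulrA.
  rewrite normrM (@ger0_norm _ (k * m / _)); last first.
    by rewrite divr_ge0 ?exprn_ge0 ?mulr_ge0// ltW.
  have -> : `|z x| * (k * m / (k + m) ^+ 2) * (1 + m / k) = `|z x| * (m / (k + m)).
    by field; rewrite !gt_eqF.
  apply: (@le_trans _ _ (1 / 25)); last by lra.
  by apply: le_trans z25'; rewrite ler_piMr.
have := @nb_pmf_mgf R k m h N k_gt0 m0 hk.
have -> : m * (1 + m / k) * h ^+ 2 = nbvar x * z x ^+ 2 * (m / (k + m)) ^+ 2.
  by rewrite /h /nbvar -/m; field; rewrite !gt_eqF.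
move=> H; have -> : \sum_(y < N) nb_pmf k m y * expR (z x * nbweight x y) =
    expR (k * h) * \sum_(y < N) nb_pmf k m y * expR (y%:R * h).
  rewrite mulr_sumr; apply: eq_bigr => y _; rewrite [RHS]mulrCA -expRD.
  congr (_ * expR _); rewrite /nbweight -/m /h; field; by rewrite gt_eqF.
set v := nbvar x in v0 zx25 *.
apply: (@le_trans _ _ (expR (v * z x + 6 / 5 * (v * z x ^+ 2)))).
  apply: (@le_trans _ _ (expR (k * h) * expR (m * h +
      6 / 5 * (v * z x ^+ 2 * (m / (k + m)) ^+ 2)))).
    by rewrite ler_wpM2l// expR_ge0.
  rewrite -expRD ler_expR addrA.
  have -> : k * h + m * h = v * z x.
    by rewrite /h /v /nbvar -/m; field; rewrite !gt_eqF.
  have rho2 : (m / (k + m)) ^+ 2 <= 1 by apply: exprn_ile1.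
  have vz0 : 0 <= v * z x ^+ 2 by rewrite mulr_ge0 ?sqr_ge0// ltW.
  by rewrite lerD2l ler_wpM2l// ler_piMr.
pose a := v * z x.
have a25 : `|a| <= 1 / 25 - `|z x|.
  by rewrite /a normrM (gtr0_norm v0); lra.
have vz : v * z x ^+ 2 = a * z x by rewrite /a; ring.
have -> : (v + v ^+ 2) * z x ^+ 2 = a * z x + a ^+ 2 by rewrite /a; ring.
rewrite vz -/a.
have vz0 : 0 <= a * z x by rewrite -vz mulr_ge0 ?sqr_ge0// ltW.
have [z1 z2] : - (1 / 25) <= z x /\ z x <= 1 / 25.
  by move: z25'; rewrite ler_norml => /andP[].
have aB : `|a| <= 1 / 25.
  by apply: (le_trans a25); rewrite gerBl.
have azB : a * z x <= 1 / 625.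
  rewrite -[a * z x]ger0_norm// normrM.
  have -> : 1 / 625 = (1 / 25) * (1 / 25) :> R by field.
  exact: ler_pM.
have [a1 a2] : - (1 / 25) <= a /\ a <= 1 / 25.
  by move: aB; rewrite ler_norml => /andP[].
apply: (le_trans (expR_le_quad _)).
  by rewrite ler_norml; apply/andP; split; lra.
have -> : (a + 6 / 5 * (a * z x)) ^+ 2 = a ^+ 2 * (1 + 6 / 5 * z x) ^+ 2 by ring.
have a0 : 0 <= a ^+ 2 by exact: sqr_ge0.
have : (1 + 6 / 5 * z x) ^+ 2 <= 11 / 10 by nra.
by move: (a ^+ 2) ((1 + _) ^+ 2) a0 => A Z A0 ZZ; nra.
Qed.

(** An inequality is what partial sums give, and it is the direction that passes the lower bound on
    the Hessian on to [nbvar]. *)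
Lemma nbweight_mean_le (g : p.-tuple R -> R) :
  measurable_fun setT g -> (forall x, 0 <= g x) ->
  (\int[P]_w (nbweight (cvtuple (X w)) (Y w) * g (cvtuple (X w)))%:E <=
   \int[P]_w (nbvar (cvtuple (X w)) * g (cvtuple (X w)))%:E)%E.
Proof.
move=> mg g0.
apply: (nb_given_integral_le k_gt0 mXY hNB
  (F := fun x y => nbweight x y * g x) (G := fun x => nbvar x * g x)).
- move=> y; apply: measurable_funM => //.
  exact: (m_slice y measurable_nbweight).
- by move=> x y; rewrite mulr_ge0// nbweight_ge0.
- by apply: measurable_funM => //; exact: measurable_nbvar.
move=> x N; rewrite -/(nbmean x).
have m0 := nbmean_gt0 x; have km0 := kmean_gt0 x.
set m := nbmean x in m0 km0 *.
under eq_bigr do rewrite mulrA.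
rewrite -mulr_suml ler_wpM2r//.
have -> : \sum_(y < N) nb_pmf k m y * nbweight x y = k * m / (k + m) ^+ 2 *
   (\sum_(y < N) nb_pmf k m y * y%:R + k * \sum_(y < N) nb_pmf k m y).
  rewrite mulr_sumr -big_split mulr_sumr; apply: eq_bigr => y _ /=.
  by rewrite /nbweight -/m; ring.
apply: (@le_trans _ _ (k * m / (k + m) ^+ 2 * (m + k * 1))); last first.
  by rewrite /nbvar -/m le_eqVlt; apply/orP; left; apply/eqP; field; rewrite gt_eqF.
rewrite ler_wpM2l ?divr_ge0 ?exprn_ge0 ?mulr_ge0 ?(ltW k_gt0) ?(ltW m0) ?(ltW km0)//.
by rewrite lerD ?nb_pmf_mean_le// ler_wpM2l ?(ltW k_gt0)// nb_pmf_sum_le1.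
Qed.

End nb_regression.

(** * Identically distributed observations and Chernoff bounds *)

Lemma same_law_integral (R : realType) d (T : measurableType d)
  (P : probability T R) d' (S : measurableType d') (Z Z' : T -> S)
  (g : S -> \bar R) :
  measurable_fun setT Z -> measurable_fun setT Z' -> same_law P Z Z' ->
  measurable_fun setT g -> (forall s, 0 <= g s)%E ->
  (\int[P]_w g (Z w) = \int[P]_w g (Z' w))%E.
Proof.
move=> mZ mZ' ZZ' mg g0.
have := @ge0_integral_weight_eq R d T P P d' S (cst 1) (cst 1) Z Z' g.
under eq_integral do rewrite mul1e.
move=> H; rewrite H//; first by under eq_integral do rewrite mul1e.
move=> A mA.
have E (V : T -> S) : measurable_fun setT V ->
    (\int[P]_t ((cst 1%R t : R)%:E * (\1_A (V t))%:E) = P (V @^-1` A))%E.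
  move=> mV; have mVA : measurable (V @^-1` A).
    by rewrite -[X in measurable X]setTI; exact: mV.
  rewrite -(setIT (V @^-1` A)) -integral_indic//; apply: eq_integral => w _.
  by rewrite mul1e !indicE.
by rewrite !E// ZZ'.
Qed.

Lemma probability_iid_forall (R : realType) d (T : measurableType d)
  (P : probability T R) d' (S : measurableType d') (Z : nat -> T -> S) (A : set S)
  (n : nat) :
  (forall i, measurable_fun setT (Z i)) -> mutually_independent P Z ->
  (forall i, same_law P (Z i) (Z 0%N)) -> measurable A ->
  P [set w | forall i, (i < n)%N -> A (Z i w)] =
  ((fine (P (Z 0%N @^-1` A))) ^+ n)%:E.
Proof.
move=> mZ indep law mA.
rewrite (_ : [set w | _] = \bigcap_(i in [set` iota 0 n]) (Z i @^-1` A)); last first.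
  apply/seteqP; split => w /= H i; have := H i; rewrite /= mem_iota add0n.
    exact.
  by move=> + ?; apply.
rewrite indep ?iota_uniq// (eq_bigr (fun=> (fine (P (Z 0%N @^-1` A)))%:E)).
  by rewrite prodEFin big_const_seq count_predT size_iota iter_mulr_1.
move=> i _; rewrite law// fineK// fin_num_measure//.
by rewrite -[X in measurable X]setTI; exact: mZ.
Qed.

Section deviations.
Context (R : realType) (p : nat) (k : R) (beta : 'cV[R]_p).
Context (d : measure_display) (T : measurableType d).
Variables (P : probability T R) (Xs : nat -> T -> 'cV[R]_p) (Ys : nat -> T -> nat).
Hypothesis k_gt0 : 0 < k.
Hypothesis mZ : forall i, measurable_fun setT (obs (Xs i) (Ys i)).
Hypothesis indep : mutually_independent P (fun i => obs (Xs i) (Ys i)).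
Hypothesis law : forall i, same_law P (obs (Xs i) (Ys i)) (obs (Xs 0%N) (Ys 0%N)).
Hypothesis hNB : nb_given P k beta (Xs 0%N) (Ys 0%N).

Local Notation xi i w := (cvtuple (Xs i w)).
Local Notation v := (nbvar k beta).

Let m_xi : measurable_fun setT (fun w => xi 0%N w).
Proof. exact: measurable_cvtuple. Qed.

Lemma nbscore_deviation (u : p.-tuple R -> R) (n : nat) (a : R) :
  measurable_fun setT u -> (forall x, `|u x| <= 1 / 20) ->
  (forall x, v x * u x ^+ 2 <= 1 / 48) ->
  (P [set w | (n%:R * (5 / 4 * \int[P]_w (v (xi 0%N w) * u (xi 0%N w) ^+ 2)) + a
     <= \sum_(i < n) u (xi i w) * nbscore k beta (xi i w) (Ys i w))%R]
   <= (expR (- a))%:E)%E.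
Proof.
move=> mu u20 u48.
pose f (s : p.-tuple R * nat) := u s.1 * nbscore k beta s.1 s.2.
have mf : measurable_fun setT f.
  apply: measurable_funM; last exact: measurable_nbscore.
  exact: (measurableT_comp mu measurable_fst).
have mvu : measurable_fun setT (fun w => v (xi 0%N w) * u (xi 0%N w) ^+ 2).
  apply: (measurableT_comp (f := fun x => v x * u x ^+ 2)) => //.
  by apply: measurable_funM; [exact: measurable_nbvar|exact: measurable_funX].
have lvu : L1 P (fun w => v (xi 0%N w) * u (xi 0%N w) ^+ 2).
  apply: (L1_bounded _ mvu (c := 1 / 48)) => w.
  by rewrite ger0_norm// mulr_ge0 ?sqr_ge0// ltW// nbvar_gt0.
apply: (@chernoff_independent R d T P _ _ (fun i => obs (Xs i) (Ys i)) n f) => // i.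
rewrite (same_law_integral (g := fun s => (expR (f s))%:E) (mZ i) (mZ 0%N) (law i))//; last first.
  by apply/measurable_EFinP; apply: measurableT_comp.
apply: (le_trans (nbscore_mgf k_gt0 (mZ 0%N) hNB mu u20 u48)).
rewrite EFin_Rintegral; last by apply: L1D; [exact: finite_measure_integrable_cst|exact: L1Z].
rewrite RintegralDT ?Rintegral_cstT ?RintegralZT//; last 2 first.
- exact: finite_measure_integrable_cst.
- exact: L1Z.
by rewrite lee_fin expR_ge1Dx.
Qed.

Lemma nbweight_deviation (z : p.-tuple R -> R) (n : nat) (a : R) :
  measurable_fun setT z ->
  (forall x, `|z x| * (1 + v x) <= 1 / 25) ->
  (P [set w | (n%:R * (\int[P]_w (v (xi 0%N w) * z (xi 0%N w)) +
        6 / 5 * \int[P]_w ((v (xi 0%N w) + v (xi 0%N w) ^+ 2) * z (xi 0%N w) ^+ 2)) + a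
     <= \sum_(i < n) z (xi i w) * nbweight k beta (xi i w) (Ys i w))%R]
   <= (expR (- a))%:E)%E.
Proof.
move=> mz z25.
pose f (s : p.-tuple R * nat) := z s.1 * nbweight k beta s.1 s.2.
have mv : measurable_fun setT v by exact: measurable_nbvar.
have mf : measurable_fun setT f.
  apply: measurable_funM; last exact: measurable_nbweight.
  exact: (measurableT_comp mz measurable_fst).
have v0 x : 0 < v x by exact: nbvar_gt0.
have z25' x : `|z x| <= 1 / 25.
  by apply: le_trans (z25 x); rewrite ler_peMr// lerDl ltW.
have lvz : L1 P (fun w => v (xi 0%N w) * z (xi 0%N w)).
  apply: (L1_bounded _ _ (c := 1 / 25)) => [|w].
    apply: (measurableT_comp (f := fun x => v x * z x)) => //.
    exact: measurable_funM.
  rewrite normrM (gtr0_norm (v0 _)) mulrC; apply: le_trans (z25 (xi 0%N w)).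
  by rewrite ler_wpM2l// lerDr.
have lvz2 : L1 P (fun w => (v (xi 0%N w) + v (xi 0%N w) ^+ 2) * z (xi 0%N w) ^+ 2).
  apply: (L1_bounded _ _ (c := 1 / 25)) => [|w].
    apply: (measurableT_comp (f := fun x => (v x + v x ^+ 2) * z x ^+ 2)) => //.
    apply: measurable_funM; last exact: measurable_funX.
    by apply: measurable_funD => //; exact: measurable_funX.
  have z2 : z (xi 0%N w) ^+ 2 = `|z (xi 0%N w)| ^+ 2 by rewrite real_normK ?num_real.
  have vz0 : 0 <= (v (xi 0%N w) + v (xi 0%N w) ^+ 2) * z (xi 0%N w) ^+ 2.
    by rewrite mulr_ge0 ?sqr_ge0// addr_ge0 ?sqr_ge0// ltW.
  rewrite (ger0_norm vz0) z2 {z2 vz0}.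
  have := z25 (xi 0%N w); have := z25' (xi 0%N w); have := v0 (xi 0%N w).
  have := normr_ge0 (z (xi 0%N w)).
  move: (`|_|) (v _) => a0 b ha hb h1 h2.
  have -> : (b + b ^+ 2) * a0 ^+ 2 = (a0 * (1 + b)) * (b * a0) by ring.
  have ba : b * a0 <= 1 / 25 by nra.
  apply: (@le_trans _ _ (1 / 25 * (1 / 25))); last by lra.
  by apply: ler_pM => //; rewrite mulr_ge0// ?addr_ge0// ltW.
apply: (@chernoff_independent R d T P _ _ (fun i => obs (Xs i) (Ys i)) n f) => // i.
rewrite (same_law_integral (g := fun s => (expR (f s))%:E) (mZ i) (mZ 0%N) (law i))//; last first.
  by apply/measurable_EFinP; apply: measurableT_comp.
apply: (le_trans (nbweight_mgf k_gt0 (mZ 0%N) hNB mz z25)).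
have l1 : L1 P (fun=> 1 : R) by exact: finite_measure_integrable_cst.
rewrite EFin_Rintegral; last by apply: L1D; [exact: L1D|exact: L1Z].
rewrite RintegralDT ?RintegralDT ?Rintegral_cstT ?RintegralZT//.
- by rewrite -addrA lee_fin expR_ge1Dx.
- exact: L1D.
- exact: L1Z.
Qed.

End deviations.

(** * Population moments of the design *)

Section elementary.
Context (R : realType).

Lemma ln2_le : ln 2 <= 3 / 4 :> R.
Proof.
rewrite -[X in _ <= X]expRK ler_ln ?posrE ?expR_gt0//.
have -> : 3 / 4 = 8%:R * (3 / 32) :> R by field.
rewrite expRM_natl; apply: (@le_trans _ _ ((1 + 3 / 32) ^+ 8)); first by lra.
by rewrite lerXn2r ?nnegrE ?expR_ge0// ?expR_ge1Dx//; lra.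
Qed.

Lemma ln2_ge : 1 / 2 <= ln 2 :> R.
Proof.
rewrite -[X in X <= _]expRK ler_ln ?posrE ?expR_gt0//.
have := expR_ge1Dx (- (1 / 2) : R); rewrite expRN => H.
have : 1 / 2 * expR (1 / 2) <= 1 :> R by rewrite -ler_pdivlMr// [X in _ <= X]div1r; lra.
by lra.
Qed.

(** The sixth power of [expR (t / 6) >= 1 + t / 6] is strong enough; the difference is displayed as
    a sum of nonnegative terms. *)
Lemma expR_sub1_ge_sqr (t : R) : 0 <= t -> t ^+ 2 <= expR t - 1.
Proof.
move=> t0; pose s := t / 6.
have s0 : 0 <= s by rewrite divr_ge0.
have -> : t = 6%:R * s by rewrite /s; field.
rewrite expRM_natl.
have : (1 + s) ^+ 6 <= expR s ^+ 6.
  by rewrite lerXn2r ?nnegrE ?expR_ge0 ?expR_ge1Dx// addr_ge0.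
suff : (6%:R * s) ^+ 2 <= (1 + s) ^+ 6 - 1 by lra.
rewrite -subr_ge0.
have -> : (1 + s) ^+ 6 - 1 - (6%:R * s) ^+ 2 =
    s * (20 * (s - 21 / 40) ^+ 2 + 39 / 80 + 15 * s ^+ 3 + 6 * s ^+ 4 + s ^+ 5).
  by field.
have q0 := sqr_ge0 (s - 21 / 40).
have s3 := exprn_ge0 3 s0; have s4 := exprn_ge0 4 s0; have s5 := exprn_ge0 5 s0.
by rewrite mulr_ge0//; lra.
Qed.

(** The inequality [u / lam <= expR (u / lam - 1)], raised to the power [r]. *)
Lemma powR_le_expR (r lam u : R) : 0 < r -> 0 < lam -> 0 <= u ->
  r * (u / lam - 1) <= u - lam -> u `^ r <= lam `^ r * expR (u - lam).
Proof.
move=> r0 l0 u0 H.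
have -> : u = lam * (u / lam) by field; rewrite gt_eqF.
rewrite powRM ?(ltW l0) ?divr_ge0 ?(ltW l0)// ler_wpM2l ?powR_ge0//.
have -> : lam * (u / lam) = u by field; rewrite gt_eqF.
apply: (@le_trans _ _ (expR (r * (u / lam - 1)))); last by rewrite ler_expR.
rewrite [r * _]mulrC expRM ge0_ler_powR ?nnegrE ?(ltW r0) ?divr_ge0 ?(ltW l0) ?expR_ge0//.
by apply: le_trans (expR_ge1Dx _); lra.
Qed.

(** In terms of [u = (|x| / M) ^ theta] and [r = 2 / theta], the left side is [M ^ 2 * u ^ r]. Up to
    [lam] the first summand suffices. Beyond [lam] the function [u ^ r * expR (- u)] decreases,
    because [lam >= r], which gives the second summand. *)
Lemma sqr_le_subweibull (theta M lam x : R) : 0 < theta -> 0 < M ->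
  2 / theta <= lam ->
  x ^+ 2 <= M ^+ 2 * lam `^ (2 / theta) *
    (1 + expR (- lam) * expR (`|x| `^ theta / M `^ theta)).
Proof.
move=> th0 M0 hl; set u := `|x| `^ theta / M `^ theta.
have u0 : 0 <= u by rewrite divr_ge0// powR_ge0.
have r0 : 0 < 2 / theta by rewrite divr_gt0.
have l0 : 0 < lam by exact: lt_le_trans hl.
have -> : x ^+ 2 = M ^+ 2 * u `^ (2 / theta).
  have -> : u = (`|x| / M) `^ theta.
    by rewrite /u powRM ?invr_ge0 ?(ltW M0)// -[M^-1](powR_inv1 (ltW M0)) -powRrM mulN1r powRN.
  have -> : (`|x| / M) `^ theta `^ (2 / theta) = (`|x| / M) ^+ 2.
    rewrite -powRrM -powR_mulrn ?divr_ge0 ?(ltW M0)//.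
    by congr (_ `^ _); field; rewrite gt_eqF.
  by rewrite -(real_normK (num_real x)); field; rewrite gt_eqF.
rewrite -mulrA ler_wpM2l ?sqr_ge0//.
have [ul|ul] := leP u lam.
  apply: (@le_trans _ _ (lam `^ (2 / theta))).
    by rewrite ge0_ler_powR ?nnegrE ?(ltW r0) ?(ltW l0).
  by rewrite ler_peMr ?powR_ge0// lerDl mulr_ge0 ?expR_ge0.
apply: (@le_trans _ _ (lam `^ (2 / theta) * expR (u - lam))).
  apply: powR_le_expR => //.
  have -> : u / lam - 1 = (u - lam) / lam by field; rewrite gt_eqF.
  rewrite mulrCA ger_pMr ?subr_gt0//.
  by rewrite ler_pdivrMr// mul1r.
by rewrite ler_wpM2l ?powR_ge0// expRD mulrC lerDr.
Qed.

(** The factor is the global maximum of [u ^ r * expR (- u)], attained at [u = r = 2 / theta]. With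
    no condition on a truncation level, this bound is available before [2 / theta <= lam] is
    known. *)
Lemma sqr_le_subweibull_max (theta M x : R) : 0 < theta -> 0 < M ->
  x ^+ 2 <= M ^+ 2 * (2 / theta) `^ (2 / theta) * expR (- (2 / theta)) *
    expR (`|x| `^ theta / M `^ theta).
Proof.
move=> th0 M0; set u := `|x| `^ theta / M `^ theta.
have u0 : 0 <= u by rewrite divr_ge0// powR_ge0.
have r0 : 0 < 2 / theta by rewrite divr_gt0.
have -> : x ^+ 2 = M ^+ 2 * u `^ (2 / theta).
  have -> : u = (`|x| / M) `^ theta.
    by rewrite /u powRM ?invr_ge0 ?(ltW M0)// -[M^-1](powR_inv1 (ltW M0)) -powRrM mulN1r powRN.
  have -> : (`|x| / M) `^ theta `^ (2 / theta) = (`|x| / M) ^+ 2.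
    rewrite -powRrM -powR_mulrn ?divr_ge0 ?(ltW M0)//.
    by congr (_ `^ _); field; rewrite gt_eqF.
  by rewrite -(real_normK (num_real x)); field; rewrite gt_eqF.
rewrite -[_ * expR (- _)]mulrA -[_ * _ * expR _]mulrA ler_wpM2l ?sqr_ge0//.
rewrite -[X in _ <= X]mulrA -expRD [- _ + _]addrC.
apply: powR_le_expR => //.
by rewrite mulrBr mulr1 [_ * (u / _)]mulrC divfK ?gt_eqF.
Qed.

End elementary.

Section population.
Context (R : realType) (p : nat) (k : R) (beta : 'cV[R]_p).
Context (d : measure_display) (T : measurableType d).
Variables (P : probability T R) (X : T -> 'cV[R]_p) (Y : T -> nat).
Variables (theta MX MY B : R).
Hypothesis k_gt0 : 0 < k.
Hypothesis theta_gt0 : 0 < theta.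
Hypothesis MX_gt0 : 0 < MX.
Hypothesis MY_gt0 : 0 < MY.
Hypothesis B_gt0 : 0 < B.
Hypothesis mXY : measurable_fun setT (obs X Y).
Hypothesis hNB : nb_given P k beta X Y.
Hypothesis hX : forall j,
  (\int[P]_w (expR (`|X w j 0| `^ theta / MX `^ theta))%:E <= 2%:E)%E.
Hypothesis hY :
  (\int[P]_w (expR (`|(Y w)%:R| `^ 1 / MY `^ 1))%:E <= 2%:E)%E.
Hypothesis hB : {ae P, forall w, nbmean beta (cvtuple (X w)) <= B}.

Local Notation xi w := (cvtuple (X w)).
Local Notation v := (nbvar k beta).

Let mX : measurable_fun setT (fun w => xi w).
Proof. exact: (measurable_cvtuple mXY). Qed.

Let mcomp (f : p.-tuple R -> R) : measurable_fun setT f ->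
  measurable_fun setT (fun w => f (xi w)).
Proof. by move=> mf; exact: (measurableT_comp mf). Qed.

Let mv : measurable_fun setT (fun w => v (xi w)).
Proof. by apply: mcomp; exact: measurable_nbvar. Qed.

Let v_gt0 x : 0 < v x. Proof. exact: nbvar_gt0. Qed.

Lemma measurable_coord j : measurable_fun setT (fun w => X w j 0).
Proof.
rewrite (_ : (fun w => _) = (fun w => tnth (xi w) j)).
  by apply: (@mcomp (fun x => tnth x j)); exact: measurable_tnth.
by apply/funext => w; rewrite tnth_mktuple.
Qed.

Let expX j w := expR (`|X w j 0| `^ theta / MX `^ theta).

Let L1_expX j : L1 P (expX j) /\ \int[P]_w expX j w <= 2.
Proof.
apply: (L1_ge0 _ _ (hX j)).
  by apply: measurable_subweibull_exp; exact: measurable_coord.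
by move=> w; exact: expR_ge0.
Qed.

Lemma L1_nbvar : L1 P (fun w => v (xi w)).
Proof.
apply: (L1_bounded P mv (c := k)) => w.
by rewrite ger0_norm ?nbvar_le_k// ltW.
Qed.

Let L1v := L1_nbvar.

Lemma ae_nbvar_le : {ae P, forall w, v (xi w) <= B}.
Proof.
apply: filterS hB => w; apply: le_trans; exact: nbvar_le_mean.
Qed.

Lemma nbvar_expectation_le : \int[P]_w v (xi w) <= B.
Proof.
rewrite -[X in _ <= X](Rintegral_cstT P); apply: ae_le_Rintegral => //.
- exact: finite_measure_integrable_cst.
- by move=> w; rewrite ltW.
- by move=> _; rewrite ltW.
- exact: ae_nbvar_le.
Qed.

Let L1_sqr j : L1 P (fun w => X w j 0 ^+ 2).
Proof.
have [l1 _] := L1_expX j.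
apply: (L1_le _ (L1Z (MX ^+ 2 * (2 / theta) `^ (2 / theta) * expR (- (2 / theta))) l1)).
  by apply: measurable_funX; exact: measurable_coord.
by move=> w; rewrite ger0_norm ?sqr_ge0// sqr_le_subweibull_max.
Qed.

Lemma L1_nbvar_sqr j : L1 P (fun w => v (xi w) * X w j 0 ^+ 2).
Proof.
apply: (L1_le _ (L1Z k (L1_sqr j))).
  apply: measurable_funM => //.
  by apply: measurable_funX; exact: measurable_coord.
move=> w; rewrite ger0_norm; last by rewrite mulr_ge0 ?sqr_ge0// ltW.
by rewrite ler_wpM2r ?sqr_ge0// nbvar_le_k.
Qed.

Let L1_vsqr := L1_nbvar_sqr.

Lemma nbvar_sqr_le_max j : \int[P]_w (v (xi w) * X w j 0 ^+ 2) <=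
  k * (2 * (MX ^+ 2 * (2 / theta) `^ (2 / theta) * expR (- (2 / theta)))).
Proof.
have [l1 e2] := L1_expX j.
set c := MX ^+ 2 * _ * _.
have c0 : 0 <= c by rewrite mulr_ge0 ?expR_ge0// mulr_ge0 ?powR_ge0 ?sqr_ge0.
apply: (@le_trans _ _ (\int[P]_w (k * (c * expX j w)))).
  apply: le_RintegralT => //; first by apply: L1Z; exact: L1Z.
  move=> w; apply: ler_pM; rewrite ?sqr_ge0 ?nbvar_le_k// ?(ltW (v_gt0 _))//.
  exact: sqr_le_subweibull_max.
rewrite !RintegralZT//; last exact: L1Z.
by rewrite ler_wpM2l ?(ltW k_gt0)// mulrC ler_wpM2r.
Qed.

(** In the main term the factor [nbvar] is kept, so that its mean appears; in the tail term it is
    replaced by [B], and the exponential moment contributes the 2. The set [A] is the whole space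
    for the variance and the complement of the design set for the bias. *)
Lemma nbvar_sqr_restrict_le lam j (A : set (p.-tuple R)) : 2 / theta <= lam ->
  measurable A ->
  \int[P]_w (v (xi w) * X w j 0 ^+ 2 * \1_A (xi w)) <=
  MX ^+ 2 * lam `^ (2 / theta) *
   (\int[P]_w (v (xi w) * \1_A (xi w)) + 2 * B * expR (- lam)).
Proof.
move=> hlam mA; have [l1 e2] := L1_expX j.
set nu := MX ^+ 2 * _.
have nu0 : 0 <= nu by rewrite mulr_ge0 ?powR_ge0 ?sqr_ge0.
have mA1 : measurable_fun setT (fun w => \1_A (xi w) : R).
  by apply: (@mcomp (\1_A)); exact: measurable_indic.
have A01 w : 0 <= (\1_A (xi w) : R) <= 1.
  by rewrite indicE; case: (_ \in _); rewrite ?lexx ?ler01.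
have l2 : L1 P (fun w => v (xi w) * \1_A (xi w)).
  apply: (L1_le _ L1v); first exact: measurable_funM.
  move=> w; have /andP[a0 a1] := A01 w.
  have va0 : 0 <= v (xi w) * \1_A (xi w) by rewrite mulr_ge0// ltW.
  by rewrite (ger0_norm va0) ler_piMr// ltW.
apply: (@le_trans _ _ (\int[P]_w (nu * (v (xi w) * \1_A (xi w) +
     (B * expR (- lam)) * expX j w)))).
  apply: ae_le_Rintegral.
  - apply: (L1_le _ (L1_vsqr j)).
      apply: measurable_funM => //; apply: measurable_funM => //.
      by apply: measurable_funX; exact: measurable_coord.
    move=> w; have /andP[a0 a1] := A01 w.
    have vx0 : 0 <= v (xi w) * X w j 0 ^+ 2 by rewrite mulr_ge0 ?sqr_ge0// ltW.
    have vxa0 := mulr_ge0 vx0 a0.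
    by rewrite (ger0_norm vxa0) ler_piMr.
  - by apply: L1Z; apply: L1D => //; exact: L1Z.
  - move=> w; have /andP[a0 a1] := A01 w.
    by rewrite mulr_ge0// mulr_ge0 ?sqr_ge0// ltW.
  - move=> w; have /andP[a0 a1] := A01 w.
    have va0 := mulr_ge0 (ltW (v_gt0 (xi w))) a0.
    have be0 := mulr_ge0 (mulr_ge0 (ltW B_gt0) (expR_ge0 (- lam))) (expR_ge0 (`|X w j 0| `^ theta / MX `^ theta)).
    exact: (mulr_ge0 nu0 (addr_ge0 va0 be0)).
  - apply: filterS ae_nbvar_le => w vB; have /andP[a0 a1] := A01 w.
    have v0 := v_gt0 (xi w).
    apply: (@le_trans _ _ (v (xi w) * (nu * (1 + expR (- lam) * expX j w)) * \1_A (xi w))).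
      rewrite ler_wpM2r// ler_wpM2l ?(ltW v0)//.
      exact: sqr_le_subweibull.
    have -> : v (xi w) * (nu * (1 + expR (- lam) * expX j w)) * \1_A (xi w) =
       nu * (v (xi w) * \1_A (xi w) + (v (xi w) * \1_A (xi w)) * (expR (- lam) * expX j w)).
      by ring.
    rewrite ler_wpM2l// lerD2l -[X in _ <= X]mulrA.
    rewrite (ler_wpM2r (mulr_ge0 (expR_ge0 _) (expR_ge0 _)))//.
    by apply: le_trans vB; rewrite ler_piMr// ltW.
rewrite RintegralZT; last by apply: L1D => //; exact: L1Z.
rewrite ler_wpM2l// RintegralDT//; last exact: L1Z.
rewrite RintegralZT// lerD2l.
have -> : 2 * B * expR (- lam) = B * expR (- lam) * 2 by ring.
by rewrite ler_wpM2l// mulr_ge0 ?expR_ge0// ltW.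
Qed.

(** A positive count is at least 1, so its exponential moment is at least
    [1 + (expR MY^-1 - 1) * q], where [q] is the probability in question; this is at most 2. *)
Lemma probability_nonzero_count_le : fine (P [set w | (0 < Y w)%N]) <= MY ^+ 2.
Proof.
have mY : measurable_fun setT Y by exact: (measurable_count mXY).
have mE : measurable [set w | (0 < Y w)%N].
  by rewrite -[X in measurable X]setTI; apply: (mY _ [set y | (0 < y)%N]).
set E := [set w | (0 < Y w)%N] in mE *.
have MYt : expR MY^-1 - 1 >= MY^-1 ^+ 2.
  by apply: expR_sub1_ge_sqr; rewrite invr_ge0 ltW.
have : (\int[P]_w ((1 + (expR MY^-1 - 1) * \1_E w)%:E) <= 2%:E)%E.
  apply: le_trans hY; apply: ge0_le_integral => //=.
  - apply/measurable_EFinP; apply: measurable_funD => //.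
    by apply: measurable_funM => //; exact: measurable_indic.
  - apply/measurable_EFinP; apply: measurable_subweibull_exp.
    exact: (measurableT_comp (f := fun n : nat => n%:R : R)).
  - move=> w _; rewrite lee_fin !powRr1 ?(ltW MY_gt0)// indicE.
    have [wE|wE] := boolP (w \in E); last first.
      by rewrite mulr0 addr0 -expR0 ler_expR divr_ge0// ltW.
    rewrite mulr1 subrKC ler_expR ger0_norm// -[X in X <= _]mul1r.
    by rewrite ler_wpM2r ?invr_ge0 ?(ltW MY_gt0)// ler1n; move: wE; rewrite inE.
have lE : L1 P (\1_E) by exact: integrable_indic.
have l1 : L1 P (fun=> 1 : R) by exact: finite_measure_integrable_cst.
rewrite EFin_Rintegral; last by apply: L1D => //; exact: L1Z.
rewrite RintegralDT//; last exact: L1Z.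
rewrite RintegralZT// Rintegral_cstT lee_fin.
have -> : \int[P]_w \1_E w = fine (P E).
  by rewrite /Rintegral integral_indic// setIT.
set q := fine (P E) => H.
have q0 : 0 <= q by rewrite fine_ge0.
have : MY^-1 ^+ 2 * q <= 1.
  by apply: (@le_trans _ _ ((expR MY^-1 - 1) * q)); [rewrite ler_wpM2r|lra].
by rewrite exprVn mulrC ler_pdivrMr ?exprn_gt0// mul1r.
Qed.

(* The negative binomial mass at [0] is at most [expR (- v)], and
   [v <= (1 + v) * (1 - expR (- v))]. *)
Lemma nbvar_expectation_le_prob :
  \int[P]_w v (xi w) <= (1 + B) * fine (P [set w | (0 < Y w)%N]).
Proof.
have mY : measurable_fun setT Y by exact: (measurable_count mXY).
have mE : measurable [set w | (0 < Y w)%N].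
  by rewrite -[X in measurable X]setTI; apply: (mY _ [set y | (0 < y)%N]).
set E := [set w | (0 < Y w)%N] in mE *.
pose f w := nb_pmf k (nbmean beta (xi w)) 0.
have fE w : f w = (k / (k + nbmean beta (xi w))) `^ k.
  by rewrite /f /nb_pmf big_ord0 fact0 divr1 mul1r expr0 mulr1.
have f0 w : 0 <= f w by rewrite fE powR_ge0.
have fv w : f w <= expR (- v (xi w)).
  have km0 := kmean_gt0 beta k_gt0 (xi w).
  have -> : - v (xi w) = (k / (k + nbmean beta (xi w)) - 1) * k.
    by rewrite /nbvar; field; rewrite gt_eqF.
  rewrite fE.
  rewrite expRM ge0_ler_powR ?nnegrE ?(ltW k_gt0) ?expR_ge0//.
    by rewrite divr_ge0// ltW.
  by apply: le_trans (expR_ge1Dx _); lra.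
have f1 w : f w <= 1.
  by apply: (le_trans (fv w)); rewrite expR_le1 oppr_le0 ltW.
have mf : measurable_fun setT f.
  apply: (@mcomp (fun x => nb_pmf k (nbmean beta x) 0)).
  exact: measurable_nb_pmf.
have lf : L1 P f.
  by apply: (L1_bounded P mf (c := 1)) => w; rewrite ger0_norm.
have l1 : L1 P (fun=> 1 : R) by exact: finite_measure_integrable_cst.
have lf1 : L1 P (fun w => 1 + - 1 * f w) by apply: L1D => //; exact: L1Z.
have qE : fine (P E) = \int[P]_w (1 + - 1 * f w).
  rewrite RintegralDT//; last exact: L1Z.
  rewrite RintegralZT// Rintegral_cstT mulN1r.
  have := hNB 0 measurableT.
  rewrite (_ : [set w | [set: p.-tuple R] (xi w)] = setT); last first.
    by apply/seteqP; split.
  under eq_integral do rewrite -tdotE.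
  rewrite (EFin_Rintegral lf) => H.
  have PE : fine (P (~` E)) = \int[P]_w f w.
    rewrite -[RHS]/(fine (\int[P]_w f w)%:E) -H; congr (fine (P _)).
    apply/seteqP; split => w /=.
      by move=> /negP; rewrite -eqn0Ngt => /eqP.
    by move=> [_ Yw]; rewrite /E /= Yw.
  by rewrite -PE probability_setC// fineB ?fin_num_measure//= opprB addrC subrK.
rewrite qE -RintegralZT//.
apply: ae_le_Rintegral => //.
- exact: L1Z.
- by move=> w; rewrite ltW.
- by move=> w; have f1w := f1 w; apply: mulr_ge0; have := B_gt0; lra.
have := ae_nbvar_le; apply: filterS => w vB; have v0 := v_gt0 (xi w).
have fvw := fv w.
have : (1 + v (xi w)) * expR (- v (xi w)) <= 1.
  rewrite expRN -[X in _ <= X](mulfV (lt0r_neq0 (expR_gt0 (v (xi w))))).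
  by rewrite ler_wpM2r ?invr_ge0 ?expR_ge0// expR_ge1Dx.
have e1 : expR (- v (xi w)) <= 1 by rewrite expR_le1 oppr_le0 ltW.
move: (f w) (v (xi w)) (expR (- v (xi w))) v0 vB fvw e1 => F V E0 V0 VB FE0 E1 H.
apply: (@le_trans _ _ ((1 + V) * (1 - E0))); first by nra.
by apply: ler_pM; lra.
Qed.

(** The rate is linear in [M], so the variance has to be quadratic in it. For [B <= 1 / 2] the bound
    [(1 + B) * MY ^ 2] does it; for [B > 1 / 2] the bound [B] does, since then [B < 2 * B ^ 2]. *)
Lemma nbvar_expectation_le_M2 (M : R) : M = MY + B / ln 2 ->
  \int[P]_w v (xi w) <= 3 / 2 * M ^+ 2.
Proof.
move=> ->.
have H1 := nbvar_expectation_le_prob; have H2 := probability_nonzero_count_le.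
have H3 := nbvar_expectation_le.
have q0 : 0 <= fine (P [set w | (0 < Y w)%N]) by rewrite fine_ge0.
have l2 := ln2_le R; have l3 := ln2_ge R.
have BB : B <= 3 / 4 * (B / ln 2).
  have l0 : 0 < ln 2 :> R by lra.
  rewrite mulrA ler_pdivlMr//.
  by rewrite mulrC ler_wpM2r// ltW.
move: (\int[P]_w _) (fine _) (B / ln 2) H1 H2 H3 q0 BB => e q b H1 H2 H3 q0 BB.
have b0 : 0 < b by have := B_gt0; lra.
have [B2|B2] := leP B (1 / 2).
  have : e <= 3 / 2 * MY ^+ 2.
    apply: (le_trans H1); apply: ler_pM => //; have := B_gt0; lra.
  have := MY_gt0; nra.
have := MY_gt0; nra.
Qed.

End population.

(** Cauchy-Schwarz, from the Lagrange identity. *)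
Lemma cauchy_schwarz_sum (R : realType) (I : finType) (a b : I -> R) :
  (\sum_i a i * b i) ^+ 2 <= (\sum_i a i ^+ 2) * (\sum_i b i ^+ 2).
Proof.
rewrite -subr_ge0.
have -> : (\sum_i a i ^+ 2) * (\sum_i b i ^+ 2) - (\sum_i a i * b i) ^+ 2 =
    2^-1 * \sum_i \sum_j (a i * b j - a j * b i) ^+ 2.
  have S1 : \sum_i \sum_j a i ^+ 2 * b j ^+ 2 = (\sum_i a i ^+ 2) * (\sum_i b i ^+ 2).
    by rewrite mulr_suml; apply: eq_bigr => i _; rewrite mulr_sumr.
  have S2 : \sum_i \sum_j a j ^+ 2 * b i ^+ 2 = (\sum_i a i ^+ 2) * (\sum_i b i ^+ 2).
    by rewrite exchange_big.
  have S3 : \sum_i \sum_j (a i * b i) * (a j * b j) = (\sum_i a i * b i) ^+ 2.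
    by rewrite expr2 mulr_suml; apply: eq_bigr => i _; rewrite mulr_sumr.
  have -> : \sum_i \sum_j (a i * b j - a j * b i) ^+ 2 =
    \sum_i \sum_j a i ^+ 2 * b j ^+ 2 + \sum_i \sum_j a j ^+ 2 * b i ^+ 2
    - 2 * \sum_i \sum_j (a i * b i) * (a j * b j).
    rewrite mulr_sumr -sumrN -!big_split; apply: eq_bigr => i _ /=.
    rewrite mulr_sumr -sumrN -!big_split; apply: eq_bigr => j _ /=.
    ring.
  by rewrite S1 S2 S3; field.
rewrite mulr_ge0 ?invr_ge0//; apply: sumr_ge0 => i _; apply: sumr_ge0 => j _.
exact: sqr_ge0.
Qed.

Lemma dotv_sqr_le (R : realType) (p : nat) (x b : 'cV[R]_p) :
  dotv x b ^+ 2 <= (\sum_j x j 0 ^+ 2) * (\sum_j b j 0 ^+ 2).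
Proof.
apply: le_trans (cauchy_schwarz_sum _ _).
by rewrite /dotv mxE; under eq_bigr do rewrite mxE.
Qed.

(** The condition of [bounded_design_event] on one covariate, read on tuples. The squared norm is
    faithful for [0 <= I]. *)
Definition design_set (R : realType) (p : nat) (beta : 'cV[R]_p) (B I : R) :
    set (p.-tuple R) :=
  [set x | nbmean beta x <= B /\ sqnorm x <= I ^+ 2].

Lemma measurable_design_set (R : realType) (p : nat) (beta : 'cV[R]_p) (B I : R) :
  measurable (design_set beta B I).
Proof.
rewrite (_ : design_set beta B I =
    [set x | nbmean beta x <= B] `&` [set x | sqnorm x <= I ^+ 2])//.
apply: measurableI; rewrite -[X in measurable X]setTI.
  by apply: measurable_fun_le => //; exact: measurable_nbmean.
by apply: measurable_fun_le => //; exact: measurable_sqnorm.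
Qed.

Lemma natr_mul_sum (R : realType) (p : nat) (c : R) : p%:R * c = \sum_(j < p) c.
Proof. by rewrite sumr_const card_ord mulr_natl. Qed.

(** * Second moments inside and outside the design set *)

Section population_design.
Context (R : realType) (p : nat) (k : R) (beta : 'cV[R]_p).
Context (d : measure_display) (T : measurableType d).
Variables (P : probability T R) (X : T -> 'cV[R]_p) (Y : T -> nat).
Variables (theta MX B I Cmin lam : R).
Hypothesis k_gt0 : 0 < k.
Hypothesis theta_gt0 : 0 < theta.
Hypothesis MX_gt0 : 0 < MX.
Hypothesis B_gt0 : 0 < B.
Hypothesis I_ge0 : 0 <= I.
Hypothesis mXY : measurable_fun setT (obs X Y).
Hypothesis hNB : nb_given P k beta X Y.
Hypothesis hX : forall j,
  (\int[P]_w (expR (`|X w j 0| `^ theta / MX `^ theta))%:E <= 2%:E)%E.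
Hypothesis hB : {ae P, forall w, nbmean beta (cvtuple (X w)) <= B}.
Hypothesis hH : forall b : 'cV[R]_p, norm2 b = 1 ->
  Cmin <= (b^T *m expectation_mx P
    (fun w => nbweight k beta (cvtuple (X w)) (Y w) *: (X w *m (X w)^T)) *m b) 0 0.

Local Notation xi w := (cvtuple (X w)).
Local Notation v := (nbvar k beta).
Local Notation D := (design_set beta B I).

Let v_gt0 x : 0 < v x. Proof. exact: nbvar_gt0. Qed.
Let mX : measurable_fun setT (fun w => xi w).
Proof. exact: (measurable_cvtuple mXY). Qed.
Let mc j : measurable_fun setT (fun w => X w j 0).
Proof. exact: (measurable_coord mXY). Qed.
Let mv : measurable_fun setT (fun w => v (xi w)).
Proof. by apply: (measurableT_comp (measurable_nbvar beta k_gt0)). Qed.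
Let L1_vsqr j := L1_nbvar_sqr beta k_gt0 theta_gt0 MX_gt0 mXY hX j.

Let mind (A : set (p.-tuple R)) : measurable A ->
  measurable_fun setT (fun w => \1_A (xi w) : R).
Proof.
by move=> mA; apply: (measurableT_comp (f := \1_A : p.-tuple R -> R)) => //; exact: measurable_indic.
Qed.

Let ind01 (A : set (p.-tuple R)) w : 0 <= (\1_A (xi w) : R) <= 1.
Proof. by rewrite indicE; case: (_ \in _); rewrite ?lexx ?ler01. Qed.

Lemma sqnormE w : sqnorm (xi w) = \sum_j X w j 0 ^+ 2.
Proof. by apply: eq_bigr => j _; rewrite tnth_mktuple. Qed.

Lemma L1_nbvar_prod j l : L1 P (fun w => v (xi w) * (X w j 0 * X w l 0)).
Proof.
apply: (L1_le _ (L1D (L1_vsqr j) (L1_vsqr l))).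
  by apply: measurable_funM => //; exact: measurable_funM.
move=> w; rewrite normrM (gtr0_norm (v_gt0 _)) -mulrDr ler_wpM2l ?(ltW (v_gt0 _))//.
rewrite normrM -(real_normK (num_real (X w j 0))) -(real_normK (num_real (X w l 0))).
have := normr_ge0 (X w j 0); have := normr_ge0 (X w l 0).
by move: `|_| `|_| => a c a0 c0; nra.
Qed.

Lemma L1_nbvar_prod_restrict j l (A : set (p.-tuple R)) : measurable A ->
  L1 P (fun w => v (xi w) * (X w j 0 * X w l 0 * \1_A (xi w))).
Proof.
move=> mA; apply: (L1_le _ (integrable_norm (L1_nbvar_prod j l))).
  by apply: measurable_funM => //; apply: measurable_funM; [exact: measurable_funM|exact: mind].
move=> w /=; rewrite mulrA normrM ler_piMr// ger0_norm; by have /andP[] := ind01 A w.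
Qed.

Lemma quadratic_nbvar_restrict (b : 'cV[R]_p) (A : set (p.-tuple R)) : measurable A ->
  \sum_j \sum_l b j 0 * b l 0 *
    \int[P]_w (v (xi w) * (X w j 0 * X w l 0 * \1_A (xi w))) =
  \int[P]_w (v (xi w) * (dotv (X w) b ^+ 2 * \1_A (xi w))).
Proof.
move=> mA; have l2 := fun j l => L1Z (b j 0 * b l 0) (L1_nbvar_prod_restrict j l mA).
pose f j l w := b j 0 * b l 0 * (v (xi w) * (X w j 0 * X w l 0 * \1_A (xi w))).
transitivity (\sum_j \sum_l \int[P]_w f j l w).
  apply: eq_bigr => j _; apply: eq_bigr => l _.
  by rewrite RintegralZT//; exact: L1_nbvar_prod_restrict.
transitivity (\sum_j \int[P]_w \sum_l f j l w).
  by apply: eq_bigr => j _; rewrite Rintegral_sum// => l; exact: l2.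
rewrite -Rintegral_sum; last by move=> j; apply: L1_sum => l; exact: l2.
rewrite /f.
apply: eq_Rintegral => w _.
rewrite /dotv mxE expr2 mulr_suml mulr_suml mulr_sumr; apply: eq_bigr => j _.
rewrite mulr_sumr mulr_suml mulr_sumr; apply: eq_bigr => l _.
by rewrite !mxE; ring.
Qed.

(** [expectation_mx] takes [fine] of each entry, so the entries are shown integrable before the
    quadratic form is moved under the expectation. Conditioning on the covariate then replaces the
    weight by [nbvar]. *)
Lemma hessian_le_nbvar (b : 'cV[R]_p) : norm2 b = 1 ->
  Cmin <= \int[P]_w (v (xi w) * dotv (X w) b ^+ 2).
Proof.
move=> b1; apply: (le_trans (hH b1)).
have mw : measurable_fun setT (fun w => nbweight k beta (xi w) (Y w)).
  exact: (measurableT_comp (measurable_nbweight beta k_gt0) mXY).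
have w0 w : 0 <= nbweight k beta (xi w) (Y w) by exact: nbweight_ge0.
have lw j : L1 P (fun w => nbweight k beta (xi w) (Y w) * X w j 0 ^+ 2).
  have [] // := @L1_ge0 R d T P (fun w => nbweight k beta (xi w) (Y w) * X w j 0 ^+ 2)
     (\int[P]_w (v (xi w) * X w j 0 ^+ 2)).
  - by apply: measurable_funM => //; exact: measurable_funX.
  - by move=> w; rewrite mulr_ge0 ?sqr_ge0.
  - rewrite -EFin_Rintegral//.
    have := nbweight_mean_le k_gt0 mXY hNB (g := fun x => tnth x j ^+ 2).
    under eq_integral do rewrite tnth_mktuple.
    under [X in (_ -> _ -> _ <= X)%E]eq_integral do rewrite tnth_mktuple.
    apply; last by move=> x; exact: sqr_ge0.
    by apply: measurable_funX; exact: measurable_tnth.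
pose f j l w := nbweight k beta (xi w) (Y w) * (X w j 0 * X w l 0).
have lf j l : L1 P (f j l).
  apply: (L1_le _ (L1D (lw j) (lw l))).
    by apply: measurable_funM => //; exact: measurable_funM.
  move=> w; rewrite /f normrM (ger0_norm (w0 _)) -mulrDr ler_wpM2l//.
  rewrite normrM -(real_normK (num_real (X w j 0))) -(real_normK (num_real (X w l 0))).
  have := normr_ge0 (X w j 0); have := normr_ge0 (X w l 0).
  by move: `|_| `|_| => a c a0 c0; nra.
have -> : (b^T *m expectation_mx P
    (fun w => nbweight k beta (xi w) (Y w) *: (X w *m (X w)^T)) *m b) 0 0 =
    \int[P]_w (nbweight k beta (xi w) (Y w) * dotv (X w) b ^+ 2).
  have MfE j l : expectation_mx P
      (fun w => nbweight k beta (xi w) (Y w) *: (X w *m (X w)^T)) j l = \int[P]_w f j l w.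
    rewrite mxE unlock /Rintegral; congr fine; apply: eq_integral => w _.
    by rewrite /f !mxE big_ord1 !mxE.
  rewrite mxE; under eq_bigr do rewrite mxE mulr_suml.
  rewrite exchange_big/=.
  transitivity (\sum_j \sum_l \int[P]_w (b j 0 * b l 0 * f j l w)).
    apply: eq_bigr => j _; apply: eq_bigr => l _.
    by rewrite RintegralZT// MfE mxE; ring.
  transitivity (\sum_j \int[P]_w \sum_l (b j 0 * b l 0 * f j l w)).
    by apply: eq_bigr => j _; rewrite Rintegral_sum// => l; exact: L1Z.
  rewrite -Rintegral_sum; last by move=> j; apply: L1_sum => l; exact: L1Z.
  apply: eq_Rintegral => w _; rewrite /f.
  rewrite /dotv mxE expr2 mulr_suml mulr_sumr; apply: eq_bigr => j _.
  rewrite mulr_sumr mulr_sumr; apply: eq_bigr => l _.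
  by rewrite !mxE; ring.
have lv : L1 P (fun w => v (xi w) * dotv (X w) b ^+ 2).
  have -> : (fun w => v (xi w) * dotv (X w) b ^+ 2) =
     (fun w => \sum_j \sum_l b j 0 * b l 0 * (v (xi w) * (X w j 0 * X w l 0))).
    apply/funext => w.
    rewrite /dotv mxE expr2 mulr_suml mulr_sumr; apply: eq_bigr => j _.
    rewrite mulr_sumr mulr_sumr; apply: eq_bigr => l _.
    by rewrite !mxE; ring.
  by apply: L1_sum => j; apply: L1_sum => l; apply: L1Z; exact: L1_nbvar_prod.
have mdot : measurable_fun setT (fun x : p.-tuple R => tdot b x).
  exact: measurable_tdot.
have [] // := @L1_ge0 R d T P (fun w => nbweight k beta (xi w) (Y w) * dotv (X w) b ^+ 2)
   (\int[P]_w (v (xi w) * dotv (X w) b ^+ 2)).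
- apply: measurable_funM => //; apply: measurable_funX.
  under eq_fun do rewrite -tdotE.
  exact: (measurableT_comp mdot).
- by move=> w; rewrite mulr_ge0 ?sqr_ge0.
rewrite -EFin_Rintegral//.
under eq_integral do rewrite -tdotE.
under [X in (_ <= X)%E]eq_integral do rewrite -tdotE.
apply: (nbweight_mean_le k_gt0 mXY hNB (g := fun x => tdot b x ^+ 2)).
- exact: measurable_funX.
- by move=> x; exact: sqr_ge0.
Qed.

Lemma nbvar_sqr_le j : 2 / theta <= lam ->
  \int[P]_w (v (xi w) * X w j 0 ^+ 2) <=
  MX ^+ 2 * lam `^ (2 / theta) * (\int[P]_w v (xi w) + 2 * B * expR (- lam)).
Proof.
move=> hlam.
have := nbvar_sqr_restrict_le k_gt0 theta_gt0 MX_gt0 B_gt0 mXY hX hB j hlam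
  (@measurableT _ (p.-tuple R)).
under eq_Rintegral do rewrite indicT mulr1.
by under [in X in _ <= X -> _]eq_Rintegral do rewrite indicT mulr1.
Qed.

Lemma nbvar_bias_le : 2 / theta <= lam ->
  \sum_j \int[P]_w (v (xi w) * (X w j 0 * X w j 0 * \1_(~` D) (xi w))) <=
  p%:R * (MX ^+ 2 * lam `^ (2 / theta) *
    (B * fine (P ((fun w => xi w) @^-1` (~` D))) + 2 * B * expR (- lam))).
Proof.
move=> hlam; have mD : measurable (~` D) by apply: measurableC; exact: measurable_design_set.
have mDX : measurable ((fun w => xi w) @^-1` (~` D)).
  by rewrite -[X in measurable X]setTI; exact: mX.
rewrite natr_mul_sum; apply: ler_sum => j _.
have := nbvar_sqr_restrict_le k_gt0 theta_gt0 MX_gt0 B_gt0 mXY hX hB j hlam mD.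
have -> : (fun w => v (xi w) * X w j 0 ^+ 2 * \1_(~` D) (xi w)) =
   (fun w => v (xi w) * (X w j 0 * X w j 0 * \1_(~` D) (xi w))).
  by apply/funext => w; rewrite expr2 !mulrA.
move=> H; apply: (le_trans H).
have nu0 : 0 <= MX ^+ 2 * lam `^ (2 / theta) by apply: mulr_ge0; [exact: sqr_ge0|exact: powR_ge0].
rewrite ler_wpM2l// lerD2r.
have lI : L1 P (fun w => \1_(~` D) (xi w)).
  apply: (L1_bounded P (mind mD) (c := 1)) => w.
  by have /andP[a0 a1] := ind01 (~` D) w; rewrite ger0_norm.
have -> : fine (P ((fun w => xi w) @^-1` (~` D))) = \int[P]_w \1_(~` D) (xi w).
  by rewrite /Rintegral -[in LHS](setIT (_ @^-1` _)) -integral_indic.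
rewrite -RintegralZT//; apply: ae_le_Rintegral.
- apply: (L1_le _ (L1_nbvar beta P k_gt0 mXY)).
    by apply: measurable_funM => //; exact: mind.
  move=> w; have /andP[a0 a1] := ind01 (~` D) w.
  by rewrite normrM (gtr0_norm (v_gt0 _)) (ger0_norm a0) ler_piMr// ltW.
- exact: L1Z.
- by move=> w; have /andP[a0 a1] := ind01 (~` D) w; rewrite mulr_ge0// ltW.
- by move=> w; have /andP[a0 a1] := ind01 (~` D) w; rewrite mulr_ge0// ltW.
- apply: filterS (ae_nbvar_le k_gt0 hB) => w vB.
  by have /andP[a0 a1] := ind01 (~` D) w; rewrite ler_wpM2r.
Qed.

Let indC w : \1_D (xi w) + \1_(~` D) (xi w) = 1 :> R.
Proof.
rewrite !indicE in_setC; case: (_ \in _); rewrite /= ?addr0 ?add0r//.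
Qed.

(** Cauchy-Schwarz bounds the quadratic form of the discarded part by its trace, whatever the unit
    vector. *)
Lemma nbvar_design_lower (b : 'cV[R]_p) : norm2 b = 1 ->
  Cmin - \sum_j \int[P]_w (v (xi w) * (X w j 0 * X w j 0 * \1_(~` D) (xi w))) <=
  \sum_j \sum_l b j 0 * b l 0 *
    \int[P]_w (v (xi w) * (X w j 0 * X w l 0 * \1_D (xi w))).
Proof.
move=> b1; have mD := measurable_design_set beta B I.
have mDC : measurable (~` D) by exact: measurableC.
have lA A : measurable A ->
    L1 P (fun w => v (xi w) * (dotv (X w) b ^+ 2 * \1_A (xi w))).
  move=> mA.
  have -> : (fun w => v (xi w) * (dotv (X w) b ^+ 2 * \1_A (xi w))) =
     (fun w => \sum_j \sum_l b j 0 * b l 0 * (v (xi w) * (X w j 0 * X w l 0 * \1_A (xi w)))).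
    apply/funext => w.
    rewrite /dotv mxE expr2 mulr_suml mulr_suml mulr_sumr; apply: eq_bigr => j _.
    rewrite mulr_sumr mulr_suml mulr_sumr; apply: eq_bigr => l _.
    by rewrite !mxE; ring.
  apply: L1_sum => j; apply: L1_sum => l; apply: L1Z.
  exact: L1_nbvar_prod_restrict.
rewrite quadratic_nbvar_restrict// lerBlDr; apply: (le_trans (hessian_le_nbvar b1)).
have -> : (fun w => v (xi w) * dotv (X w) b ^+ 2) = (fun w =>
    v (xi w) * (dotv (X w) b ^+ 2 * \1_D (xi w)) +
    v (xi w) * (dotv (X w) b ^+ 2 * \1_(~` D) (xi w))).
  by apply/funext => w; rewrite -mulrDr -mulrDr indC mulr1.
rewrite RintegralDT; [|exact: lA|exact: lA].
rewrite lerD2l -Rintegral_sum; last by move=> j; exact: L1_nbvar_prod_restrict.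
apply: le_RintegralT; first exact: lA.
  by apply: L1_sum => j; exact: L1_nbvar_prod_restrict.
move=> w; have /andP[a0 a1] := ind01 (~` D) w.
rewrite -mulr_sumr ler_wpM2l ?(ltW (v_gt0 _))// -mulr_suml ler_wpM2r//.
apply: (le_trans (dotv_sqr_le _ _)).
have -> : \sum_j b j 0 ^+ 2 = 1.
  rewrite -(expr1n _ 2) -b1 sqr_sqrtr//.
  by apply: sumr_ge0 => j _; exact: sqr_ge0.
by rewrite mulr1; apply: ler_sum => j _; rewrite expr2.
Qed.

Lemma hessian_le_nbvar_sqr j : Cmin <= \int[P]_w (v (xi w) * X w j 0 ^+ 2).
Proof.
have e1 : norm2 (delta_mx j 0 : 'cV[R]_p) = 1.
  rewrite /norm2 (bigD1 j)//= big1 ?addr0; last first.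
    by move=> l /negPf lj; rewrite mxE lj expr0n.
  by rewrite mxE !eqxx expr1n sqrtr1.
have := hessian_le_nbvar e1.
have -> : (fun w => v (xi w) * dotv (X w) (delta_mx j 0) ^+ 2) =
   (fun w => v (xi w) * X w j 0 ^+ 2); last by [].
apply/funext => w; congr (_ * _ ^+ 2).
rewrite /dotv mxE (bigD1 j)//= big1 ?addr0.
  by rewrite !mxE !eqxx mulr1.
by move=> l /negPf lj; rewrite !mxE lj mulr0.
Qed.

(** Each diagonal entry of the Hessian is at least [Cmin], while inside the design set the squared
    norm is at most [I ^ 2]. The result serves as a lower bound on [I]. *)
Lemma nbvar_trace_le :
  p%:R * Cmin <= I ^+ 2 * \int[P]_w v (xi w) +
    \sum_j \int[P]_w (v (xi w) * (X w j 0 * X w j 0 * \1_(~` D) (xi w))).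
Proof.
have mD := measurable_design_set beta B I.
have mDC : measurable (~` D) by exact: measurableC.
apply: (@le_trans _ _ (\sum_j \int[P]_w (v (xi w) * X w j 0 ^+ 2))).
  rewrite natr_mul_sum; apply: ler_sum => j _.
  exact: hessian_le_nbvar_sqr.
have -> : \sum_j \int[P]_w (v (xi w) * X w j 0 ^+ 2) =
    \sum_j \int[P]_w (v (xi w) * (X w j 0 * X w j 0 * \1_D (xi w))) +
    \sum_j \int[P]_w (v (xi w) * (X w j 0 * X w j 0 * \1_(~` D) (xi w))).
  rewrite -big_split; apply: eq_bigr => j _ /=.
  rewrite -RintegralDT; [|exact: L1_nbvar_prod_restrict|exact: L1_nbvar_prod_restrict].
  by apply: eq_Rintegral => w _; rewrite -mulrDr -mulrDr indC mulr1 expr2.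
rewrite lerD2r -Rintegral_sum; last by move=> j; exact: L1_nbvar_prod_restrict.
rewrite -RintegralZT; last exact: (L1_nbvar beta P k_gt0 mXY).
apply: le_RintegralT.
- by apply: L1_sum => j; exact: L1_nbvar_prod_restrict.
- by apply: L1Z; exact: (L1_nbvar beta P k_gt0 mXY).
move=> w; rewrite -mulr_sumr mulrC ler_wpM2r ?(ltW (v_gt0 _))// -mulr_suml.
rewrite indicE; case: (boolP (_ \in _)) => [|_]; last by rewrite mulr0 sqr_ge0.
rewrite inE => -[_]; rewrite sqnormE mulr1 => H; apply: le_trans H.
by apply: ler_sum => j _; rewrite expr2.
Qed.

Let design_ball w : (\sum_l X w l 0 ^+ 2) * \1_D (xi w) <= I ^+ 2 :> R.
Proof.
rewrite indicE; case: (boolP (_ \in _)) => [|_]; last by rewrite mulr0 sqr_ge0.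
by rewrite inE => -[_]; rewrite sqnormE mulr1.
Qed.

Let second_moment_le w j l :
  (v (xi w) + v (xi w) ^+ 2) * (X w j 0 * X w l 0 * \1_D (xi w)) ^+ 2 <=
  (1 + B) * (X w l 0 ^+ 2 * \1_D (xi w)) * (v (xi w) * X w j 0 ^+ 2).
Proof.
have ind2 : \1_D (xi w) ^+ 2 = \1_D (xi w) :> R.
  by rewrite indicE; case: (_ \in _); rewrite ?expr1n ?expr0n.
have -> : (v (xi w) + v (xi w) ^+ 2) * (X w j 0 * X w l 0 * \1_D (xi w)) ^+ 2 =
   (1 + v (xi w)) * (X w l 0 ^+ 2 * \1_D (xi w) ^+ 2) * (v (xi w) * X w j 0 ^+ 2) by ring.
rewrite ind2 (ler_wpM2r (mulr_ge0 (ltW (v_gt0 _)) (sqr_ge0 _)))//.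
rewrite indicE; case: (boolP (_ \in _)) => [|_]; last by rewrite !mulr0.
rewrite inE => -[mB _]; rewrite mulr1 (ler_wpM2r (sqr_ge0 _))// lerD2l.
by apply: le_trans mB; exact: nbvar_le_mean.
Qed.

Lemma L1_design_second_moment j l :
  L1 P (fun w => (v (xi w) + v (xi w) ^+ 2) * (X w j 0 * X w l 0 * \1_D (xi w)) ^+ 2).
Proof.
have mD := measurable_design_set beta B I.
apply: (L1_le _ (L1Z ((1 + B) * I ^+ 2) (L1_vsqr j))).
  apply: measurable_funM; first by apply: measurable_funD => //; exact: measurable_funX.
  apply: measurable_funX; apply: measurable_funM; last exact: mind.
  exact: measurable_funM.
move=> w.
have nn : 0 <= (v (xi w) + v (xi w) ^+ 2) * (X w j 0 * X w l 0 * \1_D (xi w)) ^+ 2.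
  by rewrite mulr_ge0 ?sqr_ge0// addr_ge0 ?sqr_ge0// ltW.
rewrite (ger0_norm nn); apply: (le_trans (second_moment_le w j l)).
rewrite (ler_wpM2r (mulr_ge0 (ltW (v_gt0 _)) (sqr_ge0 _)))//.
have B1 : 0 <= 1 + B by rewrite addr_ge0// ltW.
rewrite ler_wpM2l//; apply: le_trans (design_ball w).
have /andP[a0 a1] := ind01 D w; rewrite ler_wpM2r//.
rewrite (bigD1 l)//= lerDl; apply: sumr_ge0 => i _; exact: sqr_ge0.
Qed.

(** On the design set [nbvar <= B], and the sum over [l] of the squared coordinates is at most
    [I ^ 2]. Summing over all entries, as the Frobenius norm requires, thus costs only one factor
    [p]. *)
Lemma nbvar_second_moment_le :
  \sum_j \sum_l \int[P]_w ((v (xi w) + v (xi w) ^+ 2) *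
      (X w j 0 * X w l 0 * \1_D (xi w)) ^+ 2) <=
  (1 + B) * I ^+ 2 * \sum_j \int[P]_w (v (xi w) * X w j 0 ^+ 2).
Proof.
have lpw := L1_design_second_moment.
rewrite mulr_sumr; apply: ler_sum => j _.
rewrite -Rintegral_sum// -RintegralZT//.
apply: le_RintegralT; [exact: L1_sum|exact: L1Z|].
move=> w; apply: (@le_trans _ _ (\sum_l (1 + B) * (X w l 0 ^+ 2 * \1_D (xi w)) * (v (xi w) * X w j 0 ^+ 2))).
  by apply: ler_sum => l _; exact: second_moment_le.
rewrite -mulr_suml (ler_wpM2r (mulr_ge0 (ltW (v_gt0 _)) (sqr_ge0 _)))//.
have B1 : 0 <= 1 + B by rewrite addr_ge0// ltW.
by rewrite -mulr_sumr ler_wpM2l// -mulr_suml.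
Qed.

End population_design.

(** * The empirical risk near the true parameter *)

Section deterministic.
Context (R : realType) (p : nat) (k : R).
Hypothesis k_gt0 : 0 < k.

(** Convexity of the exponential between 0 and [z]: divided by [expR (z * q)], it follows from two
    uses of [expR x >= 1 + x]. *)
Lemma convex_expR_bernoulli (q z : R) : 0 <= q <= 1 ->
  expR (z * q) <= 1 - q + q * expR z.
Proof.
move=> /andP[q0 q1].
have -> : expR z = expR (z * q) * expR (z * (1 - q)).
  by rewrite -expRD -mulrDr subrKC mulr1.
have e1 : 1 - q = expR (z * q) * ((1 - q) * expR (- (z * q))).
  by rewrite mulrCA expRN mulfV ?mulr1// expR_eq0.
set A := expR (z * q) in e1 *; set C := expR (z * (1 - q)).
have -> : 1 - q + q * (A * C) = A * ((1 - q) * expR (- (z * q)) + q * C).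
  by rewrite [RHS]mulrDr -e1; ring.
rewrite ler_peMr ?expR_ge0//.
apply: (@le_trans _ _ ((1 - q) * (1 - z * q) + q * (1 + z * (1 - q)))).
  by rewrite le_eqVlt; apply/orP; left; apply/eqP; ring.
apply: lerD; apply: ler_wpM2l => //; [by rewrite subr_ge0|exact: expR_ge1Dx|exact: expR_ge1Dx].
Qed.

(** The derivative of [nb_loss k u y] in [u]. *)
Let dloss (u : R) (y : nat) := - y%:R + (y%:R + k) * (expR u / (k + expR u)).

Lemma nb_loss_tangent (a z : R) (y : nat) :
  nb_loss k a y + z * dloss a y <= nb_loss k (a + z) y.
Proof.
have e0 := expR_gt0 a; have ke0 : 0 < k + expR a by rewrite addr_gt0.
rewrite /nb_loss /dloss.
set q := expR a / (k + expR a).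
have q01 : 0 <= q <= 1.
  rewrite ler_pdivrMr// mul1r lerDr (ltW k_gt0) andbT.
  exact: (divr_ge0 (ltW e0) (ltW ke0)).
have H : z * q <= ln (k + expR (a + z)) - ln (k + expR a).
  rewrite -ln_div ?posrE ?addr_gt0 ?expR_gt0// -[X in X <= _]expRK.
  rewrite ler_ln ?posrE ?expR_gt0 ?divr_gt0 ?addr_gt0 ?expR_gt0//.
  apply: (le_trans (convex_expR_bernoulli z q01)).
  rewrite le_eqVlt; apply/orP; left; apply/eqP.
  by rewrite expRD /q; field; rewrite gt_eqF.
have yk0 : 0 <= y%:R + k by rewrite addr_ge0// ltW.
have : (y%:R + k) * (z * q) <= (y%:R + k) * (ln (k + expR (a + z)) - ln (k + expR a)).
  by rewrite ler_wpM2l.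
rewrite -subr_ge0 => H2; rewrite -subr_ge0; apply: (le_trans H2).
by rewrite le_eqVlt; apply/orP; left; apply/eqP; ring.
Qed.

(** The derivative of [expR u / (k + expR u)] at [u] is [k * expR u / (k + expR u) ^ 2]. The
    constants 1/9 and 9/10 belong together: for [x > 0], [(1 + x) (1 - 9 / 10 x) >= 1] means
    [x <= 1 / 9]; for [x < 0], [1 / (1 - x) >= 9 / 10] means [x >= - 1 / 9]. *)
Lemma nb_sigmoid_increment (u x : R) : `|x| <= 1 / 9 ->
  9 / 10 * (k * expR u / (k + expR u) ^+ 2) * x ^+ 2 <=
  (expR (u + x) / (k + expR (u + x)) - expR u / (k + expR u)) * x.
Proof.
move=> x9; have e0 := expR_gt0 u; rewrite expRD.
set m := expR u in e0 *.
have km0 : 0 < k + m by rewrite addr_gt0.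
have ex0 := expR_gt0 x; have ex1 := expR_ge1Dx x.
have ex2 : (1 - x) * expR x <= 1.
  have := expR_ge1Dx (- x); rewrite expRN => H.
  by rewrite -ler_pdivlMr// div1r.
set e := expR x in ex0 ex1 ex2 *.
have kme0 : 0 < k + m * e by rewrite addr_gt0// mulr_gt0.
have -> : (m * e / (k + m * e) - m / (k + m)) * x =
    (k * m / (k + m) ^+ 2) * (((e - 1) * x) * ((k + m) / (k + m * e))).
  by field; rewrite !gt_eqF.
have c0 : 0 <= k * m / (k + m) ^+ 2.
  by rewrite (divr_ge0 (mulr_ge0 (ltW k_gt0) (ltW e0)))// exprn_ge0// ltW.
move: (k * m / _) c0 => c c0.
have -> : 9 / 10 * c * x ^+ 2 = c * (9 / 10 * x ^+ 2) by ring.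
rewrite ler_wpM2l//.
move: x9; rewrite ler_norml => /andP[x1 x2].
have [x0|x0] := leP 0 x.
  have e1 : 1 <= e by lra.
  apply: (@le_trans _ _ ((e - 1) * x * e^-1)).
    rewrite ler_pdivlMr// expr2 mulrA mulrAC ler_wpM2r//.
    by nra.
  have ke : k + m * e <= (k + m) * e by rewrite mulrDl lerD2r ler_peMr// ltW.
  have ex : 0 <= (e - 1) * x by rewrite mulr_ge0// subr_ge0.
  rewrite ler_wpM2l// ler_pdivlMr// mulrC ler_pdivrMr//.
have e1 : e <= 1 by rewrite /e -expR0 ler_expR ltW.
apply: (@le_trans _ _ ((e - 1) * x * 1)).
  by rewrite mulr1 expr2 mulrA ler_wnM2r ?(ltW x0)//; nra.
have ex : 0 <= (e - 1) * x by rewrite mulr_le0 ?subr_le0// ltW.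
rewrite ler_wpM2l// ler_pdivlMr// mul1r lerD2l.
by rewrite ler_piMr// ltW.
Qed.

(** The tangent is taken at [u + x], the end of the short step, where [nb_sigmoid_increment]
    controls the slope; convexity carries the bound to [u + t * x] however large [t] is. *)
Lemma nb_loss_ray (u x t : R) (y : nat) : `|x| <= 1 / 9 -> 1 <= t ->
  nb_loss k (u + x) y + (t - 1) * (dloss u y * x +
    9 / 10 * ((y%:R + k) * k * expR u / (k + expR u) ^+ 2) * x ^+ 2) <=
  nb_loss k (u + t * x) y.
Proof.
move=> x9 t1.
have -> : u + t * x = (u + x) + (t - 1) * x by ring.
apply: le_trans (nb_loss_tangent _ _ _).
rewrite lerD2l -[X in _ <= X]mulrA ler_wpM2l ?subr_ge0//.
have yk0 : 0 <= y%:R + k by rewrite addr_ge0// ltW.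
have := ler_wpM2l yk0 (nb_sigmoid_increment u x9).
rewrite /dloss -subr_ge0 => H; rewrite -subr_ge0; apply: (le_trans H).
by rewrite le_eqVlt; apply/orP; left; apply/eqP; ring.
Qed.

Lemma continuous_nb_loss (y : nat) : continuous (fun u : R => nb_loss k u y).
Proof.
move=> u; apply: cvgD.
  by apply: cvgN; apply: cvgMr; exact: cvg_id.
apply: cvgMr.
apply: continuous_cvg.
  by apply: continuous_ln; rewrite addr_gt0// expR_gt0.
by apply: cvgD; [exact: cvg_cst|exact: continuous_expR].
Qed.

Lemma norm2Z (c : R) (x : 'cV[R]_p) : 0 <= c -> norm2 (c *: x) = c * norm2 x.
Proof.
move=> c0; rewrite /norm2 -[c in RHS]ger0_norm// -sqrtr_sqr -sqrtrM ?sqr_ge0//.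
by rewrite mulr_sumr; congr Num.sqrt; apply: eq_bigr => j _; rewrite mxE exprMn.
Qed.

Lemma dotv_norm2_le (x b : 'cV[R]_p) : `|dotv x b| <= norm2 x * norm2 b.
Proof.
rewrite -sqrtr_sqr /norm2 -sqrtrM; last by apply: sumr_ge0 => j _; exact: sqr_ge0.
by apply: ler_wsqrtr; exact: dotv_sqr_le.
Qed.

Lemma dotvD (x b c : 'cV[R]_p) : dotv x (b + c) = dotv x b + dotv x c.
Proof. by rewrite /dotv mulmxDr mxE. Qed.

Lemma dotvZ (x b : 'cV[R]_p) (c : R) : dotv x (c *: b) = c * dotv x b.
Proof. by rewrite /dotv -scalemxAr mxE. Qed.

Variables (n : nat) (xs : nat -> 'cV[R]_p) (ys : nat -> nat) (beta : 'cV[R]_p).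
Variables (I rad : R).
Hypothesis n_gt0 : (0 < n)%N.
Hypothesis rad_gt0 : 0 < rad.
Hypothesis I_rad : rad * I <= 1 / 9.
Hypothesis xs_le : forall i, (i < n)%N -> norm2 (xs i) <= I.

Let risk (b : 'cV[R]_p) := n%:R^-1 * \sum_(i < n) nb_loss k (dotv (xs i) b) (ys i).

Hypothesis curvature : forall u : 'cV[R]_p, norm2 u = 1 ->
  \sum_(i < n) nbscore k beta (cvtuple (xs i)) (ys i) * dotv (xs i) u <
  9 / 10 * rad * \sum_(i < n) nbweight k beta (cvtuple (xs i)) (ys i) * dotv (xs i) u ^+ 2.

(** The witness is the point where the segment from [beta] to [b] meets the sphere of radius
    [rad]. *)
Lemma risk_outside (b : 'cV[R]_p) : rad < norm2 (b - beta) ->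
  exists2 c, norm2 (c - beta) <= rad & risk c < risk b.
Proof.
move=> bout; set r := norm2 (b - beta) in bout.
have r0 : 0 < r by exact: lt_trans bout.
pose u := r^-1 *: (b - beta).
have u1 : norm2 u = 1 by rewrite norm2Z ?invr_ge0 ?(ltW r0)// mulVf// gt_eqF.
exists (beta + rad *: u).
  by rewrite addrC addKr norm2Z ?(ltW rad_gt0)// u1 mulr1.
pose t := r / rad.
have t1 : 1 < t by rewrite ltr_pdivlMr// mul1r.
have bE : b = beta + (t * rad) *: u.
  by rewrite /t divfK ?gt_eqF// scalerA divff ?gt_eqF// scale1r addrC subrK.
clearbody u.
rewrite /risk ltr_pM2l ?invr_gt0 ?ltr0n//.
have step i : (i < n)%N ->
    nb_loss k (dotv (xs i) (beta + rad *: u)) (ys i) + (t - 1) * (rad *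
     (9 / 10 * rad * (nbweight k beta (cvtuple (xs i)) (ys i) * dotv (xs i) u ^+ 2)
       - nbscore k beta (cvtuple (xs i)) (ys i) * dotv (xs i) u)) <=
    nb_loss k (dotv (xs i) b) (ys i).
  move=> ni; rewrite [in X in _ <= X]bE !dotvD !dotvZ.
  have x9 : `|rad * dotv (xs i) u| <= 1 / 9.
    apply: le_trans I_rad; rewrite normrM (gtr0_norm rad_gt0) ler_wpM2l ?(ltW rad_gt0)//.
    by apply: le_trans (dotv_norm2_le _ _) _; rewrite u1 mulr1 xs_le.
  have -> : t * rad * dotv (xs i) u = t * (rad * dotv (xs i) u) by rewrite mulrA.
  apply: le_trans (nb_loss_ray _ _ x9 (ltW t1)).
  rewrite lerD2l ler_wpM2l ?subr_ge0 ?(ltW t1)//.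
  (* At the true parameter, [dloss] is the opposite of [nbscore]. *)
  rewrite /dloss /nbweight /nbscore /nbmean tdotE.
  have km0 : 0 < k + expR (dotv (xs i) beta) by rewrite addr_gt0// expR_gt0.
  by rewrite le_eqVlt; apply/orP; left; apply/eqP; field; rewrite gt_eqF.
apply: (@lt_le_trans _ _ (\sum_(i < n) (nb_loss k (dotv (xs i) (beta + rad *: u)) (ys i) + (t - 1) * (rad *
     (9 / 10 * rad * (nbweight k beta (cvtuple (xs i)) (ys i) * dotv (xs i) u ^+ 2)
       - nbscore k beta (cvtuple (xs i)) (ys i) * dotv (xs i) u))))); last first.
  by apply: ler_sum => i _; exact: step.
rewrite [X in _ < X]big_split/= ltrDl -mulr_sumr mulr_gt0 ?subr_gt0//.
rewrite -mulr_sumr mulr_gt0// sumrB -mulr_sumr subr_gt0.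
exact: curvature.
Qed.

(** A minimum over the closed ball exists by compactness and is global by [risk_outside]. Existence
    matters because the estimator is constrained only when there is a minimizer. *)
Lemma risk_argmin_exists : exists b, is_argmin risk b.
Proof.
pose A := [set z : 'rV[R]_p | \sum_j z 0 j ^+ 2 <= rad ^+ 2].
pose g (z : 'rV[R]_p) := risk (beta + z^T).
have ccoord j : continuous (fun z : 'rV[R]_p => z 0 j) by exact: coord_continuous.
have csum m (F : 'I_m -> 'rV[R]_p -> R) : (forall j, continuous (F j)) ->
    continuous (fun z => \sum_j F j z).
  by move=> cF; apply: continuous_big => [|j _]; [exact: add_continuous|exact: cF].
have clA : closed A.
  rewrite (_ : A = (fun z : 'rV[R]_p => \sum_j z 0 j ^+ 2) @^-1` [set x | x <= rad ^+ 2])//.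
  apply: closed_comp; last exact: closed_le.
  move=> z _; apply: csum => j {}z.
  exact: (cvgM (ccoord j z) (ccoord j z)).
have cA : compact A.
  have : compact [set z : 'rV[R]_p | forall i, z ord0 i \in `[(- rad), rad]].
    apply: (@rV_compact _  _ (fun=> `[(- rad), rad]%classic)).
    by move=> _; apply: segment_compact.
  move=> cbox; apply: subclosed_compact clA cbox _ => z Az i.
  rewrite in_itv/= -ler_norml -(ler_pXn2r (n := 2))// ?nnegrE ?(ltW rad_gt0)//.
  rewrite real_normK ?num_real//; apply: le_trans Az.
  by rewrite (bigD1 i)//= lerDl; apply: sumr_ge0 => j _; exact: sqr_ge0.
have A0 : A !=set0.
  exists 0; rewrite /A /= big1 ?sqr_ge0// => j _.
  by rewrite mxE expr0n.
have cg : continuous g.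
  have closs (i : 'I_n) : continuous (fun z : 'rV[R]_p => nb_loss k (dotv (xs i) (beta + z^T)) (ys i)).
    have clin : continuous (fun z : 'rV[R]_p => dotv (xs i) (beta + z^T)).
      rewrite (_ : (fun z : 'rV[R]_p => _) =
         (fun z => \sum_j (xs i j 0 * (beta j 0 + z 0 j)))); last first.
        apply/funext => z0; rewrite /dotv mxE; apply: eq_bigr => j _.
        by rewrite !mxE.
      apply: csum => j z0.
      exact: (cvgMr (cvgD (cvg_cst (beta j 0)) (ccoord j z0))).
    move=> z.
    exact: (@continuous_comp _ _ _ (fun z : 'rV[R]_p => dotv (xs i) (beta + z^T))
      (fun u => nb_loss k u (ys i)) z (clin z) (@continuous_nb_loss (ys i) _)).
  by move=> z; exact: (cvgMr (csum _ _ closs z)).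
have [z zA zmin] := EVT_min_rV A0 cA (continuous_subspaceT cg).
exists (beta + z^T) => b.
have ball c : norm2 (c - beta) <= rad -> risk (beta + z^T) <= risk c.
  move=> cr; have -> : risk c = g (c - beta)^T.
    by rewrite /g trmxK addrC subrK.
  apply: zmin; rewrite inE /A /=.
  have -> : \sum_j (c - beta)^T 0 j ^+ 2 = norm2 (c - beta) ^+ 2.
    rewrite sqr_sqrtr; last by apply: sumr_ge0 => j _; exact: sqr_ge0.
    by apply: eq_bigr => j _; rewrite mxE.
  by rewrite ler_pXn2r ?nnegrE ?sqrtr_ge0 ?(ltW rad_gt0).
have [br|br] := leP (norm2 (b - beta)) rad; first exact: ball.
have [c cr cb] := risk_outside br.
by apply: (le_trans (ball _ cr)); exact: ltW.
Qed.

Lemma risk_argmin_close (b : 'cV[R]_p) : is_argmin risk b ->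
  norm2 (b - beta) <= rad.
Proof.
move=> bmin; rewrite leNgt; apply/negP => br.
by have [c _] := risk_outside br; rewrite ltNge bmin.
Qed.

End deterministic.

(** * The constants of the theorem *)

Section gamma_lower_bound.
Context (R : realType).
Local Notation mu := (@lebesgue_measure R).

Lemma integral_expRM_itvcy (c a : R) : 0 < c ->
  (\int[mu]_(x in `[a, +oo[) (expR (- c * x))%:E = (c^-1 * expR (- c * a))%:E)%E.
Proof.
move=> c0.
have ccont : continuous (fun x : R => expR (- c * x)).
  move=> x; apply: (@continuous_comp _ _ _ (fun x : R => - c * x) expR).
    by apply: cvgMr; exact: cvg_id.
  exact: continuous_expR.
have dF (x : R) : is_derive x (1 : R) (fun x => - (c^-1 * expR (- c * x))) (expR (- c * x)).
  have d1 : is_derive x (1 : R) (fun x : R => - c * x) (- c).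
    have := is_deriveZ (- c) (is_derive_id x (1 : R)).
    by rewrite -[X in is_derive _ _ _ X]/(- c * 1) mulr1.
  have d2 := @is_derive1_comp R expR (fun x => - c * x) x _ _ (is_derive_expR _) d1.
  have d3 := is_deriveN (is_deriveZ c^-1 d2).
  apply: is_derive_eq d3 _.
  rewrite -[_ *: _]/(c^-1 * (expR (- c * x) * - c)); field.
  by rewrite gt_eqF.
rewrite (@ge0_continuous_FTC2y _ (fun x => expR (- c * x))
  (fun x => - (c^-1 * expR (- c * x))) a 0).
- by rewrite sub0e -EFinN opprK.
- by move=> x _; exact: expR_ge0.
- exact: continuous_subspaceT.
- rewrite -oppr0; apply: cvgN; rewrite -(mulr0 c^-1); apply: cvgMr.
  rewrite (_ : (fun x => expR (- c * x)) =
               (fun z => expR (- z)) \o (fun z => c * z)); last first.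
    by apply: eq_fun => x; rewrite mulNr.
  apply: (@cvg_comp _ _ _ _ _ _ (pinfty_nbhs R)); last exact: cvgr_expR.
  exact: gt0_cvgMry.
- by move=> x _; case: (dF x).
- by apply: cvg_at_right_filter; apply: cvgN; apply: cvgMr; exact: ccont.
- by move=> x _; rewrite derive1E; case: (dF x).
Qed.

(** On [x >= s] the integrand is at least [s ^ s * expR (- x)]. As [Gamma] takes [fine] of an
    integral, which would send an infinite value to 0, finiteness is proved as well. *)
Lemma Gamma_lower (s : R) : 0 < s -> s `^ s * expR (- s) <= Gamma (s + 1).
Proof.
move=> s0; rewrite /Gamma /Rintegral addrK.
have mf : measurable_fun setT (fun x : R => x `^ s * expR (- x)).
  apply: measurable_funM; first exact: measurable_powR.
  by apply: measurableT_comp => //; apply: measurableT_comp.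
have f0 (x : R) : 0 <= x `^ s * expR (- x) by rewrite mulr_ge0 ?powR_ge0 ?expR_ge0.
have lower : ((s `^ s * expR (- s))%:E <=
    \int[mu]_(x in `]0%R, +oo[) (x `^ s * expR (- x))%:E)%E.
  apply: (@le_trans _ _ (\int[mu]_(x in `[s, +oo[) (x `^ s * expR (- x))%:E)%E).
    apply: (@le_trans _ _ (\int[mu]_(x in `[s, +oo[) ((s `^ s)%:E * (expR (- 1 * x))%:E))%E).
      rewrite ge0_integralZl_EFin ?powR_ge0//.
      - by rewrite integral_expRM_itvcy// invr1 mul1r mulN1r EFinM.
      - apply/measurable_EFinP; apply: measurable_funTS.
        by apply: measurableT_comp => //; exact: measurable_funM.
    apply: ge0_le_integral => //.
    - by move=> x _; rewrite mule_ge0// lee_fin ?powR_ge0 ?expR_ge0.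
    - apply: emeasurable_funM => //; apply/measurable_EFinP; apply: measurable_funTS.
      by apply: measurableT_comp => //; exact: measurable_funM.
    - by apply/measurable_EFinP; apply: measurable_funTS.
    - move=> x; rewrite /= in_itv/= andbT => sx.
      rewrite -EFinM lee_fin mulN1r ler_wpM2r ?expR_ge0//.
      by rewrite ge0_ler_powR ?nnegrE ?(ltW s0)// (le_trans (ltW s0)).
  apply: ge0_subset_integral => //.
  - by apply/measurable_EFinP; apply: measurable_funTS.
  - by move=> x _; rewrite lee_fin.
  - by move=> x; rewrite /= !in_itv/= !andbT; exact: (lt_le_trans s0).
(* Applying [powR_le_expR] to [x / 2] dominates the integrand by a multiple of [expR (- x / 2)]. *)
have upper : (\int[mu]_(x in `]0%R, +oo[) (x `^ s * expR (- x))%:E < +oo)%E.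
  apply: (@le_lt_trans _ _ (\int[mu]_(x in `[0%R, +oo[)
     ((2 `^ s * (s `^ s * expR (- s)))%:E * (expR (- (1 / 2) * x))%:E))%E).
    apply: (@le_trans _ _ (\int[mu]_(x in `[0%R, +oo[) (x `^ s * expR (- x))%:E)%E).
      apply: ge0_subset_integral => //.
      - by apply/measurable_EFinP; apply: measurable_funTS.
      - by move=> x _; rewrite lee_fin.
      - by move=> x; rewrite /= !in_itv/= !andbT; exact: ltW.
    apply: ge0_le_integral => //.
    - by move=> x _; rewrite lee_fin.
    - by apply/measurable_EFinP; apply: measurable_funTS.
    - apply: emeasurable_funM => //; apply/measurable_EFinP; apply: measurable_funTS.
      by apply: measurableT_comp => //; exact: measurable_funM.
    - move=> x; rewrite /= in_itv/= andbT => x0.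
      rewrite -EFinM lee_fin.
      have -> : x `^ s = 2 `^ s * (x / 2) `^ s.
        by rewrite -powRM ?divr_ge0// mulrCA divff ?mulr1.
      rewrite -!mulrA ler_wpM2l ?powR_ge0//.
      have -> : expR (- x) = expR (- (x / 2)) * expR (- (1 / 2) * x).
        by rewrite -expRD; congr expR; field.
      rewrite !mulrA ler_wpM2r ?expR_ge0//.
      apply: (@le_trans _ _ (s `^ s * expR (x / 2 - s) * expR (- (x / 2)))).
        rewrite ler_wpM2r ?expR_ge0// powR_le_expR ?divr_ge0//.
        by rewrite mulrBr mulr1 [_ * (_ / s)]mulrC divfK ?gt_eqF.
      rewrite -mulrA -expRD ler_wpM2l ?powR_ge0// ler_expR.
      lra.
  rewrite ge0_integralZl_EFin//.
  - by rewrite integral_expRM_itvcy -?EFinM ?ltry//; lra.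
  - apply/measurable_EFinP; apply: measurable_funTS.
    by apply: measurableT_comp => //; exact: measurable_funM.
  - by rewrite !mulr_ge0 ?powR_ge0 ?expR_ge0.
rewrite -lee_fin fineK// ge0_fin_numE// integral_ge0// => x _.
by rewrite lee_fin.
Qed.

(** Of the nonnegative summands the one with [Gamma (2 / tau + 1)] is kept. The supremum is
    nonnegative in any case: [sup] is 0 on a set without a supremum. *)
Lemma C_const_lower (tau : R) : 0 < tau ->
  2 * expR 3 * ((2 / tau) `^ (1 / tau) * expR (- (1 / tau))) <= C_const tau.
Proof.
move=> t0; have t2 : 0 < 2 / tau by rewrite divr_gt0.
have gm0 q : 0 <= gamma_moment tau q by rewrite mulr_ge0// powR_ge0.
have sup0 : 0 <= sup [set gamma_moment tau q | q in [set q : R | 2 <= q]].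
  set S := [set _ | _ in _].
  have [hs|/sup_out ->//] := pselect (has_sup S).
  apply: (@le_trans _ _ (gamma_moment tau 2)); first exact: gm0.
  by apply: ub_le_sup; [case: hs|exists 2 => //=].
have G := Gamma_lower t2.
have G' : (2 / tau) `^ (1 / tau) * expR (- (1 / tau)) <= Gamma (2 / tau + 1) `^ (1 / 2).
  have -> : (2 / tau) `^ (1 / tau) * expR (- (1 / tau)) =
      ((2 / tau) `^ (2 / tau) * expR (- (2 / tau))) `^ (1 / 2).
    rewrite powRM ?powR_ge0 ?expR_ge0// -powRrM -expRM.
    by congr (_ `^ _ * expR _); field; rewrite gt_eqF.
  apply: ge0_ler_powR => //; rewrite ?nnegrE ?divr_ge0//.
    by rewrite mulr_ge0 ?powR_ge0 ?expR_ge0.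
  by apply: le_trans G; rewrite mulr_ge0 ?powR_ge0 ?expR_ge0.
rewrite /C_const -mulrA ler_wpM2l//.
apply: (@le_trans _ _ (expR 3 * (Gamma (2 / tau + 1) `^ (1 / 2)
     + 3 `^ ((2 - tau) / (3 * tau)) * sup [set gamma_moment tau q | q in [set q | 2 <= q]]))).
  rewrite ler_wpM2l ?expR_ge0//; apply: (le_trans G').
  by rewrite lerDl mulr_ge0// powR_ge0.
by rewrite lerDr powR_ge0.
Qed.

End gamma_lower_bound.

(* The reading is [N = n], [ev] the mean of [nbvar], [s = 2 * B * expR (- lam)],
   [nu = MX ^+ 2 * lam `^ (2 / theta)], [q] the probability that the design leaves the
   ball of radius [I], and [xb] the bias that truncation to this ball causes in the
   trace of the Hessian. *)
Section arithmetic.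
Context (R : realType).
Variables (N p B M ev s Cmin nu q l I xb : R).
Hypothesis N1 : 1 <= N.
Hypothesis p1 : 1 <= p.
Hypothesis B0 : 0 < B.
Hypothesis M0 : 0 < M.
Hypothesis BM : B <= 3 / 4 * M.
Hypothesis ev0 : 0 <= ev.
Hypothesis evB : ev <= B.
Hypothesis evM : ev <= 3 / 2 * M ^+ 2.
Hypothesis s0 : 0 <= s.
Hypothesis psB : N * (p * s) <= B.
Hypothesis C0 : 0 < Cmin.
Hypothesis nu0 : 0 < nu.
Hypothesis Ce : Cmin <= nu * (ev + s).
Hypothesis H4 : 64 * (nu ^+ 2 * M ^+ 2) <= N * Cmin ^+ 2.
Hypothesis q0 : 0 <= q.
Hypothesis H5 : 128 * (nu ^+ 2 * M ^+ 2) * q <= Cmin ^+ 2.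
Hypothesis H6 : N * q <= l.
Hypothesis l0 : 0 < l.
Hypothesis I0 : 0 <= I.
Hypothesis H1 : (81 * 72) * (M ^+ 2 * nu * p * l * I ^+ 2) <= N * Cmin ^+ 2.
Hypothesis xb_le : xb <= p * (nu * (B * q + s)).
Hypothesis trace : p * Cmin <= I ^+ 2 * ev + xb.

Let B2 : B ^+ 2 <= 9 / 16 * M ^+ 2.
Proof.
have -> : 9 / 16 * M ^+ 2 = (3 / 4 * M) ^+ 2 by field.
by rewrite ler_pXn2r ?nnegrE ?(ltW B0)//; apply: le_trans BM; exact: ltW.
Qed.

Let NsB : N * s <= B.
Proof.
apply: le_trans psB; rewrite ler_wpM2l//; first by have := N1; lra.
by rewrite ler_peMl.
Qed.

Let sB : s <= B.
Proof. by apply: le_trans NsB; rewrite ler_peMl. Qed.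

Lemma moment_le_2B : ev + s <= 2 * B. Proof. by have := sB; have := evB; lra. Qed.

Lemma moment_mulB_le : B * (ev + s) <= 9 / 8 * M ^+ 2.
Proof.
apply: (@le_trans _ _ (B * (2 * B))); first by rewrite ler_wpM2l ?(ltW B0)// moment_le_2B.
by have := B2; lra.
Qed.

(** Otherwise [s > M ^ 2 / 2], hence [ev + s <= 4 * s]. Then [H4] and [Ce] give
    [64 * M ^ 2 <= N * (ev + s) ^ 2], while [N * s <= B] gives [N * (ev + s) ^ 2 <= 16 * B ^ 2 <= 9
    * M ^ 2]. *)
Lemma moment_le : ev + s <= 2 * M ^+ 2.
Proof.
have M2 : 0 < M ^+ 2 by rewrite exprn_gt0.
have [//|H] := leP (ev + s) (2 * M ^+ 2).
have [sM e4s] : M ^+ 2 / 2 < s /\ ev + s <= 4 * s by have := evM; split; lra.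
have Ne : 64 * M ^+ 2 <= N * (ev + s) ^+ 2.
  rewrite -(ler_pM2l (exprn_gt0 2 nu0)).
  apply: (@le_trans _ _ (N * Cmin ^+ 2)); first by have := H4; lra.
  have -> : nu ^+ 2 * (N * (ev + s) ^+ 2) = N * (nu * (ev + s)) ^+ 2 by ring.
  rewrite ler_wpM2l//; first by have := N1; lra.
  by rewrite ler_pXn2r ?nnegrE ?(ltW C0)//; apply: le_trans Ce; exact: ltW.
have : N * (ev + s) ^+ 2 <= 16 * B ^+ 2.
  apply: (@le_trans _ _ (N * (4 * s) ^+ 2)).
    rewrite ler_wpM2l//; first by have := N1; lra.
    by rewrite ler_pXn2r ?nnegrE//; have := ev0; have := s0; lra.
  have -> : N * (4 * s) ^+ 2 = 16 * ((N * s) * s) by ring.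
  rewrite ler_wpM2l// expr2; apply: ler_pM => //.
  by rewrite mulr_ge0//; have := N1; lra.
by have := B2; lra.
Qed.

Lemma moment_mul1B_le : (1 + B) * (ev + s) <= 4 * M ^+ 2.
Proof.
have := moment_le; have := moment_mulB_le.
have : 0 < M ^+ 2 by rewrite exprn_gt0.
by rewrite mulrDl mul1r; lra.
Qed.

Let nuB : 56 * (nu * B) <= N * Cmin.
Proof.
have C2 : Cmin <= 2 * (nu * B).
  apply: le_trans Ce _; rewrite mulrCA ler_wpM2l ?(ltW nu0)//.
  exact: moment_le_2B.
have nB0 : 0 < nu * B by rewrite mulr_gt0.
have H : 64 * (nu ^+ 2 * M ^+ 2) <= N * Cmin * (2 * (nu * B)).
  apply: (le_trans H4); rewrite expr2 mulrA ler_wpM2l//.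
  by rewrite mulr_ge0 ?(ltW C0)//; have := N1; lra.
have X0 : 0 < 2 * (nu * B) by lra.
rewrite -(ler_pM2r X0); apply: le_trans H.
have -> : 56 * (nu * B) * (2 * (nu * B)) = nu ^+ 2 * (112 * B ^+ 2) by ring.
rewrite [X in _ <= X]mulrCA ler_wpM2l ?sqr_ge0//.
have : 0 < M ^+ 2 by rewrite exprn_gt0.
by have := B2; lra.
Qed.

Let tail_le : p * (nu * s) <= Cmin / 56.
Proof.
have N0 : 0 < N by have := N1; lra.
rewrite -(ler_pM2l N0).
have -> : N * (p * (nu * s)) = nu * (N * (p * s)) by ring.
apply: (@le_trans _ _ (nu * B)); first by rewrite ler_wpM2l ?(ltW nu0).
by have := nuB; lra.
Qed.

Let qcrude : nu * (B * q) <= Cmin / 100.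
Proof.
have M2 : 0 < M ^+ 2 by rewrite exprn_gt0.
have nM : 0 < 128 * (nu * M ^+ 2) by rewrite !mulr_gt0.
rewrite -(ler_pM2l nM).
have -> : 128 * (nu * M ^+ 2) * (nu * (B * q)) =
  B * (128 * (nu ^+ 2 * M ^+ 2) * q) by ring.
apply: (@le_trans _ _ (B * Cmin ^+ 2)); first by rewrite ler_wpM2l ?(ltW B0).
have C2 : Cmin <= 2 * (nu * B).
  apply: le_trans Ce _; rewrite mulrCA ler_wpM2l ?(ltW nu0)//.
  exact: moment_le_2B.
apply: (@le_trans _ _ (B * (Cmin * (2 * (nu * B))))).
  by rewrite ler_wpM2l ?(ltW B0)// expr2 ler_wpM2l ?(ltW C0).
have -> : B * (Cmin * (2 * (nu * B))) = (nu * Cmin) * (2 * B ^+ 2) by ring.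
have -> : 128 * (nu * M ^+ 2) * (Cmin / 100) = (nu * Cmin) * (128 / 100 * M ^+ 2) by field.
rewrite ler_wpM2l ?mulr_ge0 ?(ltW nu0) ?(ltW C0)//.
by have := B2; lra.
Qed.

Let I2ev : p * Cmin / 2 <= I ^+ 2 * ev.
Proof.
have xc : xb <= p * Cmin / 100 + Cmin / 56.
  apply: (le_trans xb_le); rewrite mulrDr mulrDr; apply: lerD; last exact: tail_le.
  by rewrite -mulrA ler_wpM2l ?qcrude//; have := p1; lra.
have pC : Cmin <= p * Cmin by rewrite ler_peMl ?(ltW C0).
by have := trace; have := C0; lra.
Qed.

Lemma radius_gt0 : 0 < I.
Proof.
rewrite lt0r I0 andbT; apply/eqP => I00.
have := I2ev; rewrite I00 expr0n mul0r.
have : 0 < p * Cmin by rewrite mulr_gt0//; have := p1; lra.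
by lra.
Qed.

(** Summing [qcrude] over the coordinates would lose a factor [p]. It is recovered from [H1] and
    [H6], which bound [p * I ^ 2 * q]: by [I2ev], [I ^ 2] is itself at least [p * Cmin / (2 * ev)],
    which brings in a second [p]. *)
Lemma design_bias_small : xb <= Cmin / 32.
Proof.
have M2 : 0 < M ^+ 2 by rewrite exprn_gt0.
have N0 : 0 < N by have := N1; lra.
have p0 : 0 < p by have := p1; lra.
have c0 : 0 <= 81 * 72 :> R by exact: mulr_ge0.
have c1 : 0 < 81 * 36 :> R by exact: mulr_gt0.
have Y0 : 0 <= M ^+ 2 * nu * p := mulr_ge0 (mulr_ge0 (sqr_ge0 M) (ltW nu0)) (ltW p0).
have X0 : 0 <= M ^+ 2 * nu * p * I ^+ 2 := mulr_ge0 Y0 (sqr_ge0 I).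
have E1 : (81 * 72) * (M ^+ 2 * nu * p * I ^+ 2) * q <= Cmin ^+ 2.
  rewrite -(ler_pM2l N0); apply: le_trans H1.
  have -> : N * ((81 * 72) * (M ^+ 2 * nu * p * I ^+ 2) * q) =
     (81 * 72) * (M ^+ 2 * nu * p * I ^+ 2) * (N * q) by ring.
  have -> : (81 * 72) * (M ^+ 2 * nu * p * l * I ^+ 2) =
     (81 * 72) * (M ^+ 2 * nu * p * I ^+ 2) * l by ring.
  exact: (ler_wpM2l (mulr_ge0 c0 X0) H6).
have E2 : (81 * 36) * (M ^+ 2 * nu * p ^+ 2) * q * Cmin <= Cmin * B * Cmin.
  apply: (@le_trans _ _ ((81 * 72) * (M ^+ 2 * nu * p) * q * (I ^+ 2 * ev))).
    have -> : (81 * 36) * (M ^+ 2 * nu * p ^+ 2) * q * Cmin =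
       (81 * 72) * (M ^+ 2 * nu * p) * q * (p * Cmin / 2) by field.
    exact: (ler_wpM2l (mulr_ge0 (mulr_ge0 c0 Y0) q0) I2ev).
  have -> : (81 * 72) * (M ^+ 2 * nu * p) * q * (I ^+ 2 * ev) =
     ((81 * 72) * (M ^+ 2 * nu * p * I ^+ 2) * q) * ev by ring.
  have -> : Cmin * B * Cmin = Cmin ^+ 2 * B by ring.
  exact: (ler_pM (mulr_ge0 (mulr_ge0 c0 X0) q0) ev0 E1 evB).
move: E2; rewrite (ler_pM2r C0) => E2.
have E3 : p * (nu * (B * q)) <= Cmin / 100.
  have pM : 0 < (81 * 36) * (M ^+ 2 * p).
    exact: (mulr_gt0 c1 (mulr_gt0 M2 p0)).
  rewrite -(ler_pM2l pM).
  have -> : (81 * 36) * (M ^+ 2 * p) * (p * (nu * (B * q))) =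
     B * ((81 * 36) * (M ^+ 2 * nu * p ^+ 2) * q) by ring.
  apply: (@le_trans _ _ (B * (Cmin * B))); first by rewrite ler_wpM2l ?(ltW B0).
  have -> : B * (Cmin * B) = Cmin * B ^+ 2 by ring.
  have -> : (81 * 36) * (M ^+ 2 * p) * (Cmin / 100) = Cmin * ((81 * 36) / 100 * (p * M ^+ 2)) by field.
  rewrite ler_wpM2l ?(ltW C0)//.
  have : M ^+ 2 <= p * M ^+ 2 by rewrite ler_peMl ?(ltW M2).
  by have := B2; lra.
apply: (le_trans xb_le); rewrite mulrDr mulrDr.
by have := tail_le; have := C0; lra.
Qed.

(** The left side bounds the squared Frobenius norm of the tolerances on the Hessian entries; the
    inner factor 2 accounts for the enlarged variances, and the right side is [(Cmin / 8) ^ 2]. *)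
Lemma hessian_budget :
  11 / 5 * (11 / 5) * (2 * l / N * (2 * ((1 + B) * I ^+ 2 * (p * (nu * (ev + s)))))) <= Cmin ^+ 2 / 64.
Proof.
have N0 : 0 < N by have := N1; lra.
have p0 : 0 < p by have := p1; lra.
have -> : 11 / 5 * (11 / 5) * (2 * l / N * (2 * ((1 + B) * I ^+ 2 * (p * (nu * (ev + s)))))) =
   22 / 5 * (22 / 5) * (((1 + B) * (ev + s)) * (nu * p * l * I ^+ 2)) / N.
  by field; rewrite gt_eqF.
rewrite ler_pdivrMr//.
have X0 : 0 <= nu * p * l * I ^+ 2.
  by apply: mulr_ge0 (sqr_ge0 I); rewrite ltW// !mulr_gt0.
have := ler_wpM2r X0 moment_mul1B_le.
have -> : 4 * M ^+ 2 * (nu * p * l * I ^+ 2) = 4 * (M ^+ 2 * nu * p * l * I ^+ 2) by ring.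
have := H1; have : 0 < N * Cmin ^+ 2 by rewrite mulr_gt0// exprn_gt0.
by lra.
Qed.

(** The square root is the Chernoff step for an entry of variance [u], and 1/25 is the limit set by
    [nbweight_mgf]. The lower bound on [u] prevents a nearly constant entry from asking for too long
    a step. *)
Lemma hessian_scale_small (u : R) :
  (1 + B) * I ^+ 2 * (p * (nu * (ev + s))) / p ^+ 2 <= u ->
  Num.sqrt (2 * l / (N * u)) * I ^+ 2 * (1 + B) <= 1 / 25.
Proof.
move=> hu; have N0 : 0 < N by have := N1; lra.
have p0 : 0 < p by have := p1; lra.
have Ip := radius_gt0; have I2 : 0 < I ^+ 2 by rewrite exprn_gt0.
have B1 : 0 < 1 + B by have := B0; lra.
have e0 : 0 < ev + s.
  by rewrite -(pmulr_rgt0 _ nu0); apply: lt_le_trans Ce.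
set U := (1 + B) * I ^+ 2 * _ in hu.
have U0 : 0 < U by rewrite !mulr_gt0.
have u0 : 0 < u by apply: lt_le_trans hu; rewrite divr_gt0// exprn_gt0.
rewrite -mulrA -[I ^+ 2 * (1 + B)]ger0_norm ?mulr_ge0 ?sqr_ge0 ?(ltW B1)//.
rewrite -sqrtr_sqr -sqrtrM; last by rewrite divr_ge0 ?mulr_ge0 ?(ltW l0) ?(ltW N0) ?(ltW u0).
rewrite -[X in _ <= X](@ger0_norm _ (1 / 25))// -sqrtr_sqr ler_wsqrtr//.
have Uu : U <= u * p ^+ 2 by rewrite -ler_pdivrMr// exprn_gt0.
rewrite mulrAC ler_pdivrMr ?mulr_gt0//.
have E1 : (81 * 72) * (l * I ^+ 2 * p) * M ^+ 2 * nu <= N * Cmin ^+ 2.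
  by have := H1; rewrite (_ : (81 * 72) * (M ^+ 2 * nu * p * l * I ^+ 2) = (81 * 72) * (l * I ^+ 2 * p) * M ^+ 2 * nu)//; ring.
have E2 : Cmin ^+ 2 <= (nu * (ev + s)) ^+ 2.
  by rewrite ler_pXn2r ?nnegrE ?(ltW C0)//; apply: le_trans Ce; exact: ltW.
have M2 : 0 < M ^+ 2 by rewrite exprn_gt0.
have P0 : 0 < p ^+ 2 * (nu * M ^+ 2) by rewrite !mulr_gt0// exprn_gt0.
rewrite -(ler_pM2r P0).
apply: (@le_trans _ _ (2 * p * (1 + B) * I ^+ 2 * (1 + B) * (N * Cmin ^+ 2 / (81 * 72)))).
  have -> : 2 * l * (I ^+ 2 * (1 + B)) ^+ 2 * (p ^+ 2 * (nu * M ^+ 2)) =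
     2 * p * (1 + B) * I ^+ 2 * (1 + B) * (l * I ^+ 2 * p * M ^+ 2 * nu) by ring.
  rewrite ler_wpM2l//; last by lra.
  by rewrite ltW// !mulr_gt0.
apply: (@le_trans _ _ (1 / 25 * (1 / 25) * (N * U) * (nu * M ^+ 2))); last first.
  have -> : (1 / 25) ^+ 2 * (N * u) * (p ^+ 2 * (nu * M ^+ 2)) =
     1 / 25 * (1 / 25) * (N * (u * p ^+ 2)) * (nu * M ^+ 2) by field.
  apply: ler_wpM2r; first by rewrite ltW// mulr_gt0.
  by apply: ler_wpM2l => //; apply: ler_wpM2l => //; exact: ltW.
apply: (@le_trans _ _ (2 * p * (1 + B) * I ^+ 2 * (1 + B) * (N * (nu * (ev + s)) ^+ 2 / (81 * 72)))).
  have Z0 : 0 <= 2 * p * (1 + B) * I ^+ 2 * (1 + B) by rewrite ltW// !mulr_gt0.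
  rewrite ler_wpM2l//.
  by apply: ler_wpM2r; [rewrite invr_ge0|apply: ler_wpM2l => //; exact: ltW].
have -> : 2 * p * (1 + B) * I ^+ 2 * (1 + B) * (N * (nu * (ev + s)) ^+ 2 / (81 * 72)) =
   (2 / (81 * 72) * ((1 + B) * (ev + s))) * (N * U * nu) by rewrite /U; field.
have -> : 1 / 25 * (1 / 25) * (N * U) * (nu * M ^+ 2) = (1 / 25 * (1 / 25) * M ^+ 2) * (N * U * nu) by ring.
have V0 : 0 <= N * U * nu by rewrite ltW// !mulr_gt0.
rewrite ler_wpM2r//.
by have := moment_mul1B_le; lra.
Qed.

Variables (rad sqp : R).
Hypothesis rad0 : 0 < rad.
Hypothesis radI : rad * I <= 1 / 9.
Hypothesis rad_ge : 72 * (M ^+ 2 * nu * p * l) <= N * Cmin ^+ 2 * rad ^+ 2.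
Hypothesis sqp1 : 1 <= sqp.
Hypothesis sqp2 : sqp ^+ 2 = p.

(** [W] bounds the variance of a score coordinate, [eta] is the tolerance on it, and the Chernoff
    step [sg] maximises [sg * eta - 5 / 4 * sg ^ 2 * W]. *)
Let W := 2 * M ^+ 2 * nu.
Let eta := 3 / 5 * Cmin * rad / sqp.
Let sg := eta / (5 / 2 * W).

Let W0 : 0 < W. Proof. by rewrite !mulr_gt0// exprn_gt0. Qed.
Let eta0 : 0 < eta.
Proof. by rewrite divr_gt0 ?mulr_gt0//; have := sqp1; lra. Qed.

Lemma score_step_gt0 : 0 < sg.
Proof. by apply: (divr_gt0 eta0); apply: mulr_gt0 W0; apply: divr_gt0. Qed.

Let CW : Cmin <= W.
Proof.
apply: (le_trans Ce); rewrite /W mulrC ler_wpM2r ?(ltW nu0)//.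
exact: moment_le.
Qed.

Let sgI0 : sg * I <= 2 / 75 * (Cmin / W).
Proof.
have s0' : 0 < sqp by have := sqp1; lra.
have -> : sg * I = 6 / 25 * (Cmin / W) * (rad * I / sqp).
  by rewrite /sg /eta; field; rewrite !gt_eqF.
have -> : 2 / 75 * (Cmin / W) = 6 / 25 * (Cmin / W) * (1 / 9) by field; rewrite gt_eqF.
have X0 : 0 <= 6 / 25 * (Cmin / W) by rewrite ltW// mulr_gt0// divr_gt0.
rewrite ler_wpM2l//.
rewrite ler_pdivrMr//; apply: (le_trans radI).
by have := sqp1; lra.
Qed.

Lemma score_scale_small : sg * I <= 1 / 20.
Proof.
apply: (le_trans sgI0).
have : Cmin / W <= 1 by rewrite ler_pdivrMr// mul1r.
by lra.
Qed.

Lemma score_variance_small : B * (sg * I) ^+ 2 <= 1 / 48.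
Proof.
have M2 : 0 < M ^+ 2 by rewrite exprn_gt0.
have e0 : 0 < ev + s.
  by rewrite -(pmulr_rgt0 _ nu0); apply: lt_le_trans Ce.
apply: (@le_trans _ _ (B * (2 / 75 * ((ev + s) / (2 * M ^+ 2))) ^+ 2)).
  rewrite ler_wpM2l ?(ltW B0)//.
  have q0' : 0 <= 2 / 75 * ((ev + s) / (2 * M ^+ 2)).
    by rewrite ltW// mulr_gt0 ?divr_gt0// mulr_gt0.
  have sI0 : 0 <= sg * I by rewrite mulr_ge0// ltW// score_step_gt0.
  rewrite ler_pXn2r ?nnegrE//.
  apply: (le_trans sgI0); rewrite ler_wpM2l// /W.
  rewrite ler_pdivrMr ?mulr_gt0//.
  have -> : (ev + s) / (2 * M ^+ 2) * (2 * M ^+ 2 * nu) = nu * (ev + s).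
    by field; rewrite gt_eqF.
  exact: Ce.
have -> : B * (2 / 75 * ((ev + s) / (2 * M ^+ 2))) ^+ 2 =
   (1 / 75 * (1 / 75)) * ((B * (ev + s) / M ^+ 2) * ((ev + s) / M ^+ 2)).
  by field; rewrite gt_eqF.
have h1 : B * (ev + s) / M ^+ 2 <= 9 / 8 by rewrite ler_pdivrMr// moment_mulB_le.
have h2 : (ev + s) / M ^+ 2 <= 2 by rewrite ler_pdivrMr// moment_le.
have : (B * (ev + s) / M ^+ 2) * ((ev + s) / M ^+ 2) <= 9 / 8 * 2.
  exact: (ler_pM (divr_ge0 (mulr_ge0 (ltW B0) (ltW e0)) (ltW M2)) (divr_ge0 (ltW e0) (ltW M2)) h1 h2).
by lra.
Qed.

(** With the optimal step the gain is [N * eta ^ 2 / (5 * W)]. It exceeds [2 * l] because the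
    constant 72 in [rad_ge] satisfies [9 / 25 * 72 >= 20]. *)
Lemma score_budget (V : R) : V <= nu * (ev + s) ->
  N * (5 / 4 * (sg ^+ 2 * V)) + 2 * l <= sg * (N * eta).
Proof.
move=> hV; have N0 : 0 < N by have := N1; lra.
have VW : V <= W.
  by apply: (le_trans hV); rewrite /W mulrC ler_wpM2r ?(ltW nu0)// moment_le.
apply: (@le_trans _ _ (N * (5 / 4 * (sg ^+ 2 * W)) + 2 * l)).
  by rewrite lerD2r ler_wpM2l ?(ltW N0)// ler_wpM2l// ler_wpM2l ?sqr_ge0.
have -> : sg * (N * eta) = N * (5 / 4 * (sg ^+ 2 * W)) + N * eta ^+ 2 / (5 * W).
  by rewrite /sg; field; rewrite gt_eqF.
rewrite lerD2l ler_pdivlMr ?mulr_gt0//.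
have p0 : 0 < p by have := p1; lra.
have -> : eta ^+ 2 = 9 / 25 * (Cmin ^+ 2 * rad ^+ 2) / p.
  by rewrite -sqp2 /eta; field; rewrite gt_eqF//; have := sqp1; lra.
rewrite [X in _ <= X]mulrA ler_pdivlMr//.
have -> : 2 * l * (5 * W) * p = 20 * (M ^+ 2 * nu * p * l) by rewrite /W; ring.
have : 0 < M ^+ 2 * nu * p * l by rewrite !mulr_gt0// exprn_gt0.
by have := rad_ge; lra.
Qed.

End arithmetic.

Section constants.
Context (R : realType).
Variables (n p : nat) (k theta delta MX MY B Cmin : R).
Hypothesis n_gt0 : (0 < n)%N.
Hypothesis p_gt0 : (0 < p)%N.
Hypothesis k_gt0 : 0 < k.
Hypothesis theta_gt0 : 0 < theta.
Hypothesis delta_gt0 : 0 < delta.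
Hypothesis delta_lt1 : delta < 1.
Hypothesis MX_gt0 : 0 < MX.
Hypothesis MY_gt0 : 0 < MY.
Hypothesis B_gt0 : 0 < B.
Hypothesis Cmin_gt0 : 0 < Cmin.

Local Notation M := (M_BX MY B).
Local Notation lam := (ln (2 * n%:R * p%:R / delta)).
Local Notation nu := (MX ^+ 2 * lam `^ (2 / theta)).
Local Notation l := (ln (2 * p%:R / delta)).
Local Notation c := (c_const n p k theta delta MX MY B Cmin).

Let n0 : 0 < n%:R :> R. Proof. by rewrite ltr0n. Qed.
Let p0 : 0 < p%:R :> R. Proof. by rewrite ltr0n. Qed.

Lemma M_BX_gt0 : 0 < M.
Proof. by rewrite addr_gt0// divr_gt0// ln_gt0// ltr1n. Qed.

Lemma B_le_M_BX : B <= 3 / 4 * M.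
Proof.
have l2 := ln2_le R; have l3 := ln2_ge R.
have l0 : 0 < ln 2 :> R by lra.
have : B <= 3 / 4 * (B / ln 2).
  by rewrite mulrA ler_pdivlMr// mulrC ler_wpM2r// ltW.
by rewrite /M_BX; have := MY_gt0; lra.
Qed.

Lemma log_ratio_ge (a : R) : 1 <= a -> ln a <= ln (2 * a / delta).
Proof.
move=> a1; have a0 : 0 < a by exact: lt_le_trans a1.
have A0 : 0 < 2 * a / delta by rewrite divr_gt0// mulr_gt0.
rewrite ler_ln ?posrE// ler_pdivlMr//.
by have := delta_lt1; nra.
Qed.

Lemma log_ratio_gt0 (a : R) : 1 <= a -> 0 < ln (2 * a / delta).
Proof.
move=> a1; have a0 : 0 < a by exact: lt_le_trans a1.
by rewrite ln_gt0// ltr_pdivlMr// mul1r; have := delta_lt1; lra.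
Qed.

Let np1 : 1 <= n%:R * p%:R :> R.
Proof. by rewrite -natrM ler1n muln_gt0 n_gt0. Qed.

Lemma lam_gt0 : 0 < lam.
Proof. by rewrite -[2 * _ * _]mulrA; exact: log_ratio_gt0. Qed.

Lemma nu_gt0 : 0 < nu.
Proof. by rewrite mulr_gt0 ?exprn_gt0// powR_gt0// lam_gt0. Qed.

Lemma rate_gt0 : 0 < rate n p theta delta MX MY B Cmin.
Proof.
have lp : 0 < l by apply: log_ratio_gt0; rewrite ler1n.
rewrite /rate !mulr_gt0 ?invr_gt0 ?powR_gt0 ?lam_gt0 ?M_BX_gt0//.
apply: ltr_pwDl; last by rewrite mulr_ge0 ?invr_ge0 ?sqrtr_ge0 ?(ltW n0).
by rewrite sqrtr_gt0 mulr_gt0// divr_gt0// mulr_gt0.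
Qed.

Lemma rate_sqr_ge :
  72 * (M ^+ 2 * nu * p%:R * l) <=
  n%:R * Cmin ^+ 2 * rate n p theta delta MX MY B Cmin ^+ 2.
Proof.
have lp : 0 < l by apply: log_ratio_gt0; rewrite ler1n.
have M0 := M_BX_gt0; have La0 := lam_gt0.
pose r0 := 6 * M * MX / Cmin * Num.sqrt (2 * p%:R / n%:R * l) * lam `^ (1 / theta).
have A0 : 0 <= 6 * M * MX / Cmin by rewrite ltW// divr_gt0// !mulr_gt0.
have X0 : 0 <= 2 * p%:R / n%:R * l by rewrite ltW// mulr_gt0// divr_gt0// mulr_gt0.
have r00 : 0 <= r0 by rewrite mulr_ge0 ?powR_ge0// mulr_ge0 ?sqrtr_ge0.
have r0r : r0 <= rate n p theta delta MX MY B Cmin.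
  rewrite ler_wpM2r ?powR_ge0// ler_wpM2l// lerDl.
  by rewrite mulr_ge0 ?invr_ge0 ?sqrtr_ge0 ?(ltW n0).
apply: (@le_trans _ _ (n%:R * Cmin ^+ 2 * r0 ^+ 2)); last first.
  apply: (ler_wpM2l (mulr_ge0 (ltW n0) (sqr_ge0 Cmin))).
  by rewrite ler_pXn2r ?nnegrE// ltW// rate_gt0.
have -> : lam `^ (2 / theta) = (lam `^ (1 / theta)) ^+ 2.
  by rewrite -powR_mulrn ?powR_ge0// -powRrM; congr (_ `^ _); field; rewrite gt_eqF.
rewrite /r0 [X in _ <= _ * X]exprMn [X in _ <= _ * (X * _)]exprMn sqr_sqrtr//.
rewrite le_eqVlt; apply/orP; left; apply/eqP; field.
by rewrite !gt_eqF.
Qed.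

Let nu2 : nu ^+ 2 = MX ^+ 4 * lam `^ (4 / theta).
Proof.
have -> : lam `^ (4 / theta) = (lam `^ (2 / theta)) ^+ 2.
  by rewrite -powR_mulrn ?powR_ge0// -powRrM; congr (_ `^ _); field; rewrite gt_eqF.
ring.
Qed.

(** The minimum in the first exponential is at most its quadratic argument;
    [128 = 4 * 2 * 4 ^ 2]. *)
Lemma c_const_ge_subexponential :
  expR (- (n%:R * Cmin ^+ 2 / (128 * (nu ^+ 2 * M ^+ 2)))) <= c.
Proof.
have M0 := M_BX_gt0; have La0 : 0 < lam `^ (4 / theta) by exact/powR_gt0/lam_gt0.
pose a1 := n%:R * (Cmin / 4) ^+ 2 / (2 * MX ^+ 4 * lam `^ (4 / theta) * M ^+ 2).
pose a2 := n%:R * (Cmin / 4) / (MX ^+ 2 * lam `^ (2 / theta) * M).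
have a1E : n%:R * Cmin ^+ 2 / (128 * (nu ^+ 2 * M ^+ 2)) = 1 / 4 * a1.
  by rewrite nu2 /a1; field; rewrite !gt_eqF.
rewrite a1E.
apply: (@le_trans _ _ (expR (- (1 / 4 * Num.min a1 a2)))); last first.
  by rewrite lerDl expR_ge0.
by rewrite ler_expR lerN2 ler_wpM2l// ge_min lexx.
Qed.

(** The minimum in the second exponential is at most its quadratic argument, in which the squared
    norm of [bvec] is [k ^ 2 * MX ^ 4 / n]. *)
Lemma c_const_ge_subweibull (C := C_const (theta / 2)) : 0 < C ->
  expR (- (n%:R * Cmin ^+ 2 / (256 * (expR 1 ^+ 2 * C ^+ 2 * (k ^+ 2 * MX ^+ 4))))) <= c.
Proof.
move=> Cpos; rewrite /c_const -/C.
have bE : norm2 (bvec n k MX) ^+ 2 = k ^+ 2 * MX ^+ 4 / n%:R.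
  rewrite sqr_sqrtr; last by apply: sumr_ge0 => j _; exact: sqr_ge0.
  under eq_bigr do rewrite mxE.
  rewrite sumr_const card_ord -mulr_natl; field.
  by rewrite gt_eqF.
rewrite bE.
have -> : n%:R * Cmin ^+ 2 / (256 * (expR 1 ^+ 2 * C ^+ 2 * (k ^+ 2 * MX ^+ 4))) =
   (Cmin / 4) ^+ 2 / (16 * expR 1 ^+ 2 * C ^+ 2 * (k ^+ 2 * MX ^+ 4 / n%:R)).
  by field; rewrite !gt_eqF.
set b2 := _ / (16 * _ * _ * _).
apply: (@le_trans _ _ (expR (- Num.min ((Cmin / 4) `^ (theta / 2)
       / (4 * expR 1 * C * norm2 (bvec n k MX) * L_const (theta / 2) (bvec n k MX)) `^ (theta / 2)) b2))).
  by rewrite ler_expR lerN2 ge_min lexx orbT.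
by rewrite lerDr expR_ge0.
Qed.

Hypothesis c_small : 2 * p%:R ^+ 2 * c < 1.

Let small_exp (a : R) : expR (- a) <= c -> 1 / 2 <= a.
Proof.
move=> ac; have l3 := ln2_ge R; apply: (le_trans l3).
rewrite -ler_expR lnK ?posrE//.
have p2 : 1 <= p%:R ^+ 2 :> R by rewrite expr_ge1// ler1n.
have e0 := expR_gt0 (- a).
have : 2 * expR (- a) <= 1.
  apply: (@le_trans _ _ (2 * p%:R ^+ 2 * c)); last exact: ltW.
  rewrite -mulrA ler_wpM2l//; apply: (le_trans ac).
  by rewrite ler_peMl//; apply: le_trans ac; exact: ltW.
by rewrite expRN ler_pdivrMr ?expR_gt0// mul1r.
Qed.

Lemma sample_size_subexponential : 64 * (nu ^+ 2 * M ^+ 2) <= n%:R * Cmin ^+ 2.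
Proof.
have := small_exp c_const_ge_subexponential.
have D0 : 0 < nu ^+ 2 * M ^+ 2 by rewrite mulr_gt0 ?exprn_gt0 ?nu_gt0 ?M_BX_gt0.
have D1 : 0 < 128 * (nu ^+ 2 * M ^+ 2) by rewrite mulr_gt0.
rewrite ler_pdivlMr// => H; apply: le_trans H.
by rewrite le_eqVlt; apply/orP; left; apply/eqP; field.
Qed.

(* The constant [C_const (theta / 2)] is at least [2 * (2 * r) `^ r * expR (- r)] with
   [r = 2 / theta], which forces [n >= 4 `^ r]. *)
Lemma lam_ge :
  Cmin <= k * (2 * (MX ^+ 2 * (2 / theta) `^ (2 / theta) * expR (- (2 / theta)))) ->
  2 / theta <= lam.
Proof.
move=> hC; have t2 : 0 < theta / 2 by rewrite divr_gt0.
have r0 : 0 < 2 / theta by rewrite divr_gt0.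
have := C_const_lower t2; set C := C_const _.
have -> : 2 / (theta / 2) = 2 * (2 / theta) by field; rewrite gt_eqF.
have -> : 1 / (theta / 2) = 2 / theta by field; rewrite gt_eqF.
set r := 2 / theta in r0 hC *.
rewrite powRM ?(ltW r0)//.
pose x := r `^ r * expR (- r).
have x0 : 0 < x by rewrite mulr_gt0 ?expR_gt0// powR_gt0.
have e3 : 1 <= expR 3 :> R by rewrite -expR0 ler_expR.
have e1 : 1 <= expR 1 :> R by rewrite -expR0 ler_expR.
have Px0 : 0 < 2 `^ r * x :> R by rewrite mulr_gt0.
move=> hC'; have CL : 2 * (2 `^ r * x) <= C.
  apply: le_trans hC'; rewrite -mulrA ler_wpM2l//.
  have -> : 2 `^ r * r `^ r * expR (- r) = 2 `^ r * x by rewrite /x mulrA.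
  by rewrite ler_peMl// ltW.
have Cpos : 0 < C by apply: lt_le_trans CL; rewrite mulr_gt0.
have E0 : 0 < expR 1 ^+ 2 * C ^+ 2 * (k ^+ 2 * MX ^+ 4) :> R.
  exact: (mulr_gt0 (mulr_gt0 (exprn_gt0 2 (expR_gt0 _)) (exprn_gt0 2 Cpos))
    (mulr_gt0 (exprn_gt0 2 k_gt0) (exprn_gt0 4 MX_gt0))).
have := small_exp (c_const_ge_subweibull Cpos).
rewrite ler_pdivlMr; last exact: (mulr_gt0 (ltr0Sn R 255) E0).
have hC2 : Cmin <= 2 * (k * MX ^+ 2 * x).
  by apply: (le_trans hC); rewrite le_eqVlt; apply/orP; left; apply/eqP; rewrite /x; ring.
move=> H.
have K0 : 0 < k ^+ 2 * MX ^+ 4 by rewrite mulr_gt0 ?exprn_gt0.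
have H1 : C ^+ 2 * (k ^+ 2 * MX ^+ 4) <= n%:R * Cmin ^+ 2.
  apply: le_trans H.
  have -> : 1 / 2 * (256 * (expR 1 ^+ 2 * C ^+ 2 * (k ^+ 2 * MX ^+ 4))) =
     (128 * expR 1 ^+ 2) * (C ^+ 2 * (k ^+ 2 * MX ^+ 4)) by field.
  rewrite ler_peMl//; first by rewrite mulr_ge0 ?sqr_ge0// ltW.
  have : 1 <= expR 1 ^+ 2 :> R by rewrite expr_ge1.
  by lra.
have H2 : (2 * (2 `^ r * x)) ^+ 2 * (k ^+ 2 * MX ^+ 4) <= n%:R * (2 * (k * MX ^+ 2 * x)) ^+ 2.
  apply: (@le_trans _ _ (n%:R * Cmin ^+ 2)); last first.
    rewrite ler_wpM2l ?(ltW n0)// ler_pXn2r ?nnegrE ?(ltW Cmin_gt0)//.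
    by apply: le_trans hC2; exact: ltW.
  apply: le_trans H1; rewrite ler_wpM2r ?(ltW K0)//.
  by rewrite ler_pXn2r ?nnegrE ?(ltW Cpos)// mulr_ge0// ltW.
have H3 : (2 `^ r) ^+ 2 <= n%:R :> R.
  have Z0 : 0 < 2 * 2 * (x ^+ 2 * (k ^+ 2 * MX ^+ 4)).
    by apply: mulr_gt0; [exact: mulr_gt0|exact: (mulr_gt0 (exprn_gt0 2 x0) K0)].
  rewrite -(ler_pM2r Z0).
  have -> : (2 `^ r) ^+ 2 * (2 * 2 * (x ^+ 2 * (k ^+ 2 * MX ^+ 4))) =
    (2 * (2 `^ r * x)) ^+ 2 * (k ^+ 2 * MX ^+ 4) by ring.
  apply: (le_trans H2); rewrite le_eqVlt; apply/orP; left; apply/eqP; ring.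
have : r <= ln n%:R.
  rewrite -ler_expR lnK ?posrE//; apply: le_trans H3.
  have -> : (2 `^ r) ^+ 2 = expR (2 * ln 2 * r) :> R.
    rewrite -powR_mulrn ?powR_ge0// -powRrM /powR gt_eqF//.
    by congr expR; ring.
  rewrite ler_expR -[X in X <= _]mul1r ler_wpM2r ?(ltW r0)//.
  by have := ln2_ge R; lra.
move=> H4; apply: (le_trans H4).
apply: (@le_trans _ _ (ln (n%:R * p%:R))).
  by rewrite ler_ln ?posrE ?mulr_gt0// ler_peMr ?(ltW n0)// ler1n.
by rewrite -[2 * _ * _]mulrA; exact: log_ratio_ge.
Qed.

End constants.

(** * Concentration and the estimator *)

Lemma measure_bigsetU_le (R : realType) d (T : measurableType d)
  (P : probability T R) (J : Type) (s : seq J) (F : J -> set T) (c : R) :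
  (forall j, measurable (F j)) -> (forall j, (P (F j) <= c%:E)%E) ->
  measurable (\big[setU/set0]_(j <- s) F j) /\
  (P (\big[setU/set0]_(j <- s) F j) <= ((size s)%:R * c)%:E)%E.
Proof.
move=> mF Fc; elim: s => [|j s [ms IH]].
  by rewrite big_nil mul0r measure0.
rewrite big_cons; split; first exact: measurableU.
apply: (le_trans (measureU2 _ (mF j) ms)).
by rewrite /= -natr1 mulrDl mul1r addrC EFinD; exact: leeD.
Qed.

Section good_event.
Context (R : realType) (p : nat) (k : R) (beta : 'cV[R]_p).
Variables (n : nat) (xs : nat -> 'cV[R]_p) (ys : nat -> nat).
Variables (B I rad Cmin : R) (V t : 'I_p -> 'I_p -> R).
Hypothesis k_gt0 : 0 < k.
Hypothesis p_gt0 : (0 < p)%N.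
Hypothesis n_gt0 : (0 < n)%N.
Hypothesis rad_gt0 : 0 < rad.
Hypothesis Cmin_gt0 : 0 < Cmin.
Hypothesis I_ge0 : 0 <= I.
Hypothesis I_rad : rad * I <= 1 / 9.
Hypothesis xsD : forall i, (i < n)%N -> design_set beta B I (cvtuple (xs i)).
Hypothesis score_small : forall j,
  `|\sum_(i < n) nbscore k beta (cvtuple (xs i)) (ys i) * xs i j 0| <=
  n%:R * (3 / 5 * Cmin * rad / Num.sqrt p%:R).
Hypothesis hessian_close : forall j l,
  `|\sum_(i < n) nbweight k beta (cvtuple (xs i)) (ys i) * (xs i j 0 * xs i l 0)
    - n%:R * V j l| <= n%:R * t j l.
Hypothesis t_small : \sum_j \sum_l t j l ^+ 2 <= Cmin ^+ 2 / 64.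
Hypothesis V_lower : forall u : 'cV[R]_p, norm2 u = 1 ->
  31 / 32 * Cmin <= \sum_j \sum_l u j 0 * u l 0 * V j l.

Let n0 : 0 < n%:R :> R. Proof. by rewrite ltr0n. Qed.

Let norm1_sum (u : 'cV[R]_p) : norm2 u = 1 -> \sum_j u j 0 ^+ 2 = 1.
Proof.
move=> u1; rewrite -(expr1n _ 2) -u1 sqr_sqrtr//.
by apply: sumr_ge0 => j _; exact: sqr_ge0.
Qed.

Lemma score_direction_le (u : 'cV[R]_p) : norm2 u = 1 ->
  \sum_(i < n) nbscore k beta (cvtuple (xs i)) (ys i) * dotv (xs i) u <=
  n%:R * (3 / 5 * Cmin * rad).
Proof.
move=> u1; set g := fun j => \sum_(i < n) nbscore k beta (cvtuple (xs i)) (ys i) * xs i j 0.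
have -> : \sum_(i < n) nbscore k beta (cvtuple (xs i)) (ys i) * dotv (xs i) u =
    \sum_j u j 0 * g j.
  rewrite /g; under [RHS]eq_bigr do rewrite mulr_sumr.
  rewrite exchange_big; apply: eq_bigr => i _.
  rewrite /dotv mxE mulr_sumr; apply: eq_bigr => j _.
  by rewrite mxE; ring.
apply: (le_trans (ler_norm _)).
have K0 : 0 <= n%:R * (3 / 5 * Cmin * rad) by rewrite ltW// !mulr_gt0.
rewrite -(ler_pXn2r (n := 2))// ?nnegrE// real_normK ?num_real//.
apply: (le_trans (cauchy_schwarz_sum _ _)); rewrite (norm1_sum u1) mul1r.
have p0 : 0 < p%:R :> R by rewrite ltr0n.
have sp0 : 0 < Num.sqrt p%:R :> R by rewrite sqrtr_gt0.
apply: (@le_trans _ _ (\sum_(j < p) (n%:R * (3 / 5 * Cmin * rad / Num.sqrt p%:R)) ^+ 2)).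
  apply: ler_sum => j _; rewrite -(real_normK (num_real (g j))).
  have cr : 0 < 3 / 5 * Cmin * rad by rewrite !mulr_gt0.
  have K1 := ltW (mulr_gt0 n0 (divr_gt0 cr sp0)).
  rewrite ler_pXn2r ?nnegrE//; exact: score_small.
rewrite sumr_const card_ord -[X in X <= _]mulr_natl.
have pE : p%:R = Num.sqrt p%:R ^+ 2 :> R by rewrite sqr_sqrtr// ltW.
set q := Num.sqrt p%:R in sp0 pE *; rewrite pE le_eqVlt; apply/orP; left; apply/eqP; field.
by rewrite gt_eqF.
Qed.

(** Cauchy-Schwarz over pairs of indices bounds the deviation of the quadratic form by the Frobenius
    norm, at most [Cmin / 8], and [31 / 32 - 1 / 8 = 27 / 32]. *)
Lemma hessian_direction_ge (u : 'cV[R]_p) : norm2 u = 1 ->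
  n%:R * (27 / 32 * Cmin) <=
  \sum_(i < n) nbweight k beta (cvtuple (xs i)) (ys i) * dotv (xs i) u ^+ 2.
Proof.
move=> u1.
set S := fun j l => \sum_(i < n) nbweight k beta (cvtuple (xs i)) (ys i) * (xs i j 0 * xs i l 0).
have -> : \sum_(i < n) nbweight k beta (cvtuple (xs i)) (ys i) * dotv (xs i) u ^+ 2 =
    \sum_j \sum_l u j 0 * u l 0 * S j l.
  have -> : \sum_j \sum_l u j 0 * u l 0 * S j l = \sum_j \sum_(i < n) \sum_l
      u j 0 * u l 0 * (nbweight k beta (cvtuple (xs i)) (ys i) * (xs i j 0 * xs i l 0)).
    apply: eq_bigr => j _; rewrite exchange_big; apply: eq_bigr => l _.
    by rewrite mulr_sumr.
  rewrite exchange_big; apply: eq_bigr => i _.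
  rewrite /dotv mxE expr2 mulr_suml mulr_sumr; apply: eq_bigr => j _.
  rewrite mulr_sumr mulr_sumr; apply: eq_bigr => l _.
  by rewrite !mxE; ring.
have -> : \sum_j \sum_l u j 0 * u l 0 * S j l =
    n%:R * (\sum_j \sum_l u j 0 * u l 0 * V j l) +
    \sum_j \sum_l u j 0 * u l 0 * (S j l - n%:R * V j l).
  rewrite mulr_sumr -big_split; apply: eq_bigr => j _ /=.
  rewrite mulr_sumr -big_split; apply: eq_bigr => l _ /=.
  by ring.
set dev := \sum_j \sum_l u j 0 * u l 0 * (S j l - n%:R * V j l).
have devle : `|dev| <= n%:R * (Cmin / 8).
  have K0 : 0 <= n%:R * (Cmin / 8) by rewrite ltW// mulr_gt0// divr_gt0.
  rewrite -(ler_pXn2r (n := 2))// ?nnegrE// real_normK ?num_real//.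
  rewrite /dev pair_big/=.
  apply: (le_trans (cauchy_schwarz_sum (fun jl : 'I_p * 'I_p => u jl.1 0 * u jl.2 0)
    (fun jl => S jl.1 jl.2 - n%:R * V jl.1 jl.2))).
  have -> : \sum_(jl : 'I_p * 'I_p) (u jl.1 0 * u jl.2 0) ^+ 2 = 1.
    rewrite -(pair_big xpredT xpredT (fun j l => (u j 0 * u l 0) ^+ 2))/=.
    under eq_bigr do under eq_bigr do rewrite exprMn.
    under eq_bigr do rewrite -mulr_sumr (norm1_sum u1) mulr1.
    exact: norm1_sum.
  rewrite mul1r -(pair_big xpredT xpredT (fun j l => (S j l - n%:R * V j l) ^+ 2))/=.
  apply: (@le_trans _ _ (n%:R ^+ 2 * \sum_j \sum_l t j l ^+ 2)).
    rewrite mulr_sumr; apply: ler_sum => j _; rewrite mulr_sumr; apply: ler_sum => l _.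
    rewrite -exprMn -(real_normK (num_real (S j l - _))).
    have nt0 : 0 <= n%:R * t j l by apply: le_trans (hessian_close j l); exact: normr_ge0.
    rewrite ler_pXn2r ?nnegrE//.
    exact: hessian_close.
  have -> : (n%:R * (Cmin / 8)) ^+ 2 = n%:R ^+ 2 * (Cmin ^+ 2 / 64) by field.
  by rewrite ler_wpM2l ?sqr_ge0.
move: devle; rewrite ler_norml => /andP[d1 _].
have := ler_wpM2l (ltW n0) (V_lower u1).
have : 0 < n%:R * Cmin by rewrite mulr_gt0.
by lra.
Qed.

Lemma estimator_close (b : 'cV[R]_p) :
  let risk (c : 'cV[R]_p) :=
    n%:R^-1 * \sum_(i < n) nb_loss k (dotv (xs i) c) (ys i) in
  ((exists c, is_argmin risk c) -> is_argmin risk b) -> norm2 (b - beta) <= rad.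
Proof.
move=> risk hb.
have xs_le i : (i < n)%N -> norm2 (xs i) <= I.
  move=> ni; have [_ H] := xsD ni.
  rewrite /norm2 -[I]ger0_norm// -sqrtr_sqr ler_wsqrtr//.
  by apply: le_trans H; apply: ler_sum => j _; rewrite tnth_mktuple.
(* Here [3 / 5 < 9 / 10 * (27 / 32)]. *)
have curv u : norm2 u = 1 ->
    \sum_(i < n) nbscore k beta (cvtuple (xs i)) (ys i) * dotv (xs i) u <
    9 / 10 * rad * \sum_(i < n) nbweight k beta (cvtuple (xs i)) (ys i) * dotv (xs i) u ^+ 2.
  move=> u1; apply: (le_lt_trans (score_direction_le u1)).
  have H := ler_wpM2l (ltW rad_gt0) (hessian_direction_ge u1).
  have : 0 < rad * (n%:R * Cmin) by rewrite !mulr_gt0.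
  move: H; set Q := \sum_(i < n) _ => H K.
  rewrite -mulrA; lra.
apply: (risk_argmin_close k_gt0 n_gt0 rad_gt0 I_rad xs_le curv).
apply: hb; exact: (risk_argmin_exists k_gt0 n_gt0 rad_gt0 I_rad xs_le curv).
Qed.

End good_event.

(** * Probability of the design event *)

Section design_event.
Context (R : realType) (p : nat) (k : R) (beta : 'cV[R]_p).
Context (d : measure_display) (T : measurableType d).
Variables (P : probability T R) (Xs : nat -> T -> 'cV[R]_p) (Ys : nat -> T -> nat).
Hypothesis mZ : forall i, measurable_fun setT (obs (Xs i) (Ys i)).
Hypothesis indep : mutually_independent P (fun i => obs (Xs i) (Ys i)).
Hypothesis law : forall i, same_law P (obs (Xs i) (Ys i)) (obs (Xs 0%N) (Ys 0%N)).

Local Notation xi i w := (cvtuple (Xs i w)).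

Lemma probability_design_forall (A : set (p.-tuple R)) (n : nat) : measurable A ->
  P [set w | forall i, (i < n)%N -> A (xi i w)] =
  ((fine (P [set w | A (xi 0%N w)])) ^+ n)%:E.
Proof.
move=> mA; have mA' : measurable [set s : p.-tuple R * nat | A s.1].
  by rewrite -[X in measurable X]setTI; exact: measurable_fst.
exact: (probability_iid_forall n mZ indep law mA').
Qed.

Lemma measurable_design_forall (A : set (p.-tuple R)) (n : nat) : measurable A ->
  measurable [set w | forall i, (i < n)%N -> A (xi i w)].
Proof.
move=> mA; have mX i : measurable [set w | A (xi i w)].
  by rewrite -[X in measurable X]setTI; exact: (measurable_cvtuple (mZ i)).
rewrite (_ : [set w | _] = \bigcap_(i in [set i | (i < n)%N]) [set w | A (xi i w)]).
  by apply: bigcap_measurableType => i _; exact: mX.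
by apply/seteqP; split => w /= H i /H.
Qed.

Lemma bounded_design_eventE (B I : R) (n : nat) : 0 <= I ->
  bounded_design_event beta B I Xs n =
  [set w | forall i, (i < n)%N -> design_set beta B I (xi i w)].
Proof.
move=> I0; have nE i w : (norm2 (Xs i w) <= I) = (sqnorm (xi i w) <= I ^+ 2).
  rewrite /norm2 -[X in _ <= X]ger0_norm// -sqrtr_sqr.
  have -> : sqnorm (xi i w) = \sum_j Xs i w j 0 ^+ 2.
    by apply: eq_bigr => j _; rewrite tnth_mktuple.
  by rewrite ler_sqrt// sqr_ge0.
apply/seteqP; split => w /=.
  move=> [H1 H2] i ni; split; first by rewrite /nbmean tdotE; exact: H1.
  by rewrite -nE; exact: H2.
move=> H; split => i ni; have [h1 h2] := H i ni.
  by move: h1; rewrite /nbmean tdotE.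
by rewrite nE.
Qed.

Lemma bounded_design_event_neg (B I : R) (n : nat) : (0 < n)%N -> I < 0 ->
  bounded_design_event beta B I Xs n = set0.
Proof.
move=> n0 I0; apply/seteqP; split => // w /= [_ /(_ 0%N n0)].
by rewrite leNgt (lt_le_trans I0)// sqrtr_ge0.
Qed.

Lemma measurable_bounded_design_event (B I : R) (n : nat) : (0 < n)%N ->
  measurable (bounded_design_event beta B I Xs n).
Proof.
move=> n0; have [I0|I0] := leP 0 I.
  rewrite bounded_design_eventE//; apply: measurable_design_forall.
  exact: measurable_design_set.
by rewrite bounded_design_event_neg.
Qed.

Lemma probability_bounded_design_event (B I eps : R) (n : nat) : (0 < n)%N ->
  P (~` bounded_design_event beta B I Xs n) = eps%:E ->
  P (bounded_design_event beta B I Xs n) = (1 - eps)%:E.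
Proof.
move=> n0 H; have mE := measurable_bounded_design_event B I n0.
rewrite -[X in P X]setCK probability_setC; last exact: measurableC.
by rewrite [X in (_ - X)%E](_ : _ = eps%:E).
Qed.

(* The probability [b] that [nbmean <= B] satisfies [1 - eps n <= b ^+ n], and [b < 1]
   would make the right-hand side vanish in the limit. *)
Lemma ae_nbmean_le (B : R) (In eps : nat -> R) :
  (forall n, (0 < n)%N ->
     P (~` bounded_design_event beta B (In n) Xs n) = (eps n)%:E) ->
  eps @ \oo --> (0 : R) ->
  {ae P, forall w, nbmean beta (xi 0%N w) <= B}.
Proof.
move=> hC2 heps; pose A := [set x : p.-tuple R | nbmean beta x <= B].
have mA : measurable A.
  rewrite -[A]setTI; apply: measurable_fun_le => //; exact: measurable_nbmean.
have mXA : measurable [set w | A (xi 0%N w)].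
  by rewrite -[X in measurable X]setTI; exact: (measurable_cvtuple (mZ 0%N)).
set b := fine (P [set w | A (xi 0%N w)]).
have bE : P [set w | A (xi 0%N w)] = b%:E by rewrite fineK// fin_num_measure.
have b0 : 0 <= b by rewrite fine_ge0.
have b1 : b <= 1 by rewrite -lee_fin -bE probability_le1.
have pow n : 1 - eps n.+1 <= b ^+ n.+1.
  rewrite -lee_fin -(probability_bounded_design_event (ltn0Sn n) (hC2 n.+1 (ltn0Sn n))).
  rewrite -(probability_design_forall _ mA); apply: le_measure; rewrite ?inE//.
  - exact: measurable_bounded_design_event.
  - exact: measurable_design_forall.
  - by move=> w [H _] i ni; rewrite /A /= /nbmean tdotE; exact: H.
have b1' : b = 1.
  apply/eqP; rewrite eq_le b1 /= leNgt; apply/negP => blt.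
  have c1 : (1 - eps n.+1) @[n --> \oo] --> (1 : R).
    rewrite -[X in _ --> X]subr0; apply: cvgB; first exact: cvg_cst.
    by rewrite (cvg_shiftS eps).
  have c2 : (b ^+ n.+1) @[n --> \oo] --> (0 : R).
    rewrite (cvg_shiftS (fun n => b ^+ n)).
    by apply: cvg_expr; rewrite ger0_norm.
  have : (1 : R) <= 0.
    rewrite -(cvg_lim _ c1)// -(cvg_lim _ c2)//.
    apply: ler_lim; [by apply/cvg_ex; exists 1|by apply/cvg_ex; exists 0|].
    exact: nearW.
  by rewrite ler10.
exists (~` [set w | A (xi 0%N w)]); split.
- exact: measurableC.
- by rewrite probability_setC// [X in (_ - X)%E]bE b1' subee.
- by move=> w /=.
Qed.

End design_event.

(** * Simultaneous deviations of the score and of the Hessian *)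

Section deviation_bounds.
Context (R : realType) (p : nat) (k : R) (beta : 'cV[R]_p).
Context (d : measure_display) (T : measurableType d).
Variables (P : probability T R) (Xs : nat -> T -> 'cV[R]_p) (Ys : nat -> T -> nat).
Hypothesis k_gt0 : 0 < k.
Hypothesis mZ : forall i, measurable_fun setT (obs (Xs i) (Ys i)).
Hypothesis indep : mutually_independent P (fun i => obs (Xs i) (Ys i)).
Hypothesis law : forall i, same_law P (obs (Xs i) (Ys i)) (obs (Xs 0%N) (Ys 0%N)).
Hypothesis hNB : nb_given P k beta (Xs 0%N) (Ys 0%N).
Variables (theta MX : R).
Hypothesis theta_gt0 : 0 < theta.
Hypothesis MX_gt0 : 0 < MX.
Hypothesis hX : forall j : 'I_p,
  (\int[P]_w (expR (`|Xs 0%N w j 0| `^ theta / MX `^ theta))%:E <= 2%:E)%E.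
Variables (B I : R).
Hypothesis B_gt0 : 0 < B.

Local Notation xi i w := (cvtuple (Xs i w)).
Local Notation D := (design_set beta B I).
Local Notation v := (nbvar k beta).

Lemma measurable_level_sum (n : nat) (c : R) (f : p.-tuple R * nat -> R) :
  measurable_fun setT f ->
  measurable [set w | c <= \sum_(i < n) f (xi i w, Ys i w)].
Proof.
move=> mf; rewrite -[X in measurable X]setTI; apply: measurable_fun_le => //.
by apply: measurable_sum => i; exact: (measurableT_comp mf (mZ i)).
Qed.

Let sgn1 (b : bool) : `|(-1) ^+ b : R| = 1.
Proof. by rewrite normrX normrN normr1 expr1n. Qed.

Let sgn2 (b : bool) : ((-1) ^+ b : R) ^+ 2 = 1.
Proof. by rewrite sqrr_sign. Qed.

Lemma design_coord_le (x : p.-tuple R) j : D x -> tnth x j ^+ 2 <= I ^+ 2.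
Proof.
move=> [_ xI]; apply: le_trans xI; rewrite /sqnorm (bigD1 j)//= lerDl.
by apply: sumr_ge0 => l _; exact: sqr_ge0.
Qed.

Let mind : measurable_fun setT (\1_D : p.-tuple R -> R).
Proof. by apply: measurable_indic; exact: measurable_design_set. Qed.

Lemma measurable_score_coord (b : bool) j :
  measurable_fun setT (fun s : p.-tuple R * nat =>
    (-1) ^+ b * (tnth s.1 j * \1_D s.1) * nbscore k beta s.1 s.2).
Proof.
apply: measurable_funM; last exact: measurable_nbscore.
apply: measurable_funM => //; apply: measurable_funM.
  exact: (measurableT_comp (measurable_tnth j)).
exact: (measurableT_comp mind).
Qed.

Lemma measurable_hessian_coord (b : bool) j l :
  measurable_fun setT (fun s : p.-tuple R * nat =>
    (-1) ^+ b * (tnth s.1 j * tnth s.1 l * \1_D s.1) * nbweight k beta s.1 s.2).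
Proof.
apply: measurable_funM; last exact: measurable_nbweight.
apply: measurable_funM => //; apply: measurable_funM.
  by apply: measurable_funM; exact: (measurableT_comp (measurable_tnth _)).
exact: (measurableT_comp mind).
Qed.

(** The indicator of the design set makes the coefficient at most [s * I] everywhere, as the moment
    generating function bound demands, and [b] selects the tail. The variance may be the untruncated
    one, which is larger. *)
Lemma score_coord_deviation (b : bool) j (n : nat) (s eta a : R) :
  0 < s -> 0 <= I -> s * I <= 1 / 20 -> B * (s * I) ^+ 2 <= 1 / 48 ->
  n%:R * (5 / 4 * (s ^+ 2 * \int[P]_w (v (xi 0%N w) * Xs 0%N w j 0 ^+ 2))) + a <=
    s * (n%:R * eta) ->
  (P [set w | (n%:R * eta <= \sum_(i < n)
      (-1) ^+ b * (tnth (xi i w) j * \1_D (xi i w)) * nbscore k beta (xi i w) (Ys i w))%R] <=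
    (expR (- a))%:E)%E.
Proof.
move=> s0 I0 sI BsI hs.
pose u (x : p.-tuple R) := s * ((-1) ^+ b * (tnth x j * \1_D x)).
have mu : measurable_fun setT u.
  by do 3 apply: measurable_funM => //; exact: measurable_tnth.
have uE x : u x = 0 \/ D x /\ u x ^+ 2 <= (s * I) ^+ 2.
  rewrite /u indicE; case: (boolP (_ \in _)) => [|_]; last by left; rewrite !mulr0.
  rewrite inE => Dx; right; split => //.
  rewrite mulr1 !exprMn sgn2 mul1r ler_wpM2l ?sqr_ge0//.
  exact: design_coord_le.
have u20 x : `|u x| <= 1 / 20.
  have [->|[_ ux]] := uE x; first by rewrite normr0.
  apply: le_trans sI; rewrite -(ler_pXn2r (n := 2))// ?nnegrE//.
    by rewrite real_normK ?num_real.
  by rewrite mulr_ge0// ltW.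
have u48 x : v x * u x ^+ 2 <= 1 / 48.
  have [->|[[mB _] ux]] := uE x; first by rewrite expr0n mulr0.
  apply: le_trans BsI; apply: ler_pM ux => //; last by apply: le_trans mB; exact: nbvar_le_mean.
    by rewrite ltW// nbvar_gt0.
  exact: sqr_ge0.
apply: le_trans (nbscore_deviation k_gt0 mZ indep law hNB n a mu u20 u48).
apply: le_measure; rewrite ?inE.
- exact: (measurable_level_sum _ _ (measurable_score_coord b j)).
- apply: (@measurable_level_sum _ _ (fun z => u z.1 * nbscore k beta z.1 z.2)).
  apply: measurable_funM; last exact: measurable_nbscore.
  exact: (measurableT_comp mu).
move=> w /= H.
have -> : \sum_(i < n) u (xi i w) * nbscore k beta (xi i w) (Ys i w) =
    s * \sum_(i < n) (-1) ^+ b * (tnth (xi i w) j * \1_D (xi i w)) *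
      nbscore k beta (xi i w) (Ys i w).
  by rewrite mulr_sumr; apply: eq_bigr => i _; rewrite /u; ring.
apply: le_trans (ler_wpM2l (ltW s0) H); apply: le_trans hs.
rewrite lerD2r ler_wpM2l// ler_wpM2l//.
have lv := L1_nbvar_sqr beta k_gt0 theta_gt0 MX_gt0 (mZ 0%N) hX j.
have v0 x : 0 <= v x := ltW (nbvar_gt0 beta k_gt0 x).
have pw w' : v (xi 0%N w') * u (xi 0%N w') ^+ 2 <= s ^+ 2 * (v (xi 0%N w') * Xs 0%N w' j 0 ^+ 2).
  rewrite [X in _ <= X]mulrCA ler_wpM2l ?v0//.
  rewrite /u tnth_mktuple !exprMn sgn2 mul1r ler_wpM2l ?sqr_ge0//.
  by rewrite indicE; case: (_ \in _); rewrite /= ?expr1n ?expr0n ?mulr1 ?mulr0 ?sqr_ge0.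
rewrite -RintegralZT//; apply: (le_RintegralT _ _ pw); last exact: L1Z.
apply: (L1_le _ (L1Z (s ^+ 2) lv)).
  have mX := measurable_cvtuple (mZ 0%N).
  apply: measurable_funM; first exact: (measurableT_comp (measurable_nbvar beta k_gt0)).
  by apply: measurable_funX; exact: (measurableT_comp mu).
move=> w'; rewrite ger0_norm; [exact: pw|exact: (mulr_ge0 (v0 _) (sqr_ge0 _))].
Qed.

(** The weight is not centred, so the truncated mean appears in the threshold with the sign of the
    tail. Here the second moment is truncated as well, because its bound relies on the radius of the
    design set. *)
Lemma hessian_coord_deviation (b : bool) j l (n : nat) (s t u a : R) :
  0 < s -> s * I ^+ 2 * (1 + B) <= 1 / 25 ->
  \int[P]_w ((v (xi 0%N w) + v (xi 0%N w) ^+ 2) *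
    (Xs 0%N w j 0 * Xs 0%N w l 0 * \1_D (xi 0%N w)) ^+ 2) <= u ->
  n%:R * (6 / 5 * (s ^+ 2 * u)) + a <= s * (n%:R * t) ->
  (P [set w | (n%:R * (t + (-1) ^+ b * \int[P]_w (v (xi 0%N w) *
         (Xs 0%N w j 0 * Xs 0%N w l 0 * \1_D (xi 0%N w)))) <= \sum_(i < n)
      (-1) ^+ b * (tnth (xi i w) j * tnth (xi i w) l * \1_D (xi i w)) *
        nbweight k beta (xi i w) (Ys i w))%R] <=
    (expR (- a))%:E)%E.
Proof.
move=> s0 sIB hu hs; set V := \int[P]_w (v (xi 0%N w) * _).
pose z (x : p.-tuple R) := s * (-1) ^+ b * (tnth x j * tnth x l * \1_D x).
have mz : measurable_fun setT z.
  apply: measurable_funM => //; apply: measurable_funM => //.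
  by apply: measurable_funM; exact: measurable_tnth.
have z25 x : `|z x| * (1 + v x) <= 1 / 25.
  rewrite /z indicE; case: (boolP (_ \in _)) => [|_]; last by rewrite !mulr0 normr0 mul0r.
  rewrite inE => Dx; apply: le_trans sIB.
  have vB : v x <= B by have [mB _] := Dx; apply: le_trans mB; exact: nbvar_le_mean.
  have v0 := nbvar_gt0 beta k_gt0 x.
  rewrite mulr1 normrM normrM sgn1 mulr1 (gtr0_norm s0).
  apply: ler_pM; [|by rewrite addr_ge0// ltW| |by rewrite lerD2l].
    by rewrite mulr_ge0// ltW.
  rewrite (ler_wpM2l (ltW s0))// normrM.
  have := design_coord_le j Dx; have := design_coord_le l Dx.
  rewrite -(real_normK (num_real (tnth x j))) -(real_normK (num_real (tnth x l))).
  by move: `|tnth x j| `|tnth x l| => e f; nra.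
apply: le_trans (nbweight_deviation k_gt0 mZ indep law hNB n a mz z25).
apply: le_measure; rewrite ?inE.
- exact: (measurable_level_sum _ _ (measurable_hessian_coord b j l)).
- apply: (@measurable_level_sum _ _ (fun y => z y.1 * nbweight k beta y.1 y.2)).
  apply: measurable_funM; last exact: measurable_nbweight.
  exact: (measurableT_comp mz).
move=> w /= H.
have -> : \sum_(i < n) z (xi i w) * nbweight k beta (xi i w) (Ys i w) =
    s * \sum_(i < n) (-1) ^+ b * (tnth (xi i w) j * tnth (xi i w) l * \1_D (xi i w)) *
      nbweight k beta (xi i w) (Ys i w).
  by rewrite mulr_sumr; apply: eq_bigr => i _; rewrite /z; ring.
apply: le_trans (ler_wpM2l (ltW s0) H).
have -> : \int[P]_w (v (xi 0%N w) * z (xi 0%N w)) = s * (-1) ^+ b * V.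
  rewrite -RintegralZT; last first.
    apply: (L1_nbvar_prod_restrict beta k_gt0 theta_gt0 MX_gt0 (mZ 0%N) hX).
    exact: measurable_design_set.
  by apply: eq_Rintegral => y _; rewrite /z !tnth_mktuple mulrCA.
have -> : \int[P]_w ((v (xi 0%N w) + v (xi 0%N w) ^+ 2) * z (xi 0%N w) ^+ 2) =
   s ^+ 2 * \int[P]_w ((v (xi 0%N w) + v (xi 0%N w) ^+ 2) *
    (Xs 0%N w j 0 * Xs 0%N w l 0 * \1_D (xi 0%N w)) ^+ 2).
  rewrite -RintegralZT; last exact: (L1_design_second_moment beta I k_gt0 theta_gt0 MX_gt0 B_gt0 (mZ 0%N) hX).
  have sq y : (s * (-1) ^+ b * y) ^+ 2 = s ^+ 2 * y ^+ 2.
    by rewrite exprMn [(s * _) ^+ 2]exprMn sgn2 mulr1.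
  by apply: eq_Rintegral => y _; rewrite /z !tnth_mktuple sq mulrCA.
apply: (@le_trans _ _ (n%:R * (s * (-1) ^+ b * V + 6 / 5 * (s ^+ 2 * u)) + a)).
  by rewrite lerD2r ler_wpM2l// lerD2l ler_wpM2l// ler_wpM2l ?sqr_ge0.
have := hs; set S := (-1) ^+ b => H'; lra.
Qed.

(** A union bound over [2 * p] signed score sums and [2 * p ^ 2] signed Hessian sums. When all
    covariates lie in the design set the indicators inside the sums equal 1; the centring stays at
    the truncated mean. *)
Lemma concentration_event (n : nat) (s eta a : R) (h t u : 'I_p -> 'I_p -> R) :
  0 < s -> 0 <= I -> s * I <= 1 / 20 -> B * (s * I) ^+ 2 <= 1 / 48 ->
  (forall j, n%:R * (5 / 4 * (s ^+ 2 * \int[P]_w (v (xi 0%N w) * Xs 0%N w j 0 ^+ 2))) + a <=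
    s * (n%:R * eta)) ->
  (forall j l, 0 < h j l /\ h j l * I ^+ 2 * (1 + B) <= 1 / 25) ->
  (forall j l, \int[P]_w ((v (xi 0%N w) + v (xi 0%N w) ^+ 2) *
    (Xs 0%N w j 0 * Xs 0%N w l 0 * \1_D (xi 0%N w)) ^+ 2) <= u j l) ->
  (forall j l, n%:R * (6 / 5 * (h j l ^+ 2 * u j l)) + a <= h j l * (n%:R * t j l)) ->
  exists F : set T,
    [/\ measurable F, (P F <= ((2 * p%:R + 2 * p%:R ^+ 2) * expR (- a))%:E)%E &
    forall w, ~ F w -> (forall i, (i < n)%N -> D (xi i w)) ->
      (forall j, `|\sum_(i < n) nbscore k beta (xi i w) (Ys i w) * Xs i w j 0| <= n%:R * eta) /\
      (forall j l, `|\sum_(i < n) nbweight k beta (xi i w) (Ys i w) * (Xs i w j 0 * Xs i w l 0)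
         - n%:R * \int[P]_w (v (xi 0%N w) * (Xs 0%N w j 0 * Xs 0%N w l 0 * \1_D (xi 0%N w)))|
         <= n%:R * t j l)].
Proof.
move=> s0 I0 sI BsI hs hh hu ht.
pose V j l := \int[P]_w (v (xi 0%N w) * (Xs 0%N w j 0 * Xs 0%N w l 0 * \1_D (xi 0%N w))).
pose F1 (jb : 'I_p * bool) := [set w | n%:R * eta <= \sum_(i < n)
  (-1) ^+ jb.2 * (tnth (xi i w) jb.1 * \1_D (xi i w)) * nbscore k beta (xi i w) (Ys i w)].
pose F2 (jb : 'I_p * 'I_p * bool) := [set w |
  n%:R * (t jb.1.1 jb.1.2 + (-1) ^+ jb.2 * V jb.1.1 jb.1.2) <= \sum_(i < n)
  (-1) ^+ jb.2 * (tnth (xi i w) jb.1.1 * tnth (xi i w) jb.1.2 * \1_D (xi i w)) *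
    nbweight k beta (xi i w) (Ys i w)].
have [] := @measure_bigsetU_le R d T P _ (enum {: 'I_p * bool}) F1 (expR (- a)).
- by move=> jb; exact: (measurable_level_sum _ _ (measurable_score_coord jb.2 jb.1)).
- by move=> [j b]; exact: (score_coord_deviation b s0 I0 sI BsI (hs j)).
rewrite -cardE card_prod card_ord card_bool => mF1 PF1.
have [] := @measure_bigsetU_le R d T P _ (enum {: 'I_p * 'I_p * bool}) F2 (expR (- a)).
- by move=> jb; exact: (measurable_level_sum _ _ (measurable_hessian_coord jb.2 jb.1.1 jb.1.2)).
- move=> [[j l] b]; have [h0 hI] := hh j l.
  exact: (hessian_coord_deviation b h0 hI (hu j l) (ht j l)).
rewrite -cardE !card_prod !card_ord card_bool => mF2 PF2.
exists (\big[setU/set0]_(jb <- enum {: 'I_p * bool}) F1 jb `|`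
        \big[setU/set0]_(jb <- enum {: 'I_p * 'I_p * bool}) F2 jb); split.
- exact: measurableU.
- apply: (le_trans (measureU2 _ mF1 mF2)); apply: (le_trans (leeD PF1 PF2)).
  rewrite -EFinD lee_fin !natrM le_eqVlt; apply/orP; left; apply/eqP; ring.
rewrite -!bigcup_seq => w nF wD.
have xE i (j : 'I_n) : tnth (xi j w) i * \1_D (xi j w) = Xs j w i 0.
  by rewrite tnth_mktuple indicE mem_set ?mulr1//; exact: wD.
split=> [j|j l].
  have nF1 b : ~ F1 (j, b) w.
    by move=> F1w; apply: nF; left; exists (j, b) => //=; rewrite mem_enum.
  have sE b : \sum_(i < n) (-1) ^+ b * (tnth (xi i w) j * \1_D (xi i w)) *
      nbscore k beta (xi i w) (Ys i w) =
    (-1) ^+ b * \sum_(i < n) nbscore k beta (xi i w) (Ys i w) * Xs i w j 0.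
    by rewrite mulr_sumr; apply: eq_bigr => i _; rewrite xE; ring.
  have := nF1 true; have := nF1 false; rewrite /F1 /= !sE expr0 expr1 mul1r mulN1r.
  by move=> /negP; rewrite -ltNge => h1 /negP; rewrite -ltNge => h2; rewrite ler_norml; lra.
have nF2 b : ~ F2 (j, l, b) w.
  by move=> F2w; apply: nF; right; exists (j, l, b) => //=; rewrite mem_enum.
have sE b : \sum_(i < n) (-1) ^+ b * (tnth (xi i w) j * tnth (xi i w) l * \1_D (xi i w)) *
    nbweight k beta (xi i w) (Ys i w) =
  (-1) ^+ b * \sum_(i < n) nbweight k beta (xi i w) (Ys i w) * (Xs i w j 0 * Xs i w l 0).
  rewrite mulr_sumr; apply: eq_bigr => i _; rewrite -(mulrA (tnth _ j)) xE tnth_mktuple; ring.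
have := nF2 true; have := nF2 false; rewrite /F2 /= !sE expr0 expr1 !mul1r !mulN1r -/(V j l).
by move=> /negP; rewrite -ltNge => h1 /negP; rewrite -ltNge => h2; rewrite ler_norml; lra.
Qed.

End deviation_bounds.

Section estimator_event.
Context (R : realType) (p : nat) (k : R) (beta : 'cV[R]_p).
Context (d : measure_display) (T : measurableType d).
Variables (P : probability T R) (Xs : nat -> T -> 'cV[R]_p) (Ys : nat -> T -> nat).
Hypothesis k_gt0 : 0 < k.
Hypothesis p_gt0 : (0 < p)%N.
Hypothesis mZ : forall i, measurable_fun setT (obs (Xs i) (Ys i)).
Hypothesis indep : mutually_independent P (fun i => obs (Xs i) (Ys i)).
Hypothesis law : forall i, same_law P (obs (Xs i) (Ys i)) (obs (Xs 0%N) (Ys 0%N)).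
Hypothesis hNB : nb_given P k beta (Xs 0%N) (Ys 0%N).
Variables (theta MX B I Cmin : R).
Hypothesis theta_gt0 : 0 < theta.
Hypothesis MX_gt0 : 0 < MX.
Hypothesis hX : forall j : 'I_p,
  (\int[P]_w (expR (`|Xs 0%N w j 0| `^ theta / MX `^ theta))%:E <= 2%:E)%E.
Hypothesis B0 : 0 < B.

Local Notation xi i w := (cvtuple (Xs i w)).
Local Notation D := (design_set beta B I).
Local Notation v := (nbvar k beta).
Local Notation ev := (\int[P]_w v (xi 0%N w)).
Local Notation xb := (\sum_j \int[P]_w
  (v (xi 0%N w) * (Xs 0%N w j 0 * Xs 0%N w j 0 * \1_(~` D) (xi 0%N w)))).

Hypothesis hH : forall b : 'cV[R]_p, norm2 b = 1 ->
  Cmin <= (b^T *m expectation_mx P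
    (fun w => nbweight k beta (xi 0%N w) (Ys 0%N w) *: (Xs 0%N w *m (Xs 0%N w)^T)) *m b) 0 0.

Variables (n : nat) (M s nu q l rad : R).
Local Notation N := (n%:R : R).
Hypothesis n_gt0 : (0 < n)%N.
Hypothesis M0 : 0 < M.
Hypothesis BM : B <= 3 / 4 * M.
Hypothesis ev0 : 0 <= ev.
Hypothesis evB : ev <= B.
Hypothesis evM : ev <= 3 / 2 * M ^+ 2.
Hypothesis s0 : 0 <= s.
Hypothesis psB : N * (p%:R * s) <= B.
Hypothesis C0 : 0 < Cmin.
Hypothesis nu0 : 0 < nu.
Hypothesis moment : forall j, \int[P]_w (v (xi 0%N w) * Xs 0%N w j 0 ^+ 2) <= nu * (ev + s).
Hypothesis H4 : 64 * (nu ^+ 2 * M ^+ 2) <= N * Cmin ^+ 2.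
Hypothesis q0 : 0 <= q.
Hypothesis H5 : 128 * (nu ^+ 2 * M ^+ 2) * q <= Cmin ^+ 2.
Hypothesis H6 : N * q <= l.
Hypothesis l0 : 0 < l.
Hypothesis I0 : 0 <= I.
Hypothesis xb_le : xb <= p%:R * (nu * (B * q + s)).
Hypothesis rad0 : 0 < rad.
Hypothesis radI : rad * I <= 1 / 9.
Hypothesis rad_ge : 72 * (M ^+ 2 * nu * p%:R * l) <= N * Cmin ^+ 2 * rad ^+ 2.

(** The level [2 * l] matches a number of tails quadratic in [p], as
    [expR (- l) = delta / (2 * p)]. *)
Lemma estimator_event : exists F : set T,
  [/\ measurable F, (P F <= ((2 * p%:R + 2 * p%:R ^+ 2) * expR (- (2 * l)))%:E)%E &
  forall w, ~ F w -> (forall i, (i < n)%N -> D (xi i w)) -> forall b,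
    ((exists c, is_argmin (empirical_risk k Xs Ys n w) c) ->
      is_argmin (empirical_risk k Xs Ys n w) b) -> norm2 (b - beta) <= rad].
Proof.
have N1 : 1 <= N by rewrite ler1n.
have N0 : 0 < N by rewrite ltr0n.
have p1 : 1 <= p%:R :> R by rewrite ler1n.
have p0 : 0 < p%:R :> R by rewrite ltr0n.
have Ce : Cmin <= nu * (ev + s).
  apply: le_trans (moment (Ordinal p_gt0)).
  exact: (hessian_le_nbvar_sqr k_gt0 theta_gt0 MX_gt0 (mZ 0%N) hNB hX hH).
have H1 : (81 * 72) * (M ^+ 2 * nu * p%:R * l * I ^+ 2) <= N * Cmin ^+ 2.
  have rI : rad ^+ 2 * I ^+ 2 <= 1 / 81.
    have -> : 1 / 81 = (1 / 9) ^+ 2 :> R by field.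
    by rewrite -exprMn ler_pXn2r ?nnegrE ?mulr_ge0// ltW.
  have NC : 0 <= N * Cmin ^+ 2 := mulr_ge0 (ltW N0) (sqr_ge0 _).
  have h := ler_wpM2r (sqr_ge0 I) rad_ge.
  have h2 := ler_wpM2l NC rI.
  lra.
have trace := nbvar_trace_le B I k_gt0 theta_gt0 MX_gt0 (mZ 0%N) hNB hX hH.
have xbC := design_bias_small N1 p1 B0 M0 BM ev0 evB s0 psB C0 nu0 Ce H4 q0 H5 H6 H1 xb_le trace.
have Ip := radius_gt0 N1 p1 B0 M0 BM evB s0 psB C0 nu0 Ce H4 H5 I0 xb_le trace.
have budget := hessian_budget N1 p1 B0 M0 BM ev0 evB evM s0 psB C0 nu0 Ce H4 l0 H1.
have hscale := hessian_scale_small N1 p1 B0 M0 BM ev0 evB evM s0 psB C0 nu0 Ce H4 H5 l0 I0 H1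
  xb_le trace.
have sqp1 : 1 <= Num.sqrt p%:R :> R by rewrite -[leLHS]sqrtr1 ler_wsqrtr.
have sqp2 : Num.sqrt p%:R ^+ 2 = p%:R :> R by rewrite sqr_sqrtr// ltW.
have g0 := score_step_gt0 M0 C0 nu0 rad0 sqp1.
have g1 := score_scale_small N1 p1 B0 M0 BM ev0 evM s0 psB C0 nu0 Ce H4 radI sqp1.
have g2 := score_variance_small N1 p1 B0 M0 BM ev0 evB evM s0 psB C0 nu0 Ce H4 I0 rad0 radI sqp1.
have g3 j := score_budget N1 p1 B0 M0 BM ev0 evM s0 psB C0 nu0 Ce H4 l0 rad_ge sqp1 sqp2 (moment j).
pose U j i := \int[P]_w ((v (xi 0%N w) + v (xi 0%N w) ^+ 2) *
    (Xs 0%N w j 0 * Xs 0%N w i 0 * \1_D (xi 0%N w)) ^+ 2).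
set U0 := (1 + B) * I ^+ 2 * (p%:R * (nu * (ev + s))) in budget hscale.
have U0_gt0 : 0 < U0.
  apply: mulr_gt0; last by apply: (mulr_gt0 p0); exact: lt_le_trans Ce.
  by apply: mulr_gt0; [exact: addr_gt0|exact: exprn_gt0].
have U_ge0 j i : 0 <= U j i.
  apply: Rintegral_ge0 => w _; apply: mulr_ge0; last exact: sqr_ge0.
  have v0 := ltW (nbvar_gt0 beta k_gt0 (xi 0%N w)).
  exact: (addr_ge0 v0 (sqr_ge0 _)).
have U_sum : \sum_j \sum_i U j i <= U0.
  have I2 : 0 <= (1 + B) * I ^+ 2 by rewrite mulr_ge0 ?sqr_ge0// addr_ge0// ltW.
  apply: (le_trans (nbvar_second_moment_le beta I k_gt0 theta_gt0 MX_gt0 B0 (mZ 0%N) hX)).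
  rewrite /U0 ler_wpM2l// natr_mul_sum; apply: ler_sum => j _; exact: moment.
(* The added term keeps every step [h j i] in the range of the moment generating
   function bound, at the cost of doubling the sum of the variances. *)
pose u j i := U j i + U0 / p%:R ^+ 2.
have u_gt0 j i : 0 < u j i by rewrite ltr_wpDl// divr_gt0// exprn_gt0.
pose h j i := Num.sqrt (2 * l / (N * u j i)).
(* The constant makes [ht] an equality: [6 / 5 * (2 * l) + 2 * l = 11 / 5 * (2 * l)]. *)
pose t j i := 11 / 5 * Num.sqrt (2 * l * u j i / N).
have h_gt0 j i : 0 < h j i by rewrite sqrtr_gt0 divr_gt0 ?mulr_gt0.
have ht j i : N * (6 / 5 * (h j i ^+ 2 * u j i)) + 2 * l <= h j i * (N * t j i).
  have a0 : 0 <= 2 * l / (N * u j i) by rewrite ltW// divr_gt0 ?mulr_gt0.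
  have hN : h j i * Num.sqrt (2 * l * u j i / N) = 2 * l / N.
    rewrite /h -sqrtrM//.
    have -> : 2 * l / (N * u j i) * (2 * l * u j i / N) = (2 * l / N) ^+ 2.
      by field; rewrite !gt_eqF.
    by rewrite sqrtr_sqr ger0_norm// ltW// divr_gt0// mulr_gt0.
  have -> : h j i * (N * t j i) = 11 / 5 * (N * (h j i * Num.sqrt (2 * l * u j i / N))).
    by rewrite /t; ring.
  rewrite hN sqr_sqrtr//.
  have -> : 2 * l / (N * u j i) * u j i = 2 * l / N by field; rewrite !gt_eqF.
  have -> : N * (6 / 5 * (2 * l / N)) = 12 / 5 * l by field; rewrite gt_eqF.
  have -> : 11 / 5 * (N * (2 * l / N)) = 22 / 5 * l by field; rewrite gt_eqF.
  by have := l0; lra.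
have [||F [mF PF HF]] := concentration_event k_gt0 mZ indep law hNB theta_gt0 MX_gt0 hX B0
  (n := n) g0 I0 g1 g2 g3 _ _ ht.
- move=> j i; split; first exact: h_gt0.
  by apply: hscale; rewrite lerDr.
- by move=> j i; rewrite lerDl ltW// divr_gt0// exprn_gt0.
have t_small : \sum_j \sum_i t j i ^+ 2 <= Cmin ^+ 2 / 64.
  apply: le_trans budget; apply: (@le_trans _ _ (\sum_j \sum_i 11 / 5 * (11 / 5) * (2 * l / N) * u j i)).
    apply: ler_sum => j _; apply: ler_sum => i _.
    rewrite exprMn sqr_sqrtr; last by rewrite ltW// divr_gt0 ?mulr_gt0.
    by rewrite le_eqVlt; apply/orP; left; apply/eqP; field; rewrite gt_eqF.
  under eq_bigr do rewrite -mulr_sumr.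
  have A0 : 0 <= 11 / 5 * (11 / 5) * (2 * l / N) by rewrite ltW// mulr_gt0// divr_gt0// mulr_gt0.
  rewrite -mulr_sumr [X in _ <= X]mulrA ler_wpM2l//.
  under eq_bigr do rewrite big_split/= sumr_const card_ord -[_ *+ p]mulr_natl.
  rewrite big_split/= sumr_const card_ord -[_ *+ p]mulr_natl.
  have -> : p%:R * (p%:R * (U0 / p%:R ^+ 2)) = U0 by field; rewrite gt_eqF.
  by have := U_sum; lra.
have V_lower (y : 'cV[R]_p) : norm2 y = 1 -> 31 / 32 * Cmin <= \sum_j \sum_i y j 0 * y i 0 *
    \int[P]_w (v (xi 0%N w) * (Xs 0%N w j 0 * Xs 0%N w i 0 * \1_D (xi 0%N w))).
  move=> y1; have := nbvar_design_lower B I k_gt0 theta_gt0 MX_gt0 (mZ 0%N) hNB hX hH y1.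
  by apply: le_trans; move: xbC; lra.
exists F; split => // w nF wD b hb.
have [score hess] := HF w nF wD.
exact: (@estimator_close R p k beta n (fun i => Xs i w) (fun i => Ys i w) _ _ _ _ _ _ k_gt0 p_gt0 n_gt0 rad0 C0 I0 radI wD score hess t_small V_lower b hb).
Qed.

End estimator_event.

Lemma measurable_norm2_ball (R : realType) (p : nat) d (T : measurableType d)
  (f : T -> 'cV[R]_p) (b : 'cV[R]_p) (r : R) :
  measurable_fun setT (fun w => cvtuple (f w)) ->
  measurable [set w | norm2 (f w - b) <= r].
Proof.
move=> mf; have -> : [set w | norm2 (f w - b) <= r] =
    [set w | Num.sqrt (\sum_j (tnth (cvtuple (f w)) j - b j 0) ^+ 2) <= r].
  apply/funext => w; congr (is_true (Num.sqrt _ <= _)); apply: eq_bigr => j _.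
  by rewrite tnth_mktuple !mxE.
rewrite -[X in measurable X]setTI; apply: measurable_fun_le => //.
apply: (@measurableT_comp _ _ _ _ _ _ (@Num.sqrt R)).
  apply: continuous_measurable_fun; exact: sqrt_continuous.
apply: measurable_sum => j; apply: measurable_funX; apply: measurable_funB => //.
exact: (measurableT_comp (measurable_tnth j) mf).
Qed.

Theorem theorem3 (R : realType) (d : measure_display) (T : measurableType d)
  (P : probability T R) (p : nat) (hp : (0 < p)%N)
  (Xs : nat -> T -> 'cV[R]_p) (Ys : nat -> T -> nat)
  (X : T -> 'cV[R]_p) (Y : T -> nat)
  (hiid : iid_sample P Xs Ys X Y)
  (k : R) (hk : 0 < k)
  (betastar : 'cV[R]_p)
  (hbetastar : is_argmin (population_risk P k X Y) betastar)
  (hNB : forall i, nb_given P k betastar (Xs i) (Ys i))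
  (theta MX MY B Cmin : R)
  (htheta0 : 0 < theta) (htheta1 : theta < 1)
  (hMX : 0 < MX) (hMY : 0 < MY) (hCmin : 0 < Cmin)
  (hC1 : forall n, (0 < n)%N -> tail_condition P theta MX MY Xs Ys n)
  (In eps : nat -> R)
  (hIn : nondecreasing_seq In)
  (hC2 : forall n, (0 < n)%N ->
     P (~` bounded_design_event betastar B (In n) Xs n) = (eps n)%:E)
  (heps : eps @ \oo --> (0 : R))
  (hC3 : forall n, (0 < n)%N -> hessian_condition P k Cmin betastar Xs Ys n)
  (betahat : nat -> T -> 'cV[R]_p)
  (hbetahat : forall n, (0 < n)%N -> is_estimator k Xs Ys n (betahat n))
  (delta : R) (hdelta0 : 0 < delta) (hdelta1 : delta < 1)
  (n : nat) (hn : (0 < n)%N)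
  (hsize : rate n p theta delta MX MY B Cmin * In n <= ln (4 / 3) / 3) :
  ((1 - 2 * p%:R ^+ 2 * c_const n p k theta delta MX MY B Cmin
      - delta - eps n)%:E
   <= P [set w | (norm2 (betahat n w - betastar)
                  <= rate n p theta delta MX MY B Cmin)%R])%E.
Proof.
have [_ mZ indep lawX] := hiid.
have law i : same_law P (obs (Xs i) (Ys i)) (obs (Xs 0%N) (Ys 0%N)).
  by move=> A mA; rewrite lawX// lawX.
set c := c_const _ _ _ _ _ _ _ _ _; set rad := rate _ _ _ _ _ _ _ _ in hsize *.
set target := [set w | _].
have [triv|pos] := leP (1 - 2 * p%:R ^+ 2 * c - delta - eps n) 0.
  by apply: le_trans (measure_ge0 P target); rewrite lee_fin.
have c_ge0 : 0 <= c by rewrite addr_ge0// expR_ge0.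
have eps_ge0 : 0 <= eps n by rewrite -lee_fin -hC2.
have p1 : 1 <= p%:R :> R by rewrite ler1n.
have p0 : 0 < p%:R :> R by rewrite ltr0n.
have N0 : 0 < n%:R :> R by rewrite ltr0n.
have pc : c <= 2 * p%:R ^+ 2 * c.
  by rewrite ler_peMl//; have : 1 <= p%:R ^+ 2 :> R by [exact: exprn_ege1]; lra.
have PE := probability_bounded_design_event mZ hn (hC2 n hn).
(* Any sample in the design event shows [0 < B] and [0 <= In n], since exponentials are positive and
   norms nonnegative. *)
have [w0 [mB0 xI0]] : bounded_design_event betastar B (In n) Xs n !=set0.
  apply/set0P/eqP => E0; move: PE; rewrite E0 measure0 => -[].
  by move: c_ge0 pc pos hdelta0; lra.
have B0 : 0 < B by apply: lt_le_trans (mB0 0%N hn); exact: expR_gt0.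
have I0 : 0 <= In n by apply: le_trans (xI0 0%N hn); exact: sqrtr_ge0.
have hB := ae_nbmean_le mZ indep law hC2 heps.
have [hY1 hX1] := hC1 1%N isT.
have mX := measurable_coord (mZ 0%N).
have hX j := subweibull_norm_le htheta0 hMX (mX j) (hX1 0%N j isT).
have mY : measurable_fun setT (fun w => (Ys 0%N w)%:R : R).
  exact: (measurableT_comp (f := fun y : nat => y%:R : R) _ (measurable_count (mZ 0%N))).
have hY := subweibull_norm_le ltr01 hMY mY (hY1 0%N isT).
have hH (b : 'cV[R]_p) : norm2 b = 1 -> Cmin <= (b^T *m expectation_mx P (fun w =>
    nbweight k betastar (cvtuple (Xs 0%N w)) (Ys 0%N w) *: (Xs 0%N w *m (Xs 0%N w)^T)) *m b) 0 0.
  (* At sample size 1 the Hessian condition concerns the first observation only. *)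
  have -> : (fun w => nbweight k betastar (cvtuple (Xs 0%N w)) (Ys 0%N w) *:
      (Xs 0%N w *m (Xs 0%N w)^T)) = empirical_hessian k Xs Ys 1 betastar.
    apply/funext => w.
    by rewrite /empirical_hessian big_ord1 invr1 scale1r /nbweight /nbmean tdotE.
  exact: hC3.
set D := design_set betastar B (In n).
set q := fine (P ((fun w => cvtuple (Xs 0%N w)) @^-1` (~` D))).
have mD : measurable D by exact: measurable_design_set.
have mDX : measurable [set w | D (cvtuple (Xs 0%N w))].
  by rewrite -[X in measurable X]setTI; exact: (measurable_cvtuple (mZ 0%N)).
have q_ge0 : 0 <= q by rewrite fine_ge0.
have DqE : fine (P [set w | D (cvtuple (Xs 0%N w))]) = 1 - q.
  have : P (~` [set w | D (cvtuple (Xs 0%N w))]) = (1 - P [set w | D (cvtuple (Xs 0%N w))])%E.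
    exact: probability_setC.
  by rewrite /q => ->; rewrite fineB ?fin_num_measure//= opprB addrC subrK.
(* The left side is [(1 - q) ^ n], or less when the design event is written coordinatewise: here it
   is equal to it, and [1 - q <= expR (- q)]. *)
have q_exp : 1 - eps n <= expR (- (n%:R * q)).
  rewrite -lee_fin -PE (bounded_design_eventE _ _ _ _ I0).
  rewrite (probability_design_forall mZ indep law _ mD) DqE lee_fin -mulrN expRM_natl.
  have q1 : 0 <= 1 - q by rewrite -DqE fine_ge0.
  by rewrite ler_pXn2r ?nnegrE ?expR_ge0// expR_ge1Dx.
set lam := ln (2 * n%:R * p%:R / delta).
set l := ln (2 * p%:R / delta).
have l0 : 0 < l by exact: log_ratio_gt0.
have c_small : 2 * p%:R ^+ 2 * c < 1 by move: pos hdelta0; lra.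
have Ce : Cmin <= k * (2 * (MX ^+ 2 * (2 / theta) `^ (2 / theta) * expR (- (2 / theta)))).
  apply: le_trans (nbvar_sqr_le_max betastar hk htheta0 hMX (mZ 0%N) hX (Ordinal hp)).
  exact: (hessian_le_nbvar_sqr hk htheta0 hMX (mZ 0%N) (hNB 0%N) hX hH).
have hlam := lam_ge hn hp hk htheta0 hdelta0 hdelta1 hMX hCmin c_small Ce.
have M0 : 0 < M_BX MY B by exact: M_BX_gt0.
have nu0 : 0 < MX ^+ 2 * lam `^ (2 / theta) by exact: nu_gt0.
have rad0 : 0 < rad by exact: rate_gt0.
have H4 := sample_size_subexponential hn hp htheta0 hdelta0 hdelta1 hMX hMY B0 c_small.
have lamE : expR (- lam) = delta / (2 * n%:R * p%:R).
  by rewrite expRN lnK ?posrE ?invf_div// divr_gt0// !mulr_gt0.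
have ev0 : 0 <= \int[P]_w nbvar k betastar (cvtuple (Xs 0%N w)).
  by apply: Rintegral_ge0 => w _; rewrite ltW// nbvar_gt0.
have evB := nbvar_expectation_le hk B0 (mZ 0%N) hB.
have evM := nbvar_expectation_le_M2 hk hMY B0 (mZ 0%N) (hNB 0%N) hY hB (erefl (M_BX MY B)).
have s0 : 0 <= 2 * B * expR (- lam).
  by apply: mulr_ge0 (expR_ge0 _); rewrite mulr_ge0// ltW.
have psB : n%:R * (p%:R * (2 * B * expR (- lam))) <= B.
  have -> : n%:R * (p%:R * (2 * B * expR (- lam))) = B * delta.
    by rewrite lamE; field; rewrite !gt_eqF.
  by rewrite ler_piMr// ltW.
have moment j := nbvar_sqr_le hk htheta0 hMX B0 (mZ 0%N) hX hB j hlam.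
(* With [K] the factor of [q], [expR (- (n * Cmin ^ 2 / K)) <= c < 1 - eps n <= expR (- (n * q))];
   the exponents are then compared. *)
have H5 : 128 * ((MX ^+ 2 * lam `^ (2 / theta)) ^+ 2 * M_BX MY B ^+ 2) * q <= Cmin ^+ 2.
  have := c_const_ge_subexponential k Cmin hn hp htheta0 hdelta0 hdelta1 hMX hMY B0.
  rewrite -/lam -/c; set K := _ * (_ ^+ 2 * _) => cK.
  have K0 : 0 < K by apply: mulr_gt0 => //; apply: mulr_gt0; exact: exprn_gt0.
  have : expR (- (n%:R * Cmin ^+ 2 / K)) < expR (- (n%:R * q)).
    apply: (le_lt_trans cK); apply: lt_le_trans q_exp.
    by move: pos pc hdelta0; clear; lra.
  rewrite ltr_expR ltrN2 ltr_pdivlMr// -mulrA ltr_pM2l// mulrC => /ltW.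
  by [].
(* Likewise [expR (- l) = delta / (2 * p) <= delta < 1 - eps n <= expR (- (n * q))]. *)
have H6 : n%:R * q <= l.
  rewrite -lerN2 -ler_expR; apply: le_trans q_exp.
  have -> : expR (- l) = delta / (2 * p%:R).
    by rewrite expRN lnK ?posrE ?invf_div// divr_gt0// mulr_gt0.
  have c2 : 0 <= 2 * p%:R ^+ 2 * c by apply: le_trans pc.
  have : delta / (2 * p%:R) <= delta by rewrite ler_pdivrMr ?mulr_gt0// ler_peMr ?(ltW hdelta0)//; move: p1; clear; lra.
  by move: pos c2; clear; lra.
have xb_le := nbvar_bias_le (In n) hk htheta0 hMX B0 (mZ 0%N) hX hB hlam.
have radI : rad * In n <= 1 / 9.
  apply: (le_trans hsize); have : ln (4 / 3) <= 1 / 3 :> R.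
    have -> : 4 / 3 = 1 + 1 / 3 :> R by field.
    by apply: le_ln1Dx; clear; lra.
  by clear; lra.
have rad_ge := rate_sqr_ge hn hp htheta0 hdelta0 hdelta1 hMX hMY B0 hCmin.
have [F [mF PF HF]] := estimator_event hk hp mZ indep law (hNB 0%N) htheta0 hMX hX B0 hH hn M0
  (B_le_M_BX hMY B0) ev0 evB evM s0 psB hCmin nu0 moment H4 q_ge0 H5 H6 l0 I0 xb_le rad0 radI rad_ge.
have [mbetahat hbest] := hbetahat n hn.
have mtarget : measurable target by exact: measurable_norm2_ball.
have sub : bounded_design_event betastar B (In n) Xs n `<=` target `|` F.
  move=> w; rewrite (bounded_design_eventE _ _ _ _ I0) => wD.
  have [?|nF] := pselect (F w); first by right.
  by left; exact: (HF w nF wD _ (hbest w)).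
have : (P (bounded_design_event betastar B (In n) Xs n) <= P target + P F)%E.
  apply: le_trans (measureU2 _ mtarget mF); apply: le_measure; rewrite ?inE//.
    exact: (measurable_bounded_design_event _ mZ).
  exact: measurableU.
rewrite PE => H.
(* The total is [delta ^ 2 * (1 / (2 * p) + 1 / 2)], at most [delta ^ 2]. *)
have PFd : (P F <= delta%:E)%E.
  apply: (le_trans PF); rewrite lee_fin.
  have -> : expR (- (2 * l)) = (delta / (2 * p%:R)) ^+ 2.
    rewrite -mulrN -[2]/(2%:R) expRM_natl; congr (_ ^+ 2).
    by rewrite expRN lnK ?posrE ?invf_div// divr_gt0// mulr_gt0.
  have -> : (2 * p%:R + 2 * p%:R ^+ 2) * (delta / (2 * p%:R)) ^+ 2 =
      delta * (delta * (1 / 2 * p%:R^-1 + 1 / 2)) by field; rewrite gt_eqF.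
  have pV : p%:R^-1 <= 1 :> R by rewrite invf_le1.
  have pV0 : 0 < p%:R^-1 :> R by rewrite invr_gt0.
  rewrite ler_piMr ?(ltW hdelta0)//.
  by move: pV pV0 hdelta0 hdelta1; clear; nra.
have {}H := le_trans H (leeD2l _ PFd).
have Pt : P target = (fine (P target))%:E by rewrite fineK// fin_num_measure.
move: H; rewrite Pt -EFinD !lee_fin.
by move: c_ge0 pc; clear; lra.
Qed.
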